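(* Let $\alpha:\Gamma\curvearrowright G$ be an action of a countable discrete group $\Gamma$ on a compact quantum group $G$ by quantum automorphisms, and let $\mathbb{G}$ be the crossed product quantum group. There are canonical group isomorphisms $$\mathrm{Int}(\mathbb{G})\simeq\Gamma\,{}_\alpha\!\ltimes\mathrm{Int}(G)\quad\text{and}\quad\chi(\mathbb{G})\simeq\chi(G)^\alpha\times\mathrm{Sp}(\Gamma).$$ The second one is moreover a homeomorphism.
   Context: For a compact quantum group $G$: $C_m(G)$ is the maximal C*-algebra (assumed separable) and $\Delta_G$ its comultiplication. $\mathrm{Aut}(G)=\{\alpha\in\mathrm{Aut}(C_m(G)):\Delta_G\circ\alpha=(\alpha\otimes\alpha)\circ\Delta_G\}$; an action by quantum automorphisms is a group homomorphism $\alpha:\Gamma\to\mathrm{Aut}(G)$. The crossed product quantum group $\mathbb{G}$ has $C_m(\mathbb{G})$ equal to the full crossed product of $C_m(G)$ by $\Gamma$, generated by a copy $\alpha(C_m(G))$ of $C_m(G)$ and unitaries $u_\gamma$ with $u_\gamma\alpha(a)u_\gamma^*=\alpha(\alpha_\gamma(a))$, with comultiplication given by $\Delta_{\mathbb{G}}(u_\gamma)=u_\gamma\otimes u_\gamma$, $\Delta_{\mathbb{G}}\circ\alpha=(\alpha\otimes\alpha)\circ\Delta_G$. $\mathrm{Int}(G)=\{u\in\mathcal U(C_m(G)):\Delta_G(u)=u\otimes u\}$, a group under multiplication, on which $\Gamma$ acts by $\gamma\cdot u=\alpha_\gamma(u)$; $\Gamma\,{}_\alpha\!\ltimes\mathrm{Int}(G)$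 is the corresponding semi-direct product. $\chi(G)$ is the set of characters of $C_m(G)$, a compact group with product $gh=(g\otimes h)\circ\Delta_G$ and the weak* topology; $\chi(G)^\alpha=\{\chi\in\chi(G):\chi\circ\alpha_\gamma=\chi\ \forall\gamma\in\Gamma\}$ is a closed subgroup. $\mathrm{Sp}(\Gamma)$ is the compact group of one-dimensional unitary representations of $\Gamma$ (pointwise multiplication and pointwise convergence). *)

(* Defs.v *)
From HB Require Import structures.
From mathcomp Require Import all_boot all_order all_algebra.
From mathcomp Require Import boolp classical_sets functions cardinality.
From mathcomp Require Import reals topology normedtype sequences.
From mathcomp Require Import complex.

Set Implicit Arguments.
Unset Strict Implicit.
Unset Printing Implicit Defensive.

Import Order.TTheory GRing.Theory Num.Theory.
Import numFieldNormedType.Exports.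
Local Open Scope classical_set_scope.
Local Open Scope ring_scope.

(* Nonzero unital C*-algebras. The product is a field of its own because a   *)
(* structure joining a ring with a norm that is not multiplicative cannot be *)
(* placed next to [numDomainType]. Norms are nonnegative elements of [R[i]]. *)
HB.mixin Record isCStar (R : realType) A of CompleteNormedModule R[i] A := {
  cone : A;
  cmul : A -> A -> A;
  star : A -> A;
  cmulA : associative cmul;
  cmul1x : left_id cone cmul;
  cmulx1 : right_id cone cmul;
  cmulDl : left_distributive cmul +%R;
  cmulDr : right_distributive cmul +%R;
  cmulZl : forall (c : R[i]) x y, cmul (c *: x) y = c *: cmul x y;
  cmulZr : forall (c : R[i]) x y, cmul x (c *: y) = c *: cmul x y;
  cone_neq0 : cone != 0;
  starK : involutive star;
  starD : {morph star : x y / x + y};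
  starZ : forall (c : R[i]) x, star (c *: x) = c^* *: star x;
  starM : forall x y, star (cmul x y) = cmul (star y) (star x);
  normM_le : forall x y : A, `|cmul x y| <= `|x| * `|y|;
  cstar_norm : forall x : A, `|cmul (star x) x| = `|x| ^+ 2
}.

#[short(type="cstarType")]
HB.structure Definition CStar (R : realType) :=
  {A of isCStar R A & CompleteNormedModule R[i] A}.

HB.mixin Record isHilbert (R : realType) H of CompleteNormedModule R[i] H := {
  dot : {dot H for @Num.conj R[i]};
  dot_norm : forall x : H, `|x| ^+ 2 = dot x x
}.

#[short(type="hilbertType")]
HB.structure Definition Hilbert (R : realType) :=
  {H of isHilbert R H & CompleteNormedModule R[i] H}.

Notation "x ** y" := (cmul x y) (at level 40, left associativity) : ring_scope.

(* An alias of [R[i]], because the library reserves the completeness instance *)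
(* on [_^o] for real numbers.                                                 *)
Definition cplx (R : realType) : Type := R[i].

HB.instance Definition _ (R : realType) := Num.ClosedField.on (cplx R).
HB.instance Definition _ (R : realType) :=
  NormedModule.copy (cplx R) (R[i]^o).

Section ComplexNumbers.
Variable R : realType.
Local Notation C := (cplx R).

Lemma normc_le_ReIm (z : R[i]) :
  `|z| <= (`|complex.Re z| + `|complex.Im z|)%:C%C.
Proof.
rewrite normc_def lecR -[leRHS]ger0_norm ?addr_ge0// -sqrtr_sqr.
by rewrite ler_sqrt ?sqr_ge0// sqrrD !real_normK ?num_real// addrAC
  lerDl mulrn_wge0 ?mulr_ge0.
Qed.

Lemma normc_ge_Im (z : R[i]) : `|complex.Im z|%:C%C <= `|z|.
Proof.
rewrite normc_def lecR -sqrtr_sqr ler_sqrt ?addr_ge0 ?sqr_ge0//.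
by rewrite lerDr sqr_ge0.
Qed.

Lemma complexo_complete (F : set_system C) :
  ProperFilter F -> cauchy F -> cvg F.
Proof.
move=> FF /cauchy_ballP Fc.
have part (f : C -> R) (fB : forall x y, f (x - y) = f x - f y)
    (fle : forall x : C, (`|f x|)%:C%C <= `|x| :> R[i]) : cvg (f @ F).
  apply/cauchy_cvgP/cauchy_ballP => e e0.
  have e0' : 0 < e%:C%C :> R[i] by rewrite ltcR.
  have [[A B] /= [FA FB] AB] := Fc _ e0'.
  exists (f @` A, f @` B) => /=.
    split.
      by apply: filterS FA => x Ax; exists x.
    by apply: filterS FB => x Bx; exists x.
  move=> [_ _] /= [[x Ax <-] [y By <-]].
  have /= := AB (x, y) (conj Ax By).
  rewrite -!ball_normE /= => xy.
  by rewrite -ltcR; apply: le_lt_trans xy; rewrite -fB.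
have /cvg_ex[/= a Fa] := part (fun z : C => complex.Re (z : R[i]))
  (fun x y => raddfB _ x y) (@normc_ge_Re R).
have /cvg_ex[/= b Fb] := part (fun z : C => complex.Im (z : R[i]))
  (fun x y => raddfB _ x y) normc_ge_Im.
apply/cvg_ex; exists ((a +i* b)%C : C).
apply/cvgrPdist_lt => e e0.
have [e' -> e'0] : exists2 e', e = e'%:C%C & 0 < e'.
  have /complex_realP[e' ee'] : e \is Num.real by rewrite gtr0_real.
  by exists e' => //; rewrite -ltcR -ee'.
have e2 : 0 < e' / 2 by rewrite divr_gt0.
move/cvgrPdist_lt : Fa => /(_ _ e2) Fa.
move/cvgrPdist_lt : Fb => /(_ _ e2) Fb.
apply: filterS2 Fa Fb => -[x y] /= xa yb.
apply: le_lt_trans (normc_le_ReIm _) _ => /=.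
by rewrite ltcR [ltRHS]splitr ltrD.
Qed.

HB.instance Definition _ := Uniform_isComplete.Build C complexo_complete.

Definition cdot (x y : C) : R[i] := (x : R[i]) * (y : R[i])^*.

Lemma cdot_bilinear :
  bilinear_for (GRing.Scale.Law.clone _ _ ( *%R ) _)
    (GRing.Scale.Law.clone _ _ (@Num.conj R[i] \; *%R) _) cdot.
Proof.
split => [z c x y|z c x y]; rewrite /cdot /=.
  by rewrite mulrDl -mulrA.
by rewrite rmorphD rmorphM mulrDr mulrCA.
Qed.

HB.instance Definition _ :=
  bilinear_isBilinear.Build R[i] C C R[i] _ _ cdot cdot_bilinear.

Lemma cdot_hermitian (x y : C) :
  cdot x y = (-1) ^+ false * (cdot y x)^*.
Proof. by rewrite /cdot expr0 mul1r rmorphM /= conjCK mulrC. Qed.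

Lemma cdot_gt0 (x : C) : x != 0 -> 0 < cdot x x.
Proof. by move=> x0; rewrite /cdot -normCK exprn_gt0// normr_gt0. Qed.

HB.instance Definition _ :=
  isHermitianSesquilinear.Build R[i] C false (@Num.conj R[i]) cdot
    cdot_hermitian.
HB.instance Definition _ := isDotProduct.Build R[i] C cdot cdot_gt0.

Lemma cdot_norm (x : C) : `|x| ^+ 2 = cdot x x.
Proof. exact: normCK. Qed.

HB.instance Definition _ :=
  isHilbert.Build R C (dot := (cdot : {dot C for @Num.conj R[i]})) cdot_norm.

Local Notation cm := (@GRing.mul R[i]).
Local Notation cj := (@Num.conj R[i]).

Lemma complexo_cmulZl (c : R[i]) (x y : C) : cm (c *: x) y = c *: (cm x y : C).
Proof. by rewrite [LHS]mulrAC [RHS]mulrA mulrAC. Qed.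

Lemma complexo_cmulZr (c : R[i]) (x y : C) : cm x (c *: y) = c *: (cm x y : C).
Proof. exact: mulrCA. Qed.

Lemma complexo_starM (x y : C) : cj (cm x y) = cm (cj y) (cj x).
Proof. by rewrite rmorphM mulrC. Qed.

Lemma complexo_normM_le (x y : C) : `|cm x y : C| <= `|x| * `|y|.
Proof. by rewrite -normrM. Qed.

Lemma complexo_cstar_norm (x : C) : `|cm (cj x) x : C| = `|x| ^+ 2.
Proof. by rewrite [LHS]normrM norm_conjC expr2. Qed.

HB.instance Definition _ := isCStar.Build R C (cone := (1 : R[i]))
  (cmul := cm) (star := cj)
  (@mulrA _) (@mul1r _) (@mulr1 _) (@mulrDl _) (@mulrDr _)
  complexo_cmulZl complexo_cmulZr (@oner_neq0 _) (@conjCK _) (rmorphD _)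
  (fun c x => rmorphM _ c x) complexo_starM complexo_normM_le
  complexo_cstar_norm.
End ComplexNumbers.

Record starhom_on (R : realType) (A B : cstarType R) (P : set A) (f : A -> B)
    : Prop := StarHomOn {
  hom_linear_on : forall (c : R[i]) x y, P x -> P y ->
    f (c *: x + y) = c *: f x + f y;
  hom_mul_on : forall x y, P x -> P y -> f (x ** y) = f x ** f y;
  hom_one_on : f cone = cone;
  hom_star_on : forall x, P x -> f (star x) = star (f x)
}.

Record starhom (R : realType) (A B : cstarType R) := StarHom {
  hom_fun :> A -> B;
  homP : starhom_on [set: A] hom_fun
}.

Definition idhom (R : realType) (A : cstarType R) : starhom A A :=
  @StarHom R A A id (@StarHomOn R A A setT id (fun _ _ _ _ _ => erefl)
    (fun _ _ _ _ => erefl) erefl (fun _ _ => erefl)).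

Record starrep (R : realType) (A : cstarType R) (H : hilbertType R) := StarRep {
  rep_fun :> A -> H -> H;
  rep_linear : forall a (c : R[i]) x y,
    rep_fun a (c *: x + y) = c *: rep_fun a x + rep_fun a y;
  rep_bounded : forall a, exists M : R[i], forall x, `|rep_fun a x| <= M * `|x|;
  rep_linear_alg : forall (c : R[i]) a b x,
    rep_fun (c *: a + b) x = c *: rep_fun a x + rep_fun b x;
  rep_mul : forall a b x, rep_fun (a ** b) x = rep_fun a (rep_fun b x);
  rep_one : forall x, rep_fun cone x = x;
  rep_star : forall a x y, dot (rep_fun a x) y = dot x (rep_fun (star a) y)
}.

Section StarHomTheory.
Variables (R : realType) (A B : cstarType R).
Implicit Types (c : R[i]).

Lemma hom_linear (f : starhom A B) c x y : f (c *: x + y) = c *: f x + f y.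
Proof. by case: f => f [/= + _ _ _]; apply. Qed.

Lemma hom_mul (f : starhom A B) x y : f (x ** y) = f x ** f y.
Proof. by case: f => f [/= _ + _ _]; apply. Qed.

Lemma hom_one (f : starhom A B) : f cone = cone.
Proof. by case: f => f []. Qed.

Lemma hom_star (f : starhom A B) x : f (star x) = star (f x).
Proof. by case: f => f [/= _ _ _]; apply. Qed.

Lemma starhom_eq (f g : starhom A B) : f =1 g -> f = g.
Proof.
case: f g => [f fP] [g gP] /= /funext fg; move: fP gP; rewrite fg => fP gP.
by rewrite (Prop_irrelevance fP gP).
Qed.

Lemma comp_rep_subproof (H : hilbertType R) (f : starhom A B)
    (pi : starrep B H) :
  exists rho : starrep A H, forall a x, rho a x = pi (f a) x.
Proof.
have l := rep_linear pi; have b := rep_bounded pi; have la := rep_linear_alg pi.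
have m := rep_mul pi; have o := rep_one pi; have s := rep_star pi.
unshelve eexists.
  apply: (@StarRep R A H (fun a x => pi (f a) x)).
  - by move=> a; apply: l.
  - by move=> a; apply: b.
  - by move=> c a a' x; rewrite hom_linear la.
  - by move=> a a' x; rewrite hom_mul m.
  - by move=> x; rewrite hom_one o.
  - by move=> a x y; rewrite hom_star s.
by [].
Qed.

Lemma cmul0x (x : A) : 0 ** x = 0.
Proof. by have := cmulZl 0 0 x; rewrite !scale0r. Qed.

Lemma cmulx0 (x : A) : x ** 0 = 0.
Proof. by have := cmulZr 0 x 0; rewrite !scale0r. Qed.

Lemma cmulNx (x y : A) : (- x) ** y = - (x ** y).
Proof. by rewrite -scaleN1r cmulZl scaleN1r. Qed.

Lemma cmulxN (x y : A) : x ** (- y) = - (x ** y).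
Proof. by rewrite -scaleN1r cmulZr scaleN1r. Qed.

Lemma cmul_suml I (s : seq I) (F : I -> A) y :
  (\sum_(i <- s) F i) ** y = \sum_(i <- s) F i ** y.
Proof.
elim: s => [|i s IH]; first by rewrite !big_nil cmul0x.
by rewrite !big_cons cmulDl IH.
Qed.

Lemma cmul_sumr I (s : seq I) (F : I -> A) y :
  y ** (\sum_(i <- s) F i) = \sum_(i <- s) y ** F i.
Proof.
elim: s => [|i s IH]; first by rewrite !big_nil cmulx0.
by rewrite !big_cons cmulDr IH.
Qed.

Lemma star0 : star 0 = 0 :> A.
Proof. by have := starZ 0 (0 : A); rewrite scale0r conjC0 scale0r. Qed.

Lemma starN (x : A) : star (- x) = - star x.
Proof. by rewrite -scaleN1r starZ rmorphN1 scaleN1r. Qed.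

Lemma star_sum I (s : seq I) (F : I -> A) :
  star (\sum_(i <- s) F i) = \sum_(i <- s) star (F i).
Proof.
elim: s => [|i s IH]; first by rewrite !big_nil star0.
by rewrite !big_cons starD IH.
Qed.

Lemma star_one : star cone = cone :> A.
Proof. by rewrite -[LHS]cmul1x -[X in X ** _]starK -starM cmul1x starK. Qed.

Lemma norm_star (x : A) : `|star x| = `|x|.
Proof.
have le (y : A) : `|y| <= `|star y|.
  have [->|y0] := eqVneq y 0; first by rewrite normr0.
  have : `|y| * `|y| <= `|star y| * `|y|.
    by rewrite -expr2 -cstar_norm normM_le.
  by rewrite ler_pM2r// normr_gt0.
by apply/eqP; rewrite eq_le le andbT -[leRHS](congr1 _ (starK x)) le.
Qed.

End StarHomTheory.

Definition tens_sum (R : realType) (A B D : cstarType R) (p : A -> D)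
    (q : B -> D) (s : seq (A * B)) : D :=
  \sum_(a <- s) p a.1 ** q a.2.

(* A finite sequence [t] of pairs stands for the vector                      *)
(* [\sum_(x <- t) x.1 (x) x.2] of the algebraic tensor product of [H] and    *)
(* [K], and [htens_sqnorm t] for its squared norm in the Hilbert space       *)
(* tensor product, in which these vectors are dense.                         *)
Definition htens_sqnorm (R : realType) (H K : hilbertType R)
    (t : seq (H * K)) : R[i] :=
  \sum_(x <- t) \sum_(y <- t) dot x.1 y.1 * dot x.2 y.2.

Definition tens_act (R : realType) (A B : cstarType R) (H K : hilbertType R)
    (pi : starrep A H) (rho : starrep B K) (s : seq (A * B)) (t : seq (H * K)) :
    seq (H * K) :=
  [seq (pi a.1 x.1, rho a.2 x.2) | a <- s, x <- t].

(* [M] bounds the operator norm of                                           *)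
(* [\sum_(a <- s) pi a.1 (x) rho a.2] for all representations [pi], [rho].   *)
Definition spatial_bound (R : realType) (A B : cstarType R) (s : seq (A * B))
    (M : R[i]) : Prop :=
  forall (H K : hilbertType R) (pi : starrep A H) (rho : starrep B K)
    (t : seq (H * K)),
    htens_sqnorm (tens_act pi rho s t) <= M ^+ 2 * htens_sqnorm t.

(* A realization of the minimal tensor product: the completion of the        *)
(* algebraic tensor product of [A] and [B] for the spatial norm, which is    *)
(* the supremum over [pi], [rho] of the above operator norms. Such a         *)
(* realization is unique up to a unique isomorphism.                         *)
Record mintensor (R : realType) (A B : cstarType R) := MinTensor {
  tens_alg :> cstarType R;
  tinl : starhom A tens_alg;
  tinr : starhom B tens_alg;
  tens_comm : forall a b, tinl a ** tinr b = tinr b ** tinl a;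
  tens_dense : dense (range (tens_sum tinl tinr));
  tens_bound : forall s, spatial_bound s `|tens_sum tinl tinr s|;
  tens_least : forall s M, 0 <= M -> spatial_bound s M ->
    `|tens_sum tinl tinr s| <= M
}.
Arguments tinl {R A B} _.
Arguments tinr {R A B} _.

Section TensSum.
Variables (R : realType) (A B D : cstarType R).
Variables (p : starhom A D) (q : starhom B D).
Hypothesis pq : forall a b, p a ** q b = q b ** p a.
Implicit Types s : seq (A * B).

Definition tscale (c : R[i]) s := [seq (c *: a.1, a.2) | a <- s].
Definition tmul s s' :=
  [seq (a.1 ** b.1, a.2 ** b.2) | a <- s, b <- s'].
Definition tstar s := [seq (star a.1, star a.2) | a <- s].

Lemma tens_sum_cat s s' :
  tens_sum p q (s ++ s') = tens_sum p q s + tens_sum p q s'.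
Proof. exact: big_cat. Qed.

Lemma hom0 (E : cstarType R) (f : starhom A E) : f 0 = 0.
Proof.
have := hom_linear f (-1) 0 0.
by rewrite scaleN1r addrC subrr scaleN1r addNr.
Qed.

Lemma homZ (E : cstarType R) (f : starhom A E) (c : R[i]) x :
  f (c *: x) = c *: f x.
Proof. by have := hom_linear f c x 0; rewrite hom0 !addr0. Qed.

Lemma tens_sum_scale c s : tens_sum p q (tscale c s) = c *: tens_sum p q s.
Proof.
rewrite /tens_sum big_map scaler_sumr; apply: eq_bigr => a _ /=.
by rewrite homZ cmulZl.
Qed.

Lemma tens_sum_mul s s' :
  tens_sum p q (tmul s s') = tens_sum p q s ** tens_sum p q s'.
Proof.
rewrite /tens_sum /tmul cmul_suml.
elim: s => [|a s IH]; first by rewrite !big_nil.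
rewrite /= big_cat big_cons IH; congr (_ + _).
rewrite big_map cmul_sumr; apply: eq_bigr => b _ /=.
by rewrite !hom_mul !cmulA -[p a.1 ** q a.2 ** p b.1]cmulA -pq cmulA.
Qed.

Lemma tens_sum_star s : tens_sum p q (tstar s) = star (tens_sum p q s).
Proof.
rewrite /tens_sum big_map star_sum; apply: eq_bigr => a _ /=.
by rewrite starM pq !hom_star.
Qed.

Lemma tens_sum_one : tens_sum p q [:: (cone, cone)] = cone.
Proof. by rewrite /tens_sum big_seq1 !hom_one cmul1x. Qed.
End TensSum.

Lemma posmin (R : numFieldType) (e e' : R) : 0 < e -> 0 < e' ->
  exists2 d, 0 < d & d <= e /\ d <= e'.
Proof.
move=> e0 e'0.
have /orP[le|le] : (e <= e') || (e' <= e).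
  by apply: real_comparable; exact: gtr0_real.
  by exists e.
by exists e'.
Qed.

Section Extension.
Variables (R : realType) (A B D : cstarType R) (T : mintensor A B).
Variables (p : starhom A D) (q : starhom B D).
Hypothesis pq : forall a b, p a ** q b = q b ** p a.
Local Notation ts := (tens_sum (tinl T) (tinr T)).
Local Notation ps := (tens_sum p q).
Hypothesis pqT : forall s, `|ps s| <= `|ts s|.

Let ext (x : T) (c : D) := forall e : R[i], 0 < e ->
  exists s, `|x - ts s| < e /\ `|c - ps s| < e.

Let ps_dist s s' : `|ps s - ps s'| <= `|ts s - ts s'|.
Proof.
have := pqT (s ++ tscale (-1) s').
by rewrite !tens_sum_cat !tens_sum_scale !scaleN1r.
Qed.

Let ext_approx (x : T) (e : R[i]) : 0 < e -> exists s, `|x - ts s| < e.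
Proof.
move=> e0.
have := @tens_dense _ _ _ T (ball x e)^°.
case.
- by exists x; apply: nbhsx_ballx.
- exact: open_interior.
- move=> y [/interior_subset + [s _ sy]]; rewrite -ball_normE /= -sy => xs.
  by exists s.
Qed.

Let ext_uniq x c c' : ext x c -> ext x c' -> c = c'.
Proof.
move=> xc xc'; apply/eqP; rewrite -subr_eq0 -normr_le0.
apply/ler_addgt0Pr => e e0; rewrite add0r.
have e4 : 0 < e / 2 / 2 by rewrite !divr_gt0.
have [s [xs cs]] := xc _ e4; have [s' [xs' cs']] := xc' _ e4.
have -> : c - c' = (c - ps s) + (ps s - ps s') + (ps s' - c').
  by rewrite !subrKA.
have -> : e = e / 2 / 2 + (e / 2 / 2 + e / 2 / 2) + e / 2 / 2.
  by rewrite -splitr addrAC -splitr -splitr.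
apply: le_trans (ler_normD _ _) _; apply: lerD; last by rewrite distrC ltW.
apply: le_trans (ler_normD _ _) _; apply: lerD; first exact: ltW.
apply: le_trans (ps_dist _ _) _.
have -> : ts s - ts s' = (ts s - x) + (x - ts s') by rewrite addrA subrK.
apply: le_trans (ler_normD _ _) _; apply: lerD; last exact: ltW.
by rewrite distrC ltW.
Qed.

Let ext_exists x : exists c, ext x c.
Proof.
pose b (e : R[i]) : set D := [set ps s | s in [set s | `|x - ts s| < e]].
pose F : set_system D := filter_from [set e | 0 < e] b.
have FF : ProperFilter F.
  apply: filter_from_proper; last first.
    by move=> e /= /(ext_approx x)[s xs]; exists (ps s); exists s.
  apply: filter_from_filter; first by exists 1 => /=.
  move=> e e' /= e0 e'0; have [d d0 [de de']] := posmin e0 e'0.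
  exists d => //= _ [s /= xs <-]; split; exists s => //=.
    exact: lt_le_trans de.
  exact: lt_le_trans de'.
have : cauchy F.
  apply/cauchy_ballP => e e0.
  have e2 : 0 < e / 2 by rewrite divr_gt0.
  exists (b (e / 2), b (e / 2)) => /=.
    by split; exists (e / 2).
  move=> [_ _] /= [[s /= xs <-] [s' /= xs' <-]].
  rewrite -ball_normE /=; apply: le_lt_trans (ps_dist _ _) _.
  have -> : ts s - ts s' = (ts s - x) + (x - ts s') by rewrite addrA subrK.
  apply: le_lt_trans (ler_normD _ _) _; rewrite [ltRHS]splitr.
  by rewrite ltrD// distrC.
move=> /cauchy_cvg/cvg_ex[c Fc]; exists c => e e0.
have [e' /= e'0 be'] : F (ball c e) by apply: Fc; apply: nbhsx_ballx.
have [d d0 [de de']] := posmin e0 e'0.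
have [s xs] := ext_approx x d0; exists s; split.
  exact: lt_le_trans de.
have : ball c e (ps s) by apply: be'; exists s => //=; apply: lt_le_trans de'.
by rewrite -ball_normE.
Qed.

Let ext_ts s : ext (ts s) (ps s).
Proof. by move=> e e0; exists s; rewrite !subrr !normr0. Qed.

Let ext_lin (k : R[i]) x y c d : ext x c -> ext y d ->
  ext (k *: x + y) (k *: c + d).
Proof.
move=> xc yd e e0.
have k1 : 0 < `|k| + 1 by rewrite ltr_wpDl.
have e1 : 0 < e / (`|k| + 1) by rewrite !divr_gt0.
have [s [xs cs]] := xc _ e1; have [s' [ys ds]] := yd _ e1.
exists (tscale k s ++ s').
have est (V : normedModType R[i]) (u v u' v' : V) :
    `|u - u'| < e / (`|k| + 1) -> `|v - v'| < e / (`|k| + 1) ->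
    `|k *: u + v - (k *: u' + v')| < e.
  move=> uu vv.
  rewrite opprD addrACA -scalerBr; apply: le_lt_trans (ler_normD _ _) _.
  rewrite normrZ; have -> : e = `|k| * (e / (`|k| + 1)) + e / (`|k| + 1).
    by rewrite -[X in _ * _ + X]mul1r -mulrDl mulrCA divff ?mulr1// gt_eqF.
  by rewrite ler_ltD// ler_wpM2l// ltW.
by rewrite !tens_sum_cat !tens_sum_scale; split; apply: est.
Qed.

Let ext_mul x y c d : ext x c -> ext y d -> ext (x ** y) (c ** d).
Proof.
move=> xc yd e e0.
pose K := `|x| + `|y| + `|c| + `|d| + 1.
have K0 : 0 < K by rewrite ltr_wpDl// !addr_ge0.
have eK : 0 < e + K by rewrite addr_gt0.
pose r := e / (e + K).
have r0 : 0 < r by rewrite divr_gt0.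
have r1 : r <= 1 by rewrite ler_pdivrMr// mul1r lerDl ltW.
have rK : r * K < e.
  by rewrite /r mulrAC ltr_pdivrMr// ltr_pM2l// ltrDr.
have [s [xs cs]] := xc _ r0; have [s' [ys ds]] := yd _ r0.
exists (tmul s s').
have est (V : cstarType R) (u v u' v' : V) : `|u| + `|v| + 1 <= K ->
    `|u - u'| < r -> `|v - v'| < r -> `|u ** v - u' ** v'| < e.
  move=> uvK uu vv; apply: le_lt_trans rK.
  have -> : u ** v - u' ** v' = (u - u') ** v + u' ** (v - v').
    by rewrite cmulDl cmulDr cmulxN cmulNx addrA subrK.
  apply: le_trans (ler_normD _ _) _.
  apply: le_trans (_ : r * `|v| + (r + `|u|) * r <= _).
    apply: lerD.
      by apply: le_trans (normM_le _ _) _; rewrite ler_wpM2r// ltW.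
    apply: le_trans (normM_le _ _) _; apply: ler_pM => //; last exact: ltW.
    have -> : u' = (u' - u) + u by rewrite subrK.
    apply: le_trans (ler_normD _ _) _.
    by rewrite lerD2r distrC ltW.
  rewrite [(_ + _) * r]mulrC -mulrDr ler_wpM2l ?(ltW r0)//.
  apply: le_trans uvK.
  by rewrite addrCA [leRHS]addrC [`|u| + `|v|]addrC lerD2r.
rewrite tens_sum_mul ?tens_sum_mul//; last exact: tens_comm.
split; apply: est => //; rewrite lerD2r /K -!addrA.
  by rewrite lerD2l lerDl addr_ge0.
by rewrite !addrA -[leRHS]addrA lerDr addr_ge0.
Qed.

Let ext_star x c : ext x c -> ext (star x) (star c).
Proof.
move=> xc e e0; have [s [xs cs]] := xc _ e0; exists (tstar s).
rewrite !tens_sum_star//; last exact: tens_comm.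
by rewrite -!starN -!starD !norm_star.
Qed.

Let ext_norm x c : ext x c -> `|c| <= `|x|.
Proof.
move=> xc; apply/ler_addgt0Pr => e e0.
have e2 : 0 < e / 2 by rewrite divr_gt0.
have [s [xs cs]] := xc _ e2.
rewrite -[c](subrK (ps s)); apply: le_trans (ler_normD _ _) _.
have -> : `|x| + e = e / 2 + (e / 2 + `|x|).
  by rewrite addrA -splitr addrC.
apply: lerD; first exact: ltW.
apply: le_trans (pqT _) _.
rewrite -[ts s](subrK x); apply: le_trans (ler_normD _ _) _.
by rewrite lerD2r distrC ltW.
Qed.

Lemma tens_hom_exists : exists f : starhom T D,
  [/\ forall a, f (tinl T a) = p a, forall b, f (tinr T b) = q b &
      forall x, `|f x| <= `|x|].
Proof.
have [f fP] := choice ext_exists.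
have fE x c : ext x c -> f x = c by move=> xc; apply: (ext_uniq (fP x)).
have homf : starhom_on setT f.
  split.
  - by move=> c x y _ _; apply: fE; apply: ext_lin.
  - by move=> x y _ _; apply: fE; apply: ext_mul.
  - apply: fE; rewrite -(tens_sum_one (tinl T) (tinr T)) -(tens_sum_one p q).
    exact: ext_ts.
  - by move=> x _; apply: fE; apply: ext_star.
exists (StarHom homf); split => [a|b|x] /=; last exact: ext_norm (fP x).
  have := ext_ts [:: (a, cone)]; move=> /fE.
  by rewrite /tens_sum !big_seq1 /= !hom_one !cmulx1.
have := ext_ts [:: (cone, b)]; move=> /fE.
by rewrite /tens_sum !big_seq1 /= !hom_one !cmul1x.
Qed.
End Extension.

Section TensorMaps.
Variables (R : realType) (A B A' B' : cstarType R).

Lemma tens_map_exists (T : mintensor A B) (T' : mintensor A' B')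
    (f : starhom A A') (g : starhom B B') :
  exists h : starhom T T', [/\ forall a, h (tinl T a) = tinl T' (f a),
    forall b, h (tinr T b) = tinr T' (g b) & forall x, `|h x| <= `|x|].
Proof.
have c1 (f' : starhom A A') : exists k : starhom A T', forall a, k a = tinl T' (f' a).
  unshelve eexists.
    apply: (@StarHom _ _ _ (fun a => tinl T' (f' a))); split.
    - by move=> c x y _ _; rewrite !hom_linear.
    - by move=> x y _ _; rewrite !hom_mul.
    - by rewrite !hom_one.
    - by move=> x _; rewrite !hom_star.
  by [].
have c2 (f' : starhom B B') : exists k : starhom B T', forall a, k a = tinr T' (f' a).
  unshelve eexists.
    apply: (@StarHom _ _ _ (fun a => tinr T' (f' a))); split.
    - by move=> c x y _ _; rewrite !hom_linear.
    - by move=> x y _ _; rewrite !hom_mul.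
    - by rewrite !hom_one.
    - by move=> x _; rewrite !hom_star.
  by [].
have [p pE] := c1 f; have [q qE] := c2 g.
have pq a b : p a ** q b = q b ** p a by rewrite pE qE tens_comm.
have [|h [hl hr hn]] := @tens_hom_exists R A B T' T p q pq.
  move=> s.
  have -> : tens_sum p q s =
      tens_sum (tinl T') (tinr T') [seq (f a.1, g a.2) | a <- s].
    by rewrite /tens_sum big_map; apply: eq_bigr => a _; rewrite pE qE.
  apply: tens_least => // H K pi rho t.
  have [pi' piE] := comp_rep_subproof f pi.
  have [rho' rhoE] := comp_rep_subproof g rho.
  have := tens_bound T s pi' rho' t; congr (htens_sqnorm _ <= _).
  rewrite /tens_act allpairs_mapl; apply: eq_allpairs => a x /=.
  by rewrite piE rhoE.
by exists h; split => [a|b|x]; rewrite ?hl ?hr ?pE ?qE.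
Qed.

Definition tens_map (T : mintensor A B) (T' : mintensor A' B')
    (f : starhom A A') (g : starhom B B') : starhom T T' :=
  projT1 (cid (tens_map_exists T T' f g)).

Lemma tens_map_inl T T' f g a :
  tens_map T T' f g (tinl T a) = tinl T' (f a).
Proof. by rewrite /tens_map; case: cid => h []. Qed.

Lemma tens_map_inr T T' f g b :
  tens_map T T' f g (tinr T b) = tinr T' (g b).
Proof. by rewrite /tens_map; case: cid => h []. Qed.

Lemma tens_map_norm T T' f g x : `|tens_map T T' f g x| <= `|x|.
Proof. by rewrite /tens_map; case: cid => h []. Qed.
End TensorMaps.

Section TensorChar.
Variables (R : realType) (A B : cstarType R) (T : mintensor A B).

Lemma char_rep_exists (E : cstarType R) (g : starhom E (cplx R)) :
  exists pi : starrep E (cplx R), forall a x, pi a x = g a ** x.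
Proof.
unshelve eexists.
  apply: (@StarRep _ _ _ (fun a x => g a ** x)).
  - by move=> a c x y; rewrite cmulDr cmulZr.
  - by move=> a; exists `|g a| => x; apply: normM_le.
  - by move=> c a b x; rewrite hom_linear cmulDl cmulZl.
  - by move=> a b x; rewrite hom_mul cmulA.
  - by move=> x; rewrite hom_one cmul1x.
  - move=> a x y; rewrite hom_star.
    by rewrite /dot /= /cdot /= rmorphM /= conjCK mulrCA mulrA.
by [].
Qed.

Lemma tens_char_exists (g : starhom A (cplx R)) (h : starhom B (cplx R)) :
  exists k : starhom T (cplx R), [/\ forall a, k (tinl T a) = g a,
    forall b, k (tinr T b) = h b & forall x, `|k x| <= `|x|].
Proof.
apply: tens_hom_exists => [a b|s]; first exact: mulrC.
have [pi piE] := char_rep_exists g; have [rho rhoE] := char_rep_exists h.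
have := tens_bound T s pi rho [:: (cone, cone)].
have -> : tens_act pi rho s [:: (cone, cone)] = [seq (g a.1, h a.2) | a <- s].
  rewrite /tens_act; elim: s => //= a s ->.
  by rewrite piE rhoE !cmulx1.
have -> : htens_sqnorm [:: (cone : cplx R, cone : cplx R)] = 1.
  by rewrite /htens_sqnorm !big_seq1 /dot /= /cdot !rmorph1 !mulr1.
have -> : htens_sqnorm [seq (g a.1, h a.2) | a <- s] =
    `|tens_sum g h s| ^+ 2.
  rewrite [RHS]normCK /htens_sqnorm big_map /tens_sum rmorph_sum mulr_suml.
  apply: eq_bigr => a _; rewrite big_map mulr_sumr; apply: eq_bigr => b _.
  by rewrite /dot /= /cdot [in RHS]rmorphM /= mulrACA.
rewrite mulr1 ler_pXn2r ?nnegrE//.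
Qed.
End TensorChar.

Lemma tens_hom_eq (R : realType) (A B D : cstarType R) (T : mintensor A B)
    (f g : starhom T D) :
  (forall x, `|f x| <= `|x|) -> (forall x, `|g x| <= `|x|) ->
  (forall a, f (tinl T a) = g (tinl T a)) ->
  (forall b, f (tinr T b) = g (tinr T b)) -> f =1 g.
Proof.
move=> fn gn fgl fgr x; apply/eqP; rewrite -subr_eq0 -normr_le0.
apply/ler_addgt0Pr => e e0; rewrite add0r.
have e2 : 0 < e / 2 by rewrite divr_gt0.
have [||y [/interior_subset + [s _ sy]]] := @tens_dense _ _ _ T (ball x (e / 2))^°.
- by exists x; apply: nbhsx_ballx.
- exact: open_interior.
rewrite -ball_normE /= -sy; set z := tens_sum _ _ s => /ltW xz.
have homB (h : starhom T D) u v : h (u - v) = h u - h v.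
  by rewrite addrC -scaleN1r hom_linear scaleN1r addrC.
have hom_sum (h : starhom T D) : h z =
    \sum_(a <- s) h (tinl T a.1) ** h (tinr T a.2).
  rewrite /z /tens_sum; elim: s {sy z xz} => [|a s IH].
    by rewrite !big_nil hom0.
  by rewrite !big_cons -[X in X + _]scale1r hom_linear scale1r IH hom_mul.
have fgz : f z = g z.
  by rewrite !hom_sum; apply: eq_bigr => a _; rewrite fgl fgr.
have -> : f x - g x = f (x - z) + g (z - x).
  by rewrite !homB fgz subrKA.
apply: le_trans (ler_normD _ _) _; rewrite [leRHS]splitr lerD//.
  exact: le_trans (fn _) _.
by apply: le_trans (gn _) _; rewrite distrC.
Qed.

Definition lin_span (R : realType) (A : cstarType R) (S : set A) : set A :=
  [set x | exists2 s : seq (R[i] * A),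
    (forall i, (i < size s)%N -> S (nth (0, 0) s i).2) &
    x = \sum_(a <- s) a.1 *: a.2].

Definition unitary (R : realType) (A : cstarType R) (u : A) : Prop :=
  u ** star u = cone /\ star u ** u = cone.

Section Comultiplication.
Variables (R : realType) (A : cstarType R) (T : mintensor A A).
Variable Delta : starhom A T.

(* [assoc] is the identification of [(A (x) A) (x) A] with [A (x) (A (x) A)]. *)
Definition coassociative : Prop :=
  exists (TL : mintensor T A) (TR : mintensor A T) (assoc : starhom TL TR),
  [/\ forall a, assoc (tinl TL (tinl T a)) = tinl TR a,
      forall a, assoc (tinl TL (tinr T a)) = tinr TR (tinl T a),
      forall a, assoc (tinr TL a) = tinr TR (tinr T a) &
      forall a, assoc (tens_map T TL Delta (idhom A) (Delta a)) =
                tens_map T TR (idhom A) Delta (Delta a)].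

Definition cancellative : Prop :=
  dense (lin_span [set x | exists a b, x = Delta a ** tinl T b]) /\
  dense (lin_span [set x | exists a b, x = Delta a ** tinr T b]).

Definition unitary_corep (n : nat) (u : 'M[A]_n) : Prop :=
  [/\ forall i j, \sum_k u i k ** star (u j k) = if i == j then cone else 0,
      forall i j, \sum_k star (u k i) ** u k j = if i == j then cone else 0 &
      forall i j, Delta (u i j) = \sum_k tinl T (u i k) ** tinr T (u k j)].

(* The *-algebra Pol(G), spanned by the coefficients of the finite           *)
(* dimensional unitary representations of G.                                 *)
Definition Pol : set A :=
  lin_span [set x | exists (n : nat) (u : 'M[A]_n) i j,
    unitary_corep u /\ x = u i j].

(* [A] is the enveloping C*-algebra of Pol(G).                               *)
Definition maximal : Prop :=
  forall (D : cstarType R) (f : A -> D), starhom_on Pol f ->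
    exists g : starhom A D, forall x, Pol x -> g x = f x.

End Comultiplication.

(* A compact quantum group G, given by the pair (C_m(G), Delta_G). The       *)
(* coercion to [cstarType] is C_m(G).                                        *)
Record cqg (R : realType) := CQG {
  cqg_alg :> cstarType R;
  cqg_sq : mintensor cqg_alg cqg_alg;
  comul : starhom cqg_alg cqg_sq;
  cqg_separable : exists2 S : set cqg_alg, countable S & dense S;
  cqg_coassoc : coassociative comul;
  cqg_cancel : cancellative comul;
  cqg_maximal : maximal comul
}.
Arguments cqg_sq {R} _.
Arguments comul {R} _.

Definition pure_tens (R : realType) (G : cqg R) (a b : G) : cqg_sq G :=
  tinl (cqg_sq G) a ** tinr (cqg_sq G) b.

Definition qaut (R : realType) (G : cqg R) (f : starhom G G) : Prop :=
  bijective f /\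
  forall a, comul G (f a) = tens_map (cqg_sq G) (cqg_sq G) f f (comul G a).

Record qaction (R : realType) (Gam : groupType) (G : cqg R) := QAction {
  qact :> Gam -> starhom G G;
  qact_aut : forall g, qaut (qact g);
  qactM : forall g h a, qact (g * h)%g a = qact g (qact h a)
}.

Definition unitary_grouprep (R : realType) (Gam : groupType) (D : cstarType R)
    (v : Gam -> D) : Prop :=
  (forall g, unitary (v g)) /\ (forall g h, v (g * h)%g = v g ** v h).

(* [GG] is the crossed product quantum group: its C*-algebra is the full     *)
(* crossed product of [G] by [Gam], that is the universal C*-algebra         *)
(* generated by a copy of [G] and unitaries [cp_u g] implementing [alpha].   *)
Record crossed_product (R : realType) (Gam : groupType) (G : cqg R)
    (alpha : qaction Gam G) (GG : cqg R) := CrossedProduct {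
  cp_inj : starhom G GG;
  cp_u : Gam -> GG;
  cp_u_rep : unitary_grouprep cp_u;
  cp_covariant : forall g a,
    cp_u g ** cp_inj a ** star (cp_u g) = cp_inj (alpha g a);
  cp_generated : dense (lin_span [set x | exists a g, x = cp_inj a ** cp_u g]);
  cp_universal : forall (D : cstarType R) (pi : starhom G D) (v : Gam -> D),
    unitary_grouprep v ->
    (forall g a, v g ** pi a ** star (v g) = pi (alpha g a)) ->
    exists f : starhom GG D,
      (forall a, f (cp_inj a) = pi a) /\ (forall g, f (cp_u g) = v g);
  cp_comul_u : forall g, comul GG (cp_u g) = pure_tens (cp_u g) (cp_u g);
  cp_comul_inj : forall a, comul GG (cp_inj a) =
    tens_map (cqg_sq G) (cqg_sq GG) cp_inj cp_inj (comul G a)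
}.

Record intg (R : realType) (G : cqg R) := IntG {
  int_val :> G;
  int_unitary : unitary int_val;
  int_comul : comul G int_val = pure_tens int_val int_val
}.

Section IntGroup.
Variables (R : realType) (G : cqg R).
Implicit Types u v w : intg G.

HB.instance Definition _ := gen_eqMixin (intg G).
HB.instance Definition _ := gen_choiceMixin (intg G).

Lemma int_val_inj : injective (@int_val R G).
Proof.
move=> [u uU uD] [v vU vD] /= uv; move: uU uD vU vD; rewrite uv => *.
by congr IntG; apply: Prop_irrelevance.
Qed.

Lemma pure_tensM (a b a' b' : G) :
  pure_tens a b ** pure_tens a' b' = pure_tens (a ** a') (b ** b').
Proof.
rewrite /pure_tens !hom_mul -[LHS]cmulA [tinr _ b ** _]cmulA -tens_comm.
by rewrite !cmulA.
Qed.

Lemma star_pure_tens (a b : G) :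
  star (pure_tens a b) = pure_tens (star a) (star b).
Proof. by rewrite /pure_tens starM -!hom_star tens_comm. Qed.

Lemma int_one_comul : comul G cone = pure_tens (cone : G) cone.
Proof. by rewrite /pure_tens !hom_one cmul1x. Qed.

Lemma int_one_unitary : unitary (cone : G).
Proof. by split; rewrite star_one cmul1x. Qed.

Lemma int_mul_unitary u v : unitary (u ** v).
Proof.
case: u v => [u [uU1 uU2] _] [v [vU1 vU2] _] /=; split; rewrite starM !cmulA.
  by rewrite -[u ** v ** _]cmulA vU1 cmulx1 uU1.
by rewrite -[_ ** star u ** u]cmulA uU2 cmulx1 vU2.
Qed.

Lemma int_mul_comul u v : comul G (u ** v) = pure_tens (u ** v) (u ** v).
Proof. by rewrite hom_mul !int_comul pure_tensM. Qed.

Lemma int_inv_unitary u : unitary (star u).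
Proof. by case: u => u [u1 u2] _ /=; split; rewrite starK. Qed.

Lemma int_inv_comul u : comul G (star u) = pure_tens (star u) (star u).
Proof. by rewrite hom_star int_comul star_pure_tens. Qed.

Definition int_one : intg G := IntG int_one_unitary int_one_comul.
Definition int_mul u v : intg G := IntG (int_mul_unitary u v) (int_mul_comul u v).
Definition int_inv u : intg G := IntG (int_inv_unitary u) (int_inv_comul u).

Lemma int_mulA : associative int_mul.
Proof. by move=> u v w; apply: int_val_inj; apply: cmulA. Qed.

Lemma int_mul1g : left_id int_one int_mul.
Proof. by move=> u; apply: int_val_inj; apply: cmul1x. Qed.

Lemma int_mulg1 : right_id int_one int_mul.
Proof. by move=> u; apply: int_val_inj; apply: cmulx1. Qed.

Lemma int_mulVg : left_inverse int_one int_inv int_mul.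
Proof. by move=> u; apply: int_val_inj; have [] := int_unitary u. Qed.

Lemma int_mulgV : right_inverse int_one int_inv int_mul.
Proof. by move=> u; apply: int_val_inj; have [] := int_unitary u. Qed.

HB.instance Definition _ :=
  isGroup.Build (intg G) int_mulA int_mul1g int_mulg1 int_mulVg int_mulgV.
End IntGroup.

Section SemiDirect.
Variables (R : realType) (Gam : groupType) (G : cqg R).
Variable alpha : qaction Gam G.
Implicit Types (g h : Gam) (u v : intg G).

Lemma int_act_unitary g u : unitary (alpha g u).
Proof.
case: u => u [u1 u2] _ /=.
by split; rewrite -hom_star -hom_mul ?u1 ?u2 hom_one.
Qed.

Lemma int_act_comul g u :
  comul G (alpha g u) = pure_tens (alpha g u) (alpha g u).
Proof.
have [_ ->] := qact_aut alpha g.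
by rewrite int_comul /pure_tens hom_mul tens_map_inl tens_map_inr.
Qed.

Definition int_act g u : intg G :=
  IntG (int_act_unitary g u) (int_act_comul g u).

Lemma qact1 a : alpha 1%g a = a.
Proof.
have [[f fK _] _] := qact_aut alpha 1%g.
by rewrite -[RHS]fK -[in RHS](mul1g 1%g) qactM !fK.
Qed.

Lemma int_act1 u : int_act 1%g u = u.
Proof. by apply: int_val_inj; apply: qact1. Qed.

Lemma int_actM g h u : int_act (g * h)%g u = int_act g (int_act h u).
Proof. by apply: int_val_inj; apply: qactM. Qed.

Lemma int_act_morph g u v : int_act g (u * v)%g = (int_act g u * int_act g v)%g.
Proof. by apply: int_val_inj; apply: hom_mul. Qed.

(* The product is (g, u)(h, v) = (g h, u (g . v)).                           *)
Definition semidirect (al : qaction Gam G) : Type := (Gam * intg G)%type.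
Local Notation S := (semidirect alpha).

HB.instance Definition _ := Choice.on S.

Definition sd_one : S := (1%g, 1%g).
Definition sd_mul (x y : S) : S := ((x.1 * y.1)%g, (x.2 * int_act x.1 y.2)%g).
Definition sd_inv (x : S) : S := (x.1^-1%g, int_act x.1^-1%g x.2^-1%g).

Lemma sd_mulA : associative sd_mul.
Proof.
move=> [g u] [h v] [k w]; rewrite /sd_mul /=; congr (_, _).
  exact: mulgA.
by rewrite int_act_morph int_actM mulgA.
Qed.

Lemma sd_mul1g : left_id sd_one sd_mul.
Proof. by move=> [g u]; rewrite /sd_mul /= !mul1g int_act1. Qed.

Lemma int_act_one g : int_act g 1%g = 1%g.
Proof. by apply: int_val_inj; apply: hom_one. Qed.

Lemma sd_mulg1 : right_id sd_one sd_mul.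
Proof. by move=> [g u]; rewrite /sd_mul /= int_act_one !mulg1. Qed.

Lemma sd_mulVg : left_inverse sd_one sd_inv sd_mul.
Proof.
move=> [g u]; rewrite /sd_mul /sd_inv /= mulVg -int_act_morph mulVg.
by rewrite int_act_one.
Qed.

Lemma sd_mulgV : right_inverse sd_one sd_inv sd_mul.
Proof.
move=> [g u]; rewrite /sd_mul /sd_inv /= mulgV -int_actM mulgV int_act1.
by rewrite mulgV.
Qed.

HB.instance Definition _ :=
  isGroup.Build S sd_mulA sd_mul1g sd_mulg1 sd_mulVg sd_mulgV.
End SemiDirect.

Definition character (R : realType) (G : cqg R) : Type := starhom G (cplx R).

Section CharacterGroup.
Variables (R : realType) (G : cqg R).
Implicit Types x y : character G.

HB.instance Definition _ := gen_eqMixin (character G).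
HB.instance Definition _ := gen_choiceMixin (character G).

Definition char_tens x y : starhom (cqg_sq G) (cplx R) :=
  projT1 (cid (tens_char_exists (cqg_sq G) x y)).

Lemma char_tensE x y (a b : G) : char_tens x y (pure_tens a b) = x a * y b.
Proof.
rewrite /char_tens; case: cid => k [kl kr _] /=.
by rewrite /pure_tens hom_mul kl kr.
Qed.

Lemma char_mul_subproof x y :
  starhom_on [set: G] (fun a => char_tens x y (comul G a)).
Proof.
split.
- by move=> c a b _ _; rewrite !hom_linear.
- by move=> a b _ _; rewrite !hom_mul.
- by rewrite !hom_one.
- by move=> a _; rewrite !hom_star.
Qed.

Definition char_mul x y : character G := StarHom (char_mul_subproof x y).

HB.instance Definition _ := hasMul.Build (character G) char_mul.

Lemma char_tens_qaut x y (f : starhom G G) (z : cqg_sq G) :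
  (forall a, x (f a) = x a) -> (forall a, y (f a) = y a) ->
  char_tens x y (tens_map (cqg_sq G) (cqg_sq G) f f z) = char_tens x y z.
Proof.
move=> xf yf; rewrite /char_tens; case: cid => k [kl kr kn] /=.
have hk : starhom_on setT
    (fun z => k (tens_map (cqg_sq G) (cqg_sq G) f f z)).
  split.
  - by move=> c a b _ _; rewrite !hom_linear.
  - by move=> a b _ _; rewrite !hom_mul.
  - by rewrite !hom_one.
  - by move=> a _; rewrite !hom_star.
apply: (tens_hom_eq (f := StarHom hk)) => //= a.
- by apply: (le_trans (kn _)); exact: tens_map_norm.
- by rewrite tens_map_inl !kl xf.
- by rewrite tens_map_inr !kr yf.
Qed.

HB.instance Definition _ := Topological.copy (character G)
  (initial_topology (fun x : character G =>
     (x : G -> cplx R) : {ptws G -> cplx R})).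
End CharacterGroup.

Definition char_fun (R : realType) (G : cqg R) (x : character G) :
  G -> cplx R := hom_fun x.
Coercion char_fun : character >-> Funclass.

Record fixchar (R : realType) (Gam : groupType) (G : cqg R)
    (alpha : qaction Gam G) := FixChar {
  fixchar_val :> character G;
  fixchar_fixed : forall g a, fixchar_val (alpha g a) = fixchar_val a
}.

Section FixedCharacters.
Variables (R : realType) (Gam : groupType) (G : cqg R).
Variable alpha : qaction Gam G.
Implicit Types x y : fixchar alpha.

HB.instance Definition _ := gen_eqMixin (fixchar alpha).
HB.instance Definition _ := gen_choiceMixin (fixchar alpha).

Lemma fixchar_mul_subproof x y g a :
  (fixchar_val x * fixchar_val y)%g (alpha g a) =
  (fixchar_val x * fixchar_val y)%g a.
Proof.
have [_ act] := qact_aut alpha g.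
rewrite /mul /= act char_tens_qaut// => b; exact: fixchar_fixed.
Qed.

Definition fixchar_mul x y : fixchar alpha :=
  FixChar (fixchar_mul_subproof x y).

HB.instance Definition _ := hasMul.Build (fixchar alpha) fixchar_mul.

HB.instance Definition _ := Topological.copy (fixchar alpha)
  (initial_topology (@fixchar_val R Gam G alpha)).
End FixedCharacters.

Record Sp (R : realType) (Gam : groupType) := MkSp {
  Sp_fun :> Gam -> cplx R;
  Sp_norm : forall g, `|Sp_fun g| = 1;
  Sp_morph : forall g h, Sp_fun (g * h)%g = Sp_fun g * Sp_fun h
}.

Section DualGroup.
Variables (R : realType) (Gam : groupType).
Implicit Types x y : Sp R Gam.

HB.instance Definition _ := gen_eqMixin (Sp R Gam).
HB.instance Definition _ := gen_choiceMixin (Sp R Gam).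

Lemma Sp_mul_norm x y g : `|x g * y g| = 1.
Proof. by rewrite normrM !Sp_norm mulr1. Qed.

Lemma Sp_mul_morph x y g h :
  x (g * h)%g * y (g * h)%g = (x g * y g) * (x h * y h).
Proof. by rewrite !Sp_morph mulrACA. Qed.

Definition Sp_mul x y : Sp R Gam :=
  MkSp (Sp_mul_norm x y) (Sp_mul_morph x y).

HB.instance Definition _ := hasMul.Build (Sp R Gam) Sp_mul.

HB.instance Definition _ := Topological.copy (Sp R Gam)
  (initial_topology (fun x : Sp R Gam =>
     (x : Gam -> cplx R) : {ptws Gam -> cplx R})).
End DualGroup.

(* Main.v *)
(* For a representation [pi] of [G] on [H], the covariant pair on             *)
(* [l^2(Gam, H)] extends to a representation [theta] of the crossed product   *)
(* by its universal property. By Gelfand-Naimark, these representations show  *)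
(* that [G] and [G (x) G] embed isometrically in [GG] and [GG (x) GG].        *)
(* For a group-like unitary [w] of [GG] there is [g] such that some           *)
(* coefficient [phi(x) = <theta(x u_g) xi, eta>], vanishing on [inj(a) u_h]   *)
(* for [h <> 1], is nonzero at [w u_g^*]. Then [(phi (x) id) (comul x)] lies  *)
(* in the closed range of [inj] for all [x], and for the group-like element   *)
(* [x = w u_g^*] it is a nonzero multiple of [x].                             *)
(* A character of [GG] is determined by its values on [inj(a)] and [u_g], and *)
(* the pairs of such values are given by the universal property; since        *)
(* *-homomorphisms are contractive, convergence on the dense span of the      *)
(* [inj(a) u_g] implies pointwise convergence.                                *)
Require Import Defs.
From HB Require Import structures.
From mathcomp Require Import all_boot all_order all_algebra.
From mathcomp Require Import boolp classical_sets functions cardinality.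
From mathcomp Require Import reals topology normedtype sequences.
From mathcomp Require Import complex ring.

Set Implicit Arguments.
Unset Strict Implicit.
Unset Printing Implicit Defensive.

Import Order.TTheory GRing.Theory Num.Theory.
Import numFieldNormedType.Exports.
Local Open Scope classical_set_scope.
Local Open Scope ring_scope.


(** * Positivity in C*-algebras *)

(** Group-like unitaries. Covariance makes [(g, u) |-> cp_inj u ** cp_u g] multiplicative, so the
    content is bijectivity: the full crossed product must not collapse [G] and must remember [Gam].
    Both are visible in the regular representation on l^2(Gam, H) ([induced_rep]), where [cp_inj a]
    preserves each summand and [cp_u g] permutes the summands. Started from a representation of [G]
    attaining a given norm, it makes [cp_inj] isometric ([cp_inj_norm]). Used on both legs, it makes
    the map from [G (x) G] to [GG (x) GG] injective ([cp_inj2_injective]), so a group-like unitary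
    of [GG] lying in the range of [cp_inj] comes from one of [G]. Distinct labels move a vector of
    the summand of 1 into orthogonal summands, whence injectivity ([cp_int_inj]).

    For surjectivity ([grouplike_crossed]), a group-like [w] sends a unit vector of the summand of 1
    to a vector with a nonzero component in some summand g. Thus w' = w u_g^-1 has a nonzero
    diagonal coefficient phi(w') on that summand. Diagonal coefficients kill [cp_inj a ** cp_u h]
    for h <> 1, so phi (x) id maps [comul y] into the range of [cp_inj], first for y in the dense
    span and then, that range being closed and slices being bounded ([norm_slice_tens_le]), for y =
    w'. There it gives phi(w') w' ([grouplike_slice]), so w' lies in the range.

    Characters. Restriction to [cp_inj] and to [cp_u] sends a character to a pair. The unitaries
    take scalar values of modulus 1, so conjugation by them is invisible and the restricted
    character is fixed by [alpha]. Conversely, a fixed character and a one-dimensional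
    representation form a covariant pair, which the universal property integrates ([cp_Psi_exists]).
    Multiplicativity is read off the comultiplication of the generators, and continuity of the
    inverse follows from their density and the contractivity of characters ([cp_Psi_continuous]).

    The rest is operator theory: positivity of x^* x ([pos_starM]) yields contractivity of
    homomorphisms, Hahn-Banach yields norm-attaining states, and one completion of positive
    semidefinite kernels produces both the GNS spaces ([exists_norm_attaining_rep]) and l^2(Gam,
    H). *)

Section CStarBasics.
Variables (R : realType) (A : cstarType R).
Implicit Types (a b c h s x y z : A).

Lemma cmulBl x y z : (x - y) ** z = x ** z - y ** z.
Proof. by rewrite cmulDl cmulNx. Qed.

Lemma cmulBr x y z : x ** (y - z) = x ** y - x ** z.
Proof. by rewrite cmulDr cmulxN. Qed.

Lemma starB x y : star (x - y) = star x - star y.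
Proof. by rewrite starD starN. Qed.

(** Closes most limit arguments below: two limits are compared through an approximation whose error
    is controlled up to a fixed factor [C]. *)
Lemma norm_eq0_approx (V : normedModType R[i]) (v : V) (C : R[i]) :
  0 <= C -> (forall e : R[i], 0 < e -> `|v| <= C * e) -> v = 0.
Proof.
move=> C0 ve; apply/eqP; rewrite -normr_le0; apply/ler_addgt0Pr => e e0.
rewrite add0r; have C1 : 0 < C + 1 by rewrite ltr_wpDl.
apply: (le_trans (ve (e / (C + 1)) _)); first by rewrite divr_gt0.
rewrite mulrA ler_pdivrMr// mulrC ler_wpM2l//; first exact: ltW.
by rewrite lerDl.
Qed.

Lemma norm_cone : `|cone : A| = 1.
Proof.
have := cstar_norm (cone : A); rewrite star_one cmul1x expr2 => /eqP.
rewrite -subr_eq0 -{1}[`|_|]mulr1 -mulrBr mulf_eq0 normr_eq0 (negbTE cone_neq0)/=.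
by rewrite subr_eq0 => /eqP.
Qed.

Lemma sa_sqr_norm x : star x = x -> `|x ** x| = `|x| ^+ 2.
Proof. by move=> xs; rewrite -cstar_norm xs. Qed.

Let half : R[i] := 2^-1.

Lemma cmul_half x : 2 *: (half *: x) = x.
Proof. by rewrite scalerA divff ?scale1r// pnatr_eq0. Qed.

(* The iteration [y |-> (x + y ^ 2) / 2] converges to [1 - sqrt (1 - x)]; its *)
(* terms are polynomials in [x] with nonnegative coefficients, so they are    *)
(* majorized by the scalar sequence obtained for [x = 1].                     *)
Let rsq (n : nat) : R := iter n (fun r => (1 + r ^+ 2) / 2) 0.

Let rsqS n : rsq n.+1 = (1 + rsq n ^+ 2) / 2. Proof. by []. Qed.

Let rsq01 n : 0 <= rsq n <= 1.
Proof.
elim: n => [|n /andP[r0 r1]]; first by rewrite /= lexx ler01.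
rewrite rsqS; apply/andP; split.
  by rewrite divr_ge0// addr_ge0// sqr_ge0.
by rewrite ler_pdivrMr// mul1r -[leRHS]/(1 + 1) lerD2l expr_le1.
Qed.

Let rsq_nd : nondecreasing_seq rsq.
Proof.
apply/nondecreasing_seqP => n; elim: n => [|n IH].
  by have /andP[] := rsq01 1.
rewrite rsqS [leRHS]rsqS ler_pM2r ?invr_gt0//.
rewrite lerD2l; apply: lerXn2r => //.
  by rewrite nnegrE; have /andP[] := rsq01 n.
by rewrite nnegrE; have /andP[] := rsq01 n.+1.
Qed.

Lemma cauchy_seq_majorized (V : completeNormedModType R[i]) (u : nat -> V)
    (r : R ^nat) : cvgn r ->
  (forall n m, (n <= m)%N -> `|u m - u n| <= (r m - r n)%:C%C) ->
  cvgn u.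
Proof.
move=> /cvg_ex[/= l rl] ur; apply/cauchy_cvgP/cauchy_ballP => e e0.
have [e' ee e'0] : exists2 e', e = e'%:C%C & 0 < e'.
  have /complex_realP[e' ee'] : e \is Num.real by rewrite gtr0_real.
  by exists e' => //; rewrite -ltcR -ee'.
have e2 : 0 < e' / 2 by rewrite divr_gt0.
move/cvgrPdist_lt : rl => /(_ _ e2)[N _ rN].
exists (u @` [set n | (N <= n)%N], u @` [set n | (N <= n)%N]) => /=.
  by split; exists N => // n /= Nn; exists n.
move=> [_ _] /= [[n /= Nn <-] [m /= Nm <-]].
have key (a b : nat) : (N <= a)%N -> (N <= b)%N -> (a <= b)%N -> `|u b - u a| < e.
  move=> Na Nb ab; apply: (le_lt_trans (ur _ _ ab)); rewrite ee ltcR.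
  rewrite [ltRHS]splitr -(subrKA l) (le_lt_trans (ler_norm _))//.
  rewrite (le_lt_trans (ler_normD _ _))//.
  by rewrite distrC ltrD//; exact: rN.
rewrite -ball_normE /=.
by case/orP: (leq_total n m) => nm; [rewrite distrC|]; exact: key.
Qed.

(** The root is [1 - y], where [y] is the limit of the iteration and satisfies [2 y = x + y^2].
    Commutation holds for each iterate by induction and passes to the limit. *)
Lemma pos_sqrt a : star a = a -> `|cone - a| <= 1 ->
  exists b, [/\ star b = b, `|cone - b| <= 1, b ** b = a &
    forall c, c ** a = a ** c -> c ** b = b ** c].
Proof.
move=> sa a1; pose x := cone - a.
pose F y := half *: (x + y ** y).
pose u n := iter n F 0.
have uS n : u n.+1 = half *: (x + u n ** u n) by [].
have half0 : 0 <= half by rewrite invr_ge0.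
have ucomm c : c ** a = a ** c -> forall n, c ** u n = u n ** c.
  move=> ca; have cx : c ** x = x ** c by rewrite cmulBl cmulBr cmul1x cmulx1 ca.
  elim=> [|n IH]; first by rewrite /= cmulx0 cmul0x.
  by rewrite uS cmulZl cmulZr cmulDl cmulDr cx cmulA IH -cmulA IH cmulA.
have us n : star (u n) = u n.
  elim: n => [|n IH]; first exact: star0.
  rewrite uS starZ starD starM IH starB star_one sa.
  by rewrite conj_Creal// realE half0.
have uu n m : u n ** u m = u m ** u n.
  by apply/esym/ucomm; apply/esym/ucomm.
have un n : `|u n| <= (rsq n)%:C%C.
  elim: n => [|n IH]; first by rewrite normr0.
  rewrite uS normrZ ger0_norm// rsqS mulrC rmorphM fmorphV /= rmorphD /=.
  rewrite rmorphXn /= rmorph_nat ler_pM2r ?invr_gt0//.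
  apply: (le_trans (ler_normD _ _)); apply: lerD => //.
  apply: (le_trans (normM_le _ _)); rewrite expr2.
  by apply: ler_pM.
have u1 n : `|u n| <= 1.
  by apply: (le_trans (un n)); rewrite -[1]/(1%:C%C) lecR; have /andP[] := rsq01 n.
(* The iterates commute, so a difference of squares factors exactly as for the scalar sequence. *)
have uSd n : `|u n.+1 - u n| <= (rsq n.+1 - rsq n)%:C%C.
  elim: n => [|n IH].
    rewrite /= !subr0 /F cmulx0 addr0 normrZ ger0_norm//.
    by rewrite expr0n addr0 mul1r fmorphV /= rmorph_nat ler_piMr.
  rewrite uS [u n.+1 in X in _ - X]uS -scalerBr normrZ ger0_norm//.
  rewrite [x + _]addrC addrKA.
  have -> : u n.+1 ** u n.+1 - u n ** u n = (u n.+1 - u n) ** (u n.+1 + u n).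
    by rewrite cmulDr !cmulBl [u n ** u n.+1]uu subrKA.
  have -> : rsq n.+2 - rsq n.+1 =
      2^-1 * ((rsq n.+1 - rsq n) * (rsq n.+1 + rsq n)).
    rewrite [LHS](congr2 (fun p q : R => p - q) (rsqS n.+1) (rsqS n)).
    by rewrite -mulrBl [X in X - _]addrC addrKA subr_sqr mulrC.
  move: IH (un n) (un n.+1).
  move: (u n.+1) (u n) (rsq n.+1) (rsq n) => v w s t vw wt vs.
  rewrite rmorphM fmorphV /= rmorph_nat ler_pM2l ?invr_gt0//.
  rewrite rmorphM /=; apply: (le_trans (normM_le _ _)).
  apply: ler_pM => //; rewrite rmorphD /=.
  by apply: (le_trans (ler_normD _ _)); apply: lerD.
have ud n m : (n <= m)%N -> `|u m - u n| <= (rsq m - rsq n)%:C%C.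
  move=> /subnK <-; elim: (m - n)%N => [|k IH].
    by rewrite add0n !subrr normr0.
  rewrite addSn -(subrKA (u (k + n)%N)) -[X in X%:C%C](subrKA (rsq (k + n)%N)).
  by rewrite rmorphD (le_trans (ler_normD _ _))// lerD//; exact: uSd.
have /cvg_ex[/= y uy] : cvgn u.
  apply: cauchy_seq_majorized ud.
  apply: nondecreasing_is_cvgn rsq_nd _; exists 1 => _ [n _ <-].
  by have /andP[] := rsq01 n.
have near (e : R[i]) : 0 < e -> exists n, `|y - u n| < e /\ `|y - u n.+1| < e.
  move=> e0; move/cvgrPdist_lt : uy => /(_ _ e0)[N _ uN].
  by exists N; split; apply: uN => /=.
have y1 : `|y| <= 1.
  apply/ler_addgt0Pr => e /near[n [yn _]].
  rewrite -[y](subrK (u n)) addrC (le_trans (ler_normD _ _))// lerD//.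
  exact: ltW.
exists (cone - y).
have ys : star y = y.
  apply/eqP; rewrite -subr_eq0; apply/eqP; apply: (@norm_eq0_approx _ _ 2) => // e.
  move=> /near[n [yn _]].
  have -> : star y - y = star (y - u n) - (y - u n).
    by rewrite starB us opprB subrKA.
  rewrite (le_trans (ler_normB _ _))// norm_star -mulr2n -[leLHS]mulr_natl.
  by rewrite ler_wpM2l// ltW.
have yx : 2 *: y = x + y ** y.
  apply/eqP; rewrite -subr_eq0; apply/eqP; apply: (@norm_eq0_approx _ _ 4) => // e.
  move=> /near[n [yn yn1]].
  have -> : 2 *: y - (x + y ** y) =
      2 *: (y - u n.+1) - ((y - u n) ** y + u n ** (y - u n)).
    rewrite scalerBr [in u n.+1]uS cmul_half cmulBl cmulBr.
    by rewrite subrKA !opprD !opprK !addrA [RHS]addrAC subrK.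
  rewrite (le_trans (ler_normB _ _))//.
  have -> : 4 * e = 2 * e + (e * 1 + 1 * e).
    by ring.
  apply: lerD.
    by rewrite normrZ ger0_norm// ler_wpM2l// ltW.
  rewrite (le_trans (ler_normD _ _))// lerD//.
    by rewrite (le_trans (normM_le _ _))// ler_pM// ltW.
  by rewrite (le_trans (normM_le _ _))// ler_pM// ltW.
split.
- by rewrite starB star_one ys.
- by rewrite opprB addrC subrK.
- rewrite cmulBl !cmulBr !cmul1x cmulx1.
  have -> : y ** y = y + y - x.
    by rewrite -mulr2n -scaler_nat yx addrAC subrr add0r.
  have -> : y - (y + y - x) = x - y.
    by rewrite -addrA opprD addrA subrr sub0r opprB.
  rewrite opprB subrKA.
  by rewrite /x opprB addrC subrK.
- move=> c ca; rewrite cmulBl cmulBr cmul1x cmulx1; congr (_ - _).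
  apply/eqP; rewrite -subr_eq0; apply/eqP.
  apply: (@norm_eq0_approx _ _ (2 * `|c|)); first by rewrite mulr_ge0.
  move=> e /near[n [yn _]].
  have -> : c ** y - y ** c = c ** (y - u n) - (y - u n) ** c.
    by rewrite cmulBl cmulBr (ucomm c ca) opprB addrA subrK.
  rewrite (le_trans (ler_normB _ _))//.
  have -> : 2 * `|c| * e = `|c| * e + e * `|c|.
    by rewrite -mulrA mulr_natl mulr2n [e * _]mulrC.
  rewrite lerD// (le_trans (normM_le _ _))//.
    by rewrite ler_wpM2l// ltW.
  by rewrite ler_wpM2r// ltW.
Qed.

Lemma csqrD x y : (x + y) ** (x + y) = (x ** x + y ** y) + (x ** y + y ** x).
Proof.
by rewrite cmulDl !cmulDr [y ** x + _]addrC addrACA.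
Qed.

Lemma csqrB x y : (x - y) ** (x - y) = (x ** x + y ** y) - (x ** y + y ** x).
Proof. by rewrite csqrD cmulxN !cmulNx !cmulxN opprK -opprD. Qed.

Lemma addrr2 (V : lmodType R[i]) (v : V) : v + v = 2 *: v.
Proof. by rewrite scaler_nat mulr2n. Qed.

(** Positivity without spectra: for self-adjoint [a], the bound [|t - a| <= t] means that the
    spectrum lies in [[0, 2 t]]. *)
Definition pos a : Prop :=
  star a = a /\ exists2 t : R[i], 0 <= t & `|t *: cone - a| <= t.

Lemma norm_scal (t : R[i]) : `|t *: cone : A| = `|t|.
Proof. by rewrite normrZ norm_cone mulr1. Qed.

Lemma conjc_ge0 (t : R[i]) : 0 <= t -> t^* = t.
Proof. by move=> t0; rewrite conj_Creal// ger0_real. Qed.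

Lemma starZ_ge0 (t : R[i]) a : 0 <= t -> star (t *: a) = t *: star a.
Proof. by move=> t0; rewrite starZ conjc_ge0. Qed.

Lemma sa_scal (t : R[i]) : 0 <= t -> star (t *: cone) = t *: cone :> A.
Proof. by move=> t0; rewrite starZ_ge0// star_one. Qed.

Lemma posD a b : pos a -> pos b -> pos (a + b).
Proof.
move=> [sa [t t0 ta]] [sb [r r0 rb]]; split; first by rewrite starD sa sb.
exists (t + r); first exact: addr_ge0.
by rewrite scalerDl opprD addrACA (le_trans (ler_normD _ _))// lerD.
Qed.

Lemma posZ (c : R[i]) a : 0 <= c -> pos a -> pos (c *: a).
Proof.
move=> c0 [sa [t t0 ta]]; split; first by rewrite starZ_ge0// sa.
exists (c * t); first exact: mulr_ge0.
by rewrite -scalerA -scalerBr normrZ ger0_norm// ler_wpM2l.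
Qed.

Lemma pos_scalB (t : R[i]) a : star a = a -> `|a| <= t -> pos (t *: cone - a).
Proof.
move=> sa ta; have t0 := le_trans (normr_ge0 _) ta.
split; first by rewrite starB sa_scal// sa.
by exists t => //; rewrite opprB addrC subrK.
Qed.

(** Rescaling by the witness [t] reduces to [pos_sqrt]; for [t = 0] the element vanishes. The
    commutation clause does the work of a functional calculus. *)
Lemma pos_root a : pos a -> exists b, [/\ star b = b, pos b, b ** b = a &
  forall c, c ** a = a ** c -> c ** b = b ** c].
Proof.
move=> [sa [t t0 ta]]; have [te|tn] := eqVneq t 0.
  have a0 : a = 0.
    by apply/eqP; rewrite -normr_le0; move: ta; rewrite te scale0r sub0r normrN.
  exists 0; split; first exact: star0.
  - by split; [exact: star0|exists 0; rewrite // scale0r subr0 normr0].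
  - by rewrite cmul0x a0.
  - by move=> c _; rewrite cmul0x cmulx0.
have tp : 0 < t by rewrite lt_def tn.
have [||b [sb b1 bb bc]] := @pos_sqrt (t^-1 *: a).
- by rewrite starZ_ge0 ?invr_ge0// sa.
- rewrite -(ler_pM2l tp) mulr1 -{1}[t]ger0_norm// -normrZ scalerBr scalerA.
  by rewrite divff// scale1r.
have r0 : 0 <= sqrtC t by rewrite sqrtC_ge0.
exists (sqrtC t *: b); split.
- by rewrite starZ_ge0// sb.
- by apply: posZ => //; split=> //; exists 1; rewrite // scale1r.
- rewrite cmulZl cmulZr scalerA -expr2 sqrtCK bb scalerA divff//.
  by rewrite scale1r.
- by move=> c ca; rewrite cmulZl cmulZr bc// cmulZl cmulZr ca.
Qed.

(** [x] is the real part of [v = x + i y], and commutation gives [v^* v = x^2 + y^2]. *)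
Lemma sa_norm_le_sum x y : star x = x -> star y = y -> x ** y = y ** x ->
  `|x| ^+ 2 <= `|x ** x + y ** y|.
Proof.
move=> sx sy xy; pose v := x + 'i *: y.
have sv : star v = x - 'i *: y by rewrite starD starZ conjCi sx sy scaleNr.
have vv : star v ** v = x ** x + y ** y.
  rewrite sv /v cmulBl !cmulDr !cmulZl !cmulZr xy scalerA -expr2 sqrCi scaleN1r.
  by rewrite opprD opprK addrA addrK.
have nv : `|x| <= `|v|.
  have -> : x = 2^-1 *: (star v + v).
    rewrite sv /v addrACA addNr addr0 addrr2 scalerA.
    by rewrite mulVf ?scale1r// pnatr_eq0.
  rewrite normrZ ger0_norm ?invr_ge0// ler_pdivrMl// mulr_natl mulr2n.
  by rewrite (le_trans (ler_normD _ _))// norm_star.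
by rewrite -vv cstar_norm lerXn2r ?nnegrE.
Qed.

(** The root [y] of [t - h^2] commutes with [h], so [|t - h^2| = |y|^2 <= |y^2 + h^2| = t]. *)
Lemma sqr_scalB_norm h (t : R[i]) : star h = h -> `|h ** h| <= t ->
  `|t *: cone - h ** h| <= t.
Proof.
move=> sh ht; have t0 := le_trans (normr_ge0 _) ht.
have shh : star (h ** h) = h ** h by rewrite starM sh.
have [y [sy _ yy yc]] := pos_root (pos_scalB shh ht).
rewrite -yy sa_sqr_norm//.
have hy : h ** y = y ** h.
  by apply: yc; rewrite cmulBl cmulBr cmulZl cmulZr cmul1x cmulx1 cmulA.
apply: (le_trans (sa_norm_le_sum sy sh (esym hy))).
by rewrite yy subrK norm_scal ger0_norm.
Qed.

Lemma pos_sqr h : star h = h -> pos (h ** h).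
Proof.
move=> sh; split; first by rewrite starM sh.
by exists `|h ** h| => //; exact: sqr_scalB_norm.
Qed.

(** Any bound of the norm can serve as the witness in [pos]. *)
Lemma pos_scalB_norm a (t : R[i]) : pos a -> `|a| <= t -> `|t *: cone - a| <= t.
Proof. by move=> /pos_root[b [sb _ <- _]]; exact: sqr_scalB_norm. Qed.

(** With [a = x^2] and [t - a = y^2] for commuting [x] and [y], [sa_norm_le_sum] bounds [|x|^2] by
    [|x^2 + y^2| = t]. *)
Lemma pos_norm_le a (t : R[i]) : 0 <= t -> pos a -> pos (t *: cone - a) ->
  `|a| <= t.
Proof.
move=> t0 /pos_root[x [sx _ xx xc]] /pos_root[y [sy _ yy yc]].
rewrite -xx sa_sqr_norm//.
have xy : x ** y = y ** x.
  by apply: yc; rewrite -xx cmulBl cmulBr cmulZl cmulZr cmul1x cmulx1 cmulA.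
by apply: (le_trans (sa_norm_le_sum sx sy xy)); rewrite xx yy addrC subrK norm_scal ger0_norm.
Qed.

(* If [z] has norm 1, then [c := - z^* z] and [z z^*] are positive, and the   *)
(* norm of [z^* (1 - z z^* ) z = - (c + c ^ 2)] gives [2 c ^ 2 <= c + c ^ 2 <= 1]. *)
Lemma neg_sqr_eq0 z s : star s = s -> star z ** z = - (s ** s) -> z = 0.
Proof.
wlog z1 : z s / `|z| = 1 => [wl ss zs|ss zs].
  have [//|z0] := eqVneq z 0; pose r := `|z|^-1.
  have nz : `|z| != 0 by rewrite normr_eq0.
  have r0 : 0 <= r by rewrite invr_ge0.
  have : r *: z = 0.
    apply: (wl _ (r *: s)).
    - by rewrite normrZ ger0_norm// mulVf.
    - by rewrite starZ_ge0// ss.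
    - by rewrite starZ_ge0// !cmulZl !cmulZr zs !scalerN.
  by move/eqP; rewrite scaler_eq0 invr_eq0 (negbTE nz) => /eqP.
pose c := s ** s; have sc : star c = c by rewrite /c starM ss.
have nc : `|c| = 1 by rewrite -normrN -zs cstar_norm z1 expr1n.
have pc : pos c by exact: pos_sqr.
pose p := z ** star z.
have sp : star p = p by rewrite starM starK.
have pp : pos p.
  (* Up to scalars these are the real and imaginary parts: [z z^* + z^* z = (a^2 + b^2) / 2], which
     isolates [z z^*] because [z^* z = - c]. *)
  pose a := z + star z; pose b := 'i *: (star z - z).
  have sa : star a = a by rewrite starD starK addrC.
  have sb : star b = b.
    by rewrite starZ conjCi starB starK -opprB scaleNr scalerN opprK.
  have -> : p = 2^-1 *: (a ** a + b ** b) + c.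
    have -> : a ** a + b ** b = 2 *: (p + star z ** z).
      rewrite /b cmulZl cmulZr scalerA -expr2 sqrCi scaleN1r /a.
      rewrite csqrD csqrB -/p [star z ** star z + _]addrC.
      rewrite [star z ** z + _]addrC opprB [LHS]addrC [LHS]addrA subrK.
      exact: addrr2.
    by rewrite scalerA mulVf ?pnatr_eq0// scale1r zs subrK.
  apply: posD => //; apply: posZ; first by rewrite invr_ge0.
  by apply: posD; exact: pos_sqr.
have np : `|p| = 1 by rewrite /p -{1}[z]starK cstar_norm norm_star z1 expr1n.
have c1 : `|c + c ** c| <= 1.
  have -> : c + c ** c = - (star z ** (cone - p) ** z).
    rewrite cmulBr cmulx1 cmulBl /p cmulA -[_ ** star z ** z]cmulA zs -/c.
    by rewrite cmulNx cmulxN opprK opprB opprK addrC.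
  rewrite normrN (le_trans (normM_le _ _))// z1 mulr1.
  rewrite (le_trans (normM_le _ _))// norm_star z1 mul1r.
  by rewrite -[cone]scale1r; apply: pos_scalB_norm => //; rewrite np.
have : `|2 *: (c ** c)| <= 1.
  apply: pos_norm_le => //; first by apply: posZ => //; exact: pos_sqr.
  have -> : 1 *: cone - 2 *: (c ** c) =
      (1 *: cone - (c + c ** c)) + (c - c ** c).
    rewrite -[RHS]addrA [in RHS]opprD [X in _ = _ + X]addrACA addNr add0r.
    by rewrite -opprD addrr2.
  apply: posD.
    by apply: pos_scalB => //; rewrite starD starM sc.
  (* Since [1 - c = y^2] with [y] commuting with [s], the element [c - c^2] is the square of
     [s y]. *)
  have [|y [sy _ yy yc]] := @pos_root (1 *: cone - c).
    by apply: pos_scalB => //; rewrite nc.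
  have sy' : s ** y = y ** s.
    by apply: yc; rewrite cmulBl cmulBr cmulZl cmulZr cmul1x cmulx1 cmulA.
  have -> : c - c ** c = (s ** y) ** (s ** y).
    rewrite -cmulA [y ** _]cmulA -sy' -[s ** y ** y]cmulA yy !cmulBr cmulZr.
    by rewrite cmulx1 scale1r !cmulA.
  by apply: pos_sqr; rewrite starM sy ss.
rewrite normrZ (sa_sqr_norm sc) nc expr1n mulr1 ger0_norm//.
by rewrite (ler_nat _ 2 1).
Qed.

(* With [d := |k| - k] for [k := x^* x], the element [z := x d] has            *)
(* [z^* z = - |k| d ^ 2], so that [d = 0].                                     *)
Theorem pos_starM x : pos (star x ** x).
Proof.
pose k := star x ** x; have sk : star k = k by rewrite starM starK.
have [m [sm pm mm mc]] := pos_root (pos_sqr sk).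
have [n [sn _ nn nc]] := pos_root pm.
have km : k ** m = m ** k by apply: mc; rewrite cmulA.
have kn : k ** n = n ** k by exact: nc.
have nm : n ** m = m ** n by apply/esym/nc.
pose d := m - k; have sd : star d = d by rewrite starB sm sk.
have nd : n ** d = d ** n by rewrite cmulBl cmulBr nm kn.
have kd : k ** d = d ** k by rewrite cmulBl cmulBr km.
have dk : d ** k = - (m ** d).
  by rewrite cmulBl cmulBr -mm opprB.
have s0 : n ** d = 0.
  have sn' : star (n ** d) = n ** d by rewrite starM sn sd.
  have E : star (x ** d) ** (x ** d) = - (n ** d ** (n ** d)).
    rewrite starM sd -cmulA [star x ** _]cmulA -/k cmulA dk cmulNx; congr (- _).
    by rewrite -nn -!cmulA; congr (_ ** _); rewrite !cmulA nd.
  apply/eqP; rewrite -normr_eq0 -sqrf_eq0 -sa_sqr_norm// -normrN -E.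
  by rewrite (neg_sqr_eq0 sn' E) cmulx0 normr0.
have md : m ** d = 0 by rewrite -nn -cmulA s0 cmulx0.
have d0 : d = 0.
  apply/eqP; rewrite -normr_eq0 -sqrf_eq0 -sa_sqr_norm// normr_eq0.
  by rewrite {1}/d cmulBl md kd dk md !oppr0 addr0.
by rewrite -/k; move/eqP: d0; rewrite subr_eq0 => /eqP <-.
Qed.

(** The form in which positivity is used afterwards: whatever is nonnegative on squares inherits a
    norm bound from this identity. *)
Lemma pos_normB_root x (t : R[i]) : `|x| <= t ->
  exists2 y, star y = y & y ** y = t ^+ 2 *: cone - star x ** x.
Proof.
move=> xt; have [|y [sy _ yy _]] := @pos_root (t ^+ 2 *: cone - star x ** x).
  apply: pos_scalB; rewrite ?starM ?starK// cstar_norm lerXn2r ?nnegrE//.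
  exact: le_trans xt.
by exists y.
Qed.

End CStarBasics.

(** The sets of approximate solutions shrink with the error, so they generate a Cauchy filter. This
    serves to extend maps from dense subspaces and to show that ranges are closed. *)
Lemma approx_limit (R : realType) (V : completeNormedModType R[i])
    (P : R[i] -> set V) (C : R[i]) : 0 <= C ->
  (forall e e', e <= e' -> P e `<=` P e') ->
  (forall e, 0 < e -> P e !=set0) ->
  (forall e x y, 0 < e -> P e x -> P e y -> `|x - y| <= C * e) ->
  exists c, forall e x, 0 < e -> P e x -> `|c - x| <= C * e.
Proof.
move=> C0 Pmono Pne Pdist.
pose F : set_system V := filter_from [set e | 0 < e] P.
have FF : ProperFilter F.
  apply: filter_from_proper; last exact: Pne.
  apply: filter_from_filter; first by exists 1 => /=.
  move=> e e' /= e0 e'0; have [d d0 [de de']] := posmin e0 e'0.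
  by exists d => //= x Px; split; [exact: Pmono de _ Px|exact: Pmono de' _ Px].
have : cauchy F.
  apply/cauchy_ballP => e e0; have C1 : 0 < C + 1 by rewrite ltr_wpDl.
  have e1 : 0 < e / (C + 1) by rewrite divr_gt0.
  exists (P (e / (C + 1)), P (e / (C + 1))) => /=.
    by split; exists (e / (C + 1)).
  move=> [x y] /= [Px Py]; rewrite -ball_normE /=.
  apply: (le_lt_trans (Pdist _ _ _ e1 Px Py)).
  by rewrite mulrA ltr_pdivrMr// mulrC ltr_pM2l// ltrDl.
move=> /cauchy_cvg/cvg_ex[c Fc]; exists c => e x e0 Px.
apply/ler_addgt0Pr => d d0.
have [r /= r0 br] : F (ball c d) by apply: Fc; exact: nbhsx_ballx.
have [q q0 [qr qe]] := posmin r0 e0; have [y Py] := Pne _ q0.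
have : ball c d y by apply: br; exact: Pmono qr _ Py.
rewrite -ball_normE /= => /ltW cy; rewrite -(subrKA y) addrC.
rewrite (le_trans (ler_normD _ _))// lerD// Pdist//; exact: Pmono qe _ Py.
Qed.

(** * Contractivity of homomorphisms and representations *)

Section Contractive.
Variables (R : realType) (A B : cstarType R).

Lemma hom_sub (f : starhom A B) x y : f (x - y) = f x - f y.
Proof. by rewrite addrC -scaleN1r hom_linear scaleN1r addrC. Qed.

(** The identity [|x|^2 - x^* x = y^2] is preserved by [f], so [f x^* f x] is dominated by [|x|^2].
    Continuity is thus automatic. *)
Lemma hom_le_norm (f : starhom A B) x : `|f x| <= `|x|.
Proof.
have [y sy yy] := pos_normB_root (lexx `|x|).
rewrite -(@ler_pXn2r _ 2) ?nnegrE// -cstar_norm.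
apply: pos_norm_le; first exact: exprn_ge0.
  exact: pos_starM.
have -> : `|x| ^+ 2 *: cone - star (f x) ** f x = f y ** f y.
  by rewrite -hom_mul yy hom_sub homZ hom_one hom_mul hom_star.
by apply: pos_sqr; rewrite -hom_star sy.
Qed.

End Contractive.

Section DotTheory.
Variables (R : realType) (H : hilbertType R).
Implicit Types (x y z : H) (c : R[i]).

Lemma dotDl x y z : dot (x + y) z = dot x z + dot y z.
Proof. exact: linearDl. Qed.

Lemma dotDr x y z : dot z (x + y) = dot z x + dot z y.
Proof. exact: linearDr. Qed.

Lemma dotBl x y z : dot (x - y) z = dot x z - dot y z.
Proof. exact: linearBl. Qed.

Lemma dotBr x y z : dot z (x - y) = dot z x - dot z y.
Proof. exact: linearBr. Qed.

Lemma dot0l z : dot 0 z = 0.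
Proof. exact: linear0l. Qed.

Lemma dot0r z : dot z 0 = 0.
Proof. exact: linear0r. Qed.

Lemma dotZl c x z : dot (c *: x) z = c * dot x z.
Proof. exact: linearZl_LR. Qed.

Lemma dotZr c x z : dot z (c *: x) = c^* * dot z x.
Proof. exact: linearZr_LR. Qed.

Lemma dotC x y : dot x y = (dot y x)^*.
Proof. by rewrite hermC expr0 mul1r. Qed.

Lemma dot_ge0 x : 0 <= dot x x.
Proof. by rewrite -dot_norm exprn_ge0. Qed.

End DotTheory.

Section RepTheory.
Variables (R : realType) (A : cstarType R) (H : hilbertType R).
Variable pi : starrep A H.
Implicit Types (a b : A) (c : R[i]) (x y : H).

Lemma rep0l x : pi 0 x = 0.
Proof.
have := rep_linear_alg pi (-1) 0 0 x.
by rewrite scaleN1r oppr0 addr0 scaleN1r addNr.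
Qed.

Lemma repZl c a x : pi (c *: a) x = c *: pi a x.
Proof. by rewrite -[c *: a]addr0 rep_linear_alg rep0l addr0. Qed.

Lemma repDl a b x : pi (a + b) x = pi a x + pi b x.
Proof. by rewrite -[a]scale1r rep_linear_alg !scale1r. Qed.

Lemma repBl a b x : pi (a - b) x = pi a x - pi b x.
Proof. by rewrite repDl -scaleN1r repZl scaleN1r. Qed.

Lemma rep_suml I (s : seq I) (F : I -> A) x :
  pi (\sum_(i <- s) F i) x = \sum_(i <- s) pi (F i) x.
Proof.
elim: s => [|i s IH]; first by rewrite !big_nil rep0l.
by rewrite !big_cons repDl IH.
Qed.

(** The same identity seen on a vector: [|a|^2 |x|^2 - |pi a x|^2 = |pi y x|^2]. *)
Lemma rep_norm_le a x : `|pi a x| <= `|a| * `|x|.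
Proof.
have [y sy yy] := pos_normB_root (lexx `|a|).
rewrite -(@ler_pXn2r _ 2) ?nnegrE ?mulr_ge0// exprMn.
rewrite -subr_ge0 !dot_norm rep_star -rep_mul.
have -> : star a ** a = `|a| ^+ 2 *: cone - y ** y.
  by rewrite yy opprB addrC subrK.
rewrite repBl repZl rep_one dotBr dotZr conjc_ge0 ?exprn_ge0// opprB addrC subrK.
by rewrite rep_mul -{1}sy -rep_star dot_ge0.
Qed.

End RepTheory.

(** * The Hahn-Banach theorem *)

Section HahnBanach.
Variables (R : realType) (V : lmodType R[i]).
Implicit Types (p q f : V -> R) (x y v : V).

(** The complex space is treated as a real one; complex linearity is restored when states are
    built. *)
Definition sublinear p : Prop :=
  (forall x y, p (x + y) <= p x + p y) /\
  (forall (t : R) x, 0 <= t -> p (t%:C%C *: x) <= t * p x).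

Lemma sublinearZ p t x : sublinear p -> 0 <= t -> p (t%:C%C *: x) = t * p x.
Proof.
move=> [pD pZ]; rewrite le_eqVlt => /orP[/eqP <-|t0].
  apply/eqP; rewrite eq_le pZ//= mul0r scale0r.
  by have := pD 0 0; rewrite addr0 lerDl.
apply/eqP; rewrite eq_le pZ ?(ltW t0)//=.
have := pZ t^-1 (t%:C%C *: x); rewrite scalerA -rmorphM mulVf ?gt_eqF// scale1r.
by rewrite ler_pdivlMl// => -> //; rewrite invr_ge0 ltW.
Qed.

Lemma sublinear_geN p x : sublinear p -> - p (- x) <= p x.
Proof.
move=> sp; rewrite -subr_ge0 opprK; have [pD _] := sp.
apply: le_trans (pD _ _); rewrite subrr.
by have := sublinearZ 0 sp (lexx 0); rewrite mul0r scale0r => ->.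
Qed.

(* A sublinear functional below [p] whose value at [- y] is at most [- p y]. *)
Let lower p y x := inf [set p (x + t%:C%C *: y) - t * p y | t in [set t | 0 <= t]].

Let lower_lb p y x t : sublinear p -> 0 <= t ->
  - p (- x) <= p (x + t%:C%C *: y) - t * p y.
Proof.
move=> sp t0; rewrite lerBrDl -(sublinearZ y sp t0) lerBlDr.
have [pD _] := sp; apply: le_trans (pD _ _).
by rewrite addrAC subrr add0r.
Qed.

Let lower_le p y x t : sublinear p -> 0 <= t ->
  lower p y x <= p (x + t%:C%C *: y) - t * p y.
Proof.
move=> sp t0; apply: ge_inf; last by exists t.
by exists (- p (- x)) => _ [r /= r0 <-]; exact: lower_lb.
Qed.

Let le_lower p y x b : 
  (forall t, 0 <= t -> b <= p (x + t%:C%C *: y) - t * p y) -> b <= lower p y x.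
Proof.
move=> pb; apply: lb_le_inf; first by eexists; exists 0 => //=.
by move=> _ [t /= t0 <-]; exact: pb.
Qed.

Let lower_sublinear p y : sublinear p -> sublinear (lower p y).
Proof.
move=> sp; have [pD pZ] := sp; split.
- move=> x x'; rewrite -lerBlDr; apply: le_lower => t t0.
  rewrite lerBlDl -lerBlDr; apply: le_lower => r r0; rewrite lerBlDl.
  apply: (le_trans (lower_le _ _ sp (addr_ge0 t0 r0))).
  rewrite addrACA -opprD -mulrDl lerD2r rmorphD scalerDl.
  by apply: (le_trans _ (pD _ _)); rewrite addrACA.
- move=> t x; rewrite le_eqVlt => /orP[/eqP <-|t0].
    rewrite mul0r scale0r.
    apply: (le_trans (lower_le _ _ sp (lexx 0))).
    by rewrite scale0r addr0 mul0r subr0 -[0](scale0r 0) (sublinearZ _ sp)// mul0r.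
  rewrite -ler_pdivrMl//; apply: le_lower => r r0; rewrite ler_pdivrMl//.
  apply: (le_trans (lower_le _ _ sp (mulr_ge0 (ltW t0) r0))).
  by rewrite mulrBr mulrA lerD2r rmorphM -scalerA -scalerDr pZ// ltW.
Qed.

Let lower_le_id p y x : sublinear p -> lower p y x <= p x.
Proof.
move=> sp; apply: (le_trans (lower_le _ _ sp (lexx 0))).
by rewrite scale0r addr0 mul0r subr0.
Qed.

(** Zorn's lemma: the pointwise infimum of a chain is finite, being bounded below by [- p (- x)],
    and is again sublinear. *)
Lemma minimal_sublinear p : sublinear p -> exists q,
  [/\ sublinear q, forall x, q x <= p x &
      forall r, sublinear r -> (forall x, r x <= q x) -> r = q].
Proof.
move=> sp; pose T := {q | sublinear q /\ forall x, q x <= p x}.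
(* The order is reversed, so that a maximal element is a minimal functional. *)
pose below (q r : T) : bool := `[< forall x, sval r x <= sval q x >].
have [||A Atot|q qmin] := @ZL_preorder T (exist _ p (conj sp (fun x => lexx _))) below.
- by move=> q; apply/asboolP.
- by move=> r q s /asboolP qr /asboolP rs; apply/asboolP => x; exact: le_trans (qr x).
- have [[q0 Aq0]|A0] := pselect (exists q : T, A q); last first.
    exists (exist _ p (conj sp (fun x => lexx _))) => s As.
    by exfalso; apply: A0; exists s.
  pose m x := inf ((fun q : T => sval q x) @` A).
  have lb x : has_lbound ((fun q : T => sval q x) @` A).
    exists (- p (- x)) => _ [[q [sq qp]] _ <-] /=.
    by apply: le_trans (sublinear_geN _ sq); rewrite lerN2.
  have m_le x (q : T) : A q -> m x <= sval q x.
    by move=> Aq; apply: ge_inf => //; exists q.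
  have le_m x b : (forall q : T, A q -> b <= sval q x) -> b <= m x.
    move=> bA; apply: lb_le_inf; first by exists (sval q0 x), q0.
    by move=> _ [q Aq <-]; exact: bA.
  have sm : sublinear m.
    split=> [x y|t x].
      rewrite -lerBlDr; apply: (le_m) => q Aq.
      rewrite lerBlDl -lerBlDr; apply: (le_m) => r Ar; rewrite lerBlDl.
      have [s [As sq sr]] : exists s : T,
          [/\ A s, forall x, sval s x <= sval q x & forall x, sval s x <= sval r x].
        by have [/asboolP ?|/asboolP ?] := Atot _ _ Aq Ar; [exists r|exists q].
      apply: (le_trans (m_le _ _ As)).
      by have [[sD _] _] := svalP s; apply: (le_trans (sD _ _)); exact: lerD.
    rewrite le_eqVlt => /orP[/eqP <-|t0].
      rewrite mul0r; apply: (le_trans (m_le _ _ Aq0)).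
      by have [[_ qZ] _] := svalP q0; have := qZ 0 x (lexx 0); rewrite mul0r.
    rewrite -ler_pdivrMl//; apply: (le_m) => r Ar; rewrite ler_pdivrMl//.
    apply: (le_trans (m_le _ _ Ar)).
    by have [[_ rZ] _] := svalP r; apply: rZ; exact: ltW.
  have mp x : m x <= p x.
    by apply: (le_trans (m_le _ _ Aq0)); have [_] := svalP q0.
  exists (exist _ m (conj sm mp)) => s As; apply/asboolP => x /=; exact: m_le.
- exists (sval q); have [sq qp] := svalP q; split=> // r sr rq.
  have rp x : r x <= p x by exact: le_trans (rq x) (qp x).
  have /asboolP qr := qmin (exist _ r (conj sr rp)) (introT (asboolP _) rq).
  by apply/funext => x; apply/eqP; rewrite eq_le rq qr.
Qed.

(** A minimal sublinear [f] equals its own [lower f y], and the term [t = 1] of that infimum gives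
    [f x + f y <= f (x + y)]. Starting below [lower p v] forces the value at [v]. *)
Theorem hahn_banach p v : sublinear p -> exists f,
  [/\ forall x y, f (x + y) = f x + f y,
      forall (t : R) x, f (t%:C%C *: x) = t * f x,
      forall x, f x <= p x & f v = p v].
Proof.
move=> sp; have [f [sf fp fmin]] := minimal_sublinear (lower_sublinear v sp).
have [fD _] := sf.
have fDE x y : f (x + y) = f x + f y.
  apply/eqP; rewrite eq_le fD/= -lerBrDr.
  rewrite -{1}(fmin _ (lower_sublinear y sf)); last by move=> ?; exact: lower_le_id.
  by have := lower_le y x sf ler01; rewrite scale1r mul1r.
have f0 : f 0 = 0 by apply: (@addrI _ (f 0)); rewrite -fDE !addr0.
have fN x : f (- x) = - f x.
  by apply/eqP; rewrite -addr_eq0 -fDE addNr f0.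
exists f; split=> // [t x|x|].
- have [t0|t0] := leP 0 t; first exact: sublinearZ.
  rewrite -[t]opprK rmorphN scaleNr fN sublinearZ ?oppr_ge0 ?ltW//.
  by rewrite mulNr !opprK.
- by apply: le_trans (fp x) _; exact: lower_le_id.
- apply/eqP; rewrite eq_le (le_trans (fp _) (lower_le_id _ _ sp))//=.
  rewrite -lerN2 -fN; apply: (le_trans (fp _)).
  apply: (le_trans (lower_le _ _ sp ler01)).
  rewrite scale1r addNr mul1r -[0](scale0r 0) (sublinearZ _ sp)//.
  by rewrite mul0r sub0r.
Qed.

End HahnBanach.

(** * States *)

Lemma norm_ReC (R : realType) (V : normedModType R[i]) (v : V) :
  `|v| = (complex.Re `|v|)%:C%C.
Proof. by rewrite RRe_real// ger0_real. Qed.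

Section States.
Variables (R : realType) (A : cstarType R).
Implicit Types (a h x y : A) (c : R[i]).

Definition positive_functional (phi : A -> R[i]) : Prop :=
  (forall c x y, phi (c *: x + y) = c * phi x + phi y) /\
  (forall x, 0 <= phi (star x ** x)).

Let nr x : R := complex.Re `|x|.

Let nrE x : `|x| = (nr x)%:C%C.
Proof. exact: norm_ReC. Qed.

Let nr_sublinear : sublinear nr.
Proof.
split=> [x y|t x t0]; rewrite -lecR.
  by rewrite rmorphD /= -!nrE ler_normD.
by rewrite rmorphM /= -!nrE normrZ ger0_norm// lecR.
Qed.

(** From [h <= 1] follows [2 h <= 1 + h <= |1 + h|], and [2 h] has norm 2. *)
Lemma norm_cone_add_pos h : pos h -> `|h| = 1 -> `|cone + h| = 2.
Proof.
move=> ph h1; apply/eqP; rewrite eq_le; apply/andP; split.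
  by apply: (le_trans (ler_normD _ _)); rewrite norm_cone h1.
have -> : 2 = `|2 *: h| by rewrite normrZ h1 mulr1 ger0_norm.
have p1 : pos (cone - h).
  rewrite -[cone]scale1r; apply: pos_scalB; [by case: ph|by rewrite h1].
apply: pos_norm_le => //; first exact: posZ.
have -> : `|cone + h| *: cone - 2 *: h =
    (`|cone + h| *: cone - (cone + h)) + (cone - h).
  by rewrite -addrr2 -[RHS]addrA !opprD addrACA addNr add0r.
apply: posD => //; apply: pos_scalB => //.
by case: ph => sh _; rewrite starD star_one sh.
Qed.

(** With [h] the normalization of [a^* a], a functional below the norm that reaches 2 at [1 + h]
    must take the value 1 at both [1] and [h], since neither value can exceed 1. *)
Lemma exists_positive_functional a : a != 0 -> exists phi : A -> R[i],
  [/\ positive_functional phi, phi cone = 1 & phi (star a ** a) = `|a| ^+ 2].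
Proof.
move=> a0; pose r := `|star a ** a|; pose h := r^-1 *: (star a ** a).
have r0 : 0 < r by rewrite /r cstar_norm exprn_gt0// normr_gt0.
have ph : pos h by apply: posZ; [rewrite invr_ge0 ltW|exact: pos_starM].
have h1 : `|h| = 1.
  by rewrite normrZ ger0_norm ?invr_ge0 ?ltW// mulVf// gt_eqF.
have [f [fD fZ fn fh]] := hahn_banach (cone + h) nr_sublinear.
have nr1 x : `|x| = 1 -> f x <= 1.
  by move=> x1; apply: (le_trans (fn x)); rewrite /nr x1.
have f1h : f cone + f h = 2.
  by rewrite -fD fh /nr norm_cone_add_pos//.
have f1 : f cone = 1.
  apply/eqP; rewrite eq_le nr1 ?norm_cone//= -(lerD2r (f h)) f1h.
  by rewrite [leRHS]/(1 + 1) lerD2l nr1.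
have fh1 : f h = 1.
  by apply: (@addrI _ (f cone)); rewrite f1h f1.
have f0 : f 0 = 0 by apply: (@addrI _ (f 0)); rewrite -fD !addr0.
have fN x : f (- x) = - f x by apply/eqP; rewrite -addr_eq0 -fD addNr f0.
(* Positivity follows from [f 1 = 1] and [| |q| - q | <= |q|]. *)
have fpos q : pos q -> 0 <= f q.
  move=> pq; have := fn (`|q| *: cone - q).
  rewrite fD fN nrE fZ f1 mulr1 lerBlDr => qn.
  rewrite -(lerD2l (nr q)) addr0; apply: (le_trans qn); rewrite lerD2r.
  by rewrite -lecR -!nrE; exact: pos_scalB_norm.
(* [f] is only real linear; applying it to the real and imaginary parts gives a complex linear
   functional that agrees with [f] on self-adjoint elements. *)
pose re x := 2^-1 *: (x + star x).
pose im x := (2^-1 * - 'i) *: (x - star x).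
pose phi x := (f (re x))%:C%C + 'i * (f (im x))%:C%C.
have reD x y : re (x + y) = re x + re y.
  by rewrite /re starD addrACA scalerDr.
have imD x y : im (x + y) = im x + im y.
  by rewrite /im starD opprD addrACA scalerDr.
have realK (t : R) : (t%:C%C)^* = t%:C%C :> R[i].
  by rewrite conj_Creal// complex_real.
have reZ (t : R) x : re (t%:C%C *: x) = t%:C%C *: re x.
  by rewrite /re starZ realK -scalerDr !scalerA mulrC.
have imZ (t : R) x : im (t%:C%C *: x) = t%:C%C *: im x.
  by rewrite /im starZ realK -scalerBr !scalerA mulrC.
have rei x : re ('i *: x) = - im x.
  rewrite /re /im starZ conjCi scaleNr -scalerBr scalerA.
  by rewrite mulrN scaleNr opprK.
have imi x : im ('i *: x) = re x.
  rewrite /re /im starZ conjCi scaleNr opprK -scalerDr scalerA.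
  by rewrite -mulrA mulNr -expr2 sqrCi opprK mulr1.
have phiD x y : phi (x + y) = phi x + phi y.
  by rewrite /phi reD imD !fD !rmorphD mulrDr addrACA.
have phiR (t : R) x : phi (t%:C%C *: x) = t%:C%C * phi x.
  by rewrite /phi reZ imZ !fZ !rmorphM mulrDr mulrCA.
have phii x : phi ('i *: x) = 'i * phi x.
  by rewrite /phi rei imi fN rmorphN mulrDr mulrA -expr2 sqrCi mulN1r addrC.
have phisa x : star x = x -> phi x = (f x)%:C%C.
  move=> sx; rewrite /phi /re /im sx subrr scaler0 f0 rmorph0 mulr0 addr0.
  by rewrite addrr2 scalerA mulVf ?pnatr_eq0// scale1r.
exists phi; split; [split=> [c x y|x]| |].
- rewrite phiD; congr (_ + _); rewrite {1}[c]complexE scalerDl phiD phiR.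
  by rewrite -scalerA phii phiR mulrA -mulrDl -complexE.
- have px := pos_starM x.
  by rewrite phisa ?starM ?starK// lecR fpos.
- by rewrite phisa ?star_one// f1.
- have -> : star a ** a = (complex.Re r)%:C%C *: h.
    by rewrite -norm_ReC scalerA divff ?scale1r// gt_eqF.
  have sh : star h = h by case: ph.
  by rewrite phiR phisa// fh1 mulr1 -norm_ReC /r cstar_norm.
Qed.

End States.

(** * Hilbert spaces from positive definite kernels *)

(** Shared by the dual norm of [rkhs] and the operator norm; [M] is real so that [inf] applies. *)
Definition dominates (R : realType) (I : Type) (u v : I -> R[i]) (M : R) : Prop :=
  0 <= M /\ forall i, u i <= M%:C%C * v i.

(** Each index with [v i > 0] imposes a closed half-line of constants, so the infimum still
    dominates; where [v i = 0] the constant is irrelevant. *)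
Lemma inf_dominates (R : realType) (I : Type) (u v : I -> R[i]) (M : R) :
  (forall i, 0 <= u i) -> (forall i, 0 <= v i) -> dominates u v M ->
  dominates u v (inf (dominates u v)).
Proof.
move=> u0 v0 uvM; split; first by apply: lb_le_inf; [exists M|move=> r []].
move=> i; have [vi0|vin] := eqVneq (v i) 0.
  by case: uvM => _ /(_ i); rewrite vi0 !mulr0.
have vp : 0 < v i by rewrite lt_def vin v0.
have uv0 : 0 <= u i / v i by rewrite divr_ge0.
have uvE : (complex.Re (u i / v i))%:C%C = u i / v i by rewrite RRe_real// ger0_real.
rewrite -ler_pdivrMr// -uvE lecR; apply: lb_le_inf; first by exists M.
by move=> N [_ uvN]; rewrite -lecR uvE ler_pdivrMr.
Qed.

Lemma ge_inf_dominates (R : realType) (I : Type) (u v : I -> R[i]) (M : R) :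
  dominates u v M -> inf (dominates u v) <= M.
Proof. by move=> uvM; apply: ge_inf => //; exists 0 => r []. Qed.

Record pdkernel (R : realType) (X : Type) := PDKernel {
  pdk :> X -> X -> R[i];
  pdk_herm : forall x y, pdk x y = (pdk y x)^*;
  pdk_ge0 : forall t : seq (R[i] * X),
    0 <= \sum_(a <- t) \sum_(b <- t) b.1^* * (a.1 * pdk a.2 b.2)
}.

Lemma normc_ReC (R : realType) (z : R[i]) : `|z| = (complex.Re `|z|)%:C%C.
Proof. by rewrite RRe_real// ger0_real. Qed.

Lemma Re_norm_ge0 (R : realType) (z : R[i]) : 0 <= complex.Re `|z|.
Proof. by rewrite -lecR -normc_ReC; exact: normr_ge0. Qed.

(** The common core of both Cauchy-Schwarz inequalities: the minimum of the quadratic form is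
    reached at [l = - b / c]. *)
Lemma discriminant_le (R : realType) (a c b : R[i]) : 0 <= a -> 0 <= c ->
  (forall l, 0 <= a + l^* * b + l * b^* + l * l^* * c) -> `|b| ^+ 2 <= a * c.
Proof.
move=> a0 c0 abc; have [c00|cn] := eqVneq c 0.
  have [->|bn] := eqVneq b 0; first by rewrite normr0 expr0n mulr_ge0.
  have b0 : 0 < b * b^* by rewrite -normCK exprn_gt0// normr_gt0.
  (* With [c = 0] the form is affine, and [l = - s b] gives it the negative value [- (a + 2)]. *)
  pose s := (a + 1) / (b * b^*).
  have sr : s^* = s.
    by rewrite conjc_ge0// divr_ge0 ?addr_ge0// ltW.
  have := abc (- (s * b)); rewrite rmorphN rmorphM /= sr c00 mulr0 addr0.
  have -> : a + - (s * b^*) * b + - (s * b) * b^* = - (a + 2).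
    have -> : a + - (s * b^*) * b + - (s * b) * b^* = a - 2 * (s * (b * b^*)).
      by ring.
    by rewrite /s divfK ?gt_eqF//; ring.
  rewrite oppr_ge0 => h; exfalso; move: h; apply/negP.
  by rewrite -real_ltNge ?realE ?lexx ?addr_ge0// ltr_wpDl.
have cp : 0 < c by rewrite lt_def cn.
have := abc (- (b / c)); rewrite rmorphN rmorphM fmorphV /= (conjc_ge0 c0).
have -> : a + - (b^* / c) * b + - (b / c) * b^* + - (b / c) * - (b^* / c) * c =
    a - b * b^* / c.
  by field.
by rewrite subr_ge0 ler_pdivrMr// normCK.
Qed.

Section FormalCombinations.
Variables (R : realType) (X : Type) (k : pdkernel R X).
Implicit Types (f g : X -> cplx R) (s t : seq (R[i] * X)) (c : R[i]).

(** The inner product of the vector represented by [f] with the combination [t]; hence the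
    conjugated coefficients. *)
Definition comb_eval f t : R[i] := \sum_(a <- t) a.1^* * f a.2.

Definition comb t : X -> cplx R := fun y => \sum_(a <- t) a.1 * k a.2 y.

Definition comb_scale c t : seq (R[i] * X) := [seq (c * a.1, a.2) | a <- t].

Local Notation b := (fun s t => comb_eval (comb s) t).

Lemma comb_eval1 f x : comb_eval f [:: (1, x)] = f x.
Proof. by rewrite /comb_eval big_seq1 conjC1 mul1r. Qed.

Lemma comb_evalD f g t : comb_eval (f + g) t = comb_eval f t + comb_eval g t.
Proof. by rewrite -big_split; apply: eq_bigr => a _; rewrite mulrDr. Qed.

Lemma comb_evalZ c f t : comb_eval (c *: f) t = c * comb_eval f t.
Proof. by rewrite mulr_sumr; apply: eq_bigr => a _; rewrite mulrCA. Qed.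

Lemma comb_evalB f g t : comb_eval (f - g) t = comb_eval f t - comb_eval g t.
Proof. by rewrite -scaleN1r comb_evalD comb_evalZ mulN1r. Qed.

Lemma comb_eval_cat f s t : comb_eval f (s ++ t) = comb_eval f s + comb_eval f t.
Proof. exact: big_cat. Qed.

Lemma comb_eval_scale f c t : comb_eval f (comb_scale c t) = c^* * comb_eval f t.
Proof.
rewrite /comb_eval big_map mulr_sumr; apply: eq_bigr => a _ /=.
by rewrite rmorphM mulrA.
Qed.

Lemma comb_cat s t : comb (s ++ t) = comb s + comb t.
Proof. by apply/funext => y; exact: big_cat. Qed.

Lemma combZ c t : comb (comb_scale c t) = c *: comb t.
Proof.
apply/funext => y; rewrite /comb big_map [RHS]mulr_sumr.
by apply: eq_bigr => a _ /=; rewrite mulrA.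
Qed.

Lemma comb_form_herm s t : b s t = (b t s)^*.
Proof.
rewrite /comb_eval /comb rmorph_sum /=.
under eq_bigr do rewrite mulr_sumr.
rewrite exchange_big /=; apply: eq_bigr => x _.
rewrite rmorphM /= conjCK rmorph_sum mulr_sumr /=; apply: eq_bigr => y _.
by rewrite rmorphM /= -pdk_herm mulrCA.
Qed.

Lemma comb_form_ge0 t : 0 <= b t t.
Proof.
have := pdk_ge0 k t; rewrite exchange_big /=.
by congr (0 <= _); apply: eq_bigr => x _; rewrite mulr_sumr.
Qed.

Definition comb_norm t : R[i] := sqrtC (b t t).

Lemma comb_norm_ge0 t : 0 <= comb_norm t.
Proof. by rewrite sqrtC_ge0 comb_form_ge0. Qed.

Lemma comb_normK t : comb_norm t ^+ 2 = b t t.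
Proof. exact: sqrtCK. Qed.

Lemma comb_cauchy_schwarz s t : `|b s t| <= comb_norm s * comb_norm t.
Proof.
rewrite -(@ler_pXn2r _ 2) ?nnegrE ?mulr_ge0 ?comb_norm_ge0// exprMn !comb_normK.
apply: discriminant_le; rewrite ?comb_form_ge0// => l.
have := comb_form_ge0 (s ++ comb_scale l t).
rewrite comb_eval_cat comb_eval_scale comb_cat combZ !comb_evalD !comb_evalZ.
rewrite [b t s]comb_form_herm; congr (0 <= _).
by ring.
Qed.

(** Norm by duality: [f] is measured as a functional on formal combinations. *)
Definition comb_bound f : R -> Prop :=
  dominates (fun t => `|comb_eval f t|) comb_norm.

Lemma comb_boundD f g M M' : comb_bound f M -> comb_bound g M' ->
  comb_bound (f + g) (M + M').
Proof.
move=> [M0 fM] [M'0 gM]; split; first exact: addr_ge0.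
move=> t; rewrite comb_evalD (le_trans (ler_normD _ _))// rmorphD mulrDl.
by rewrite lerD ?fM ?gM.
Qed.

Lemma comb_boundZ c f M : comb_bound f M ->
  comb_bound (c *: f) (complex.Re `|c| * M).
Proof.
move=> [M0 fM]; split; first by rewrite mulr_ge0// Re_norm_ge0.
move=> t; rewrite comb_evalZ normrM rmorphM /= -normc_ReC -mulrA.
by rewrite ler_wpM2l.
Qed.

Lemma comb_bound_le f M M' : M <= M' -> comb_bound f M -> comb_bound f M'.
Proof.
move=> MM [M0 fM]; split; first exact: le_trans MM.
move=> t; apply: (le_trans (fM t)).
by rewrite ler_wpM2r ?comb_norm_ge0// lecR.
Qed.

Lemma comb_bound_comb t : comb_bound (comb t) (complex.Re (comb_norm t)).
Proof.
rewrite /comb_bound /dominates -lecR RRe_real ?ger0_real ?comb_norm_ge0//.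
by split => // s; exact: comb_cauchy_schwarz.
Qed.

Lemma comb_bound0 : comb_bound 0 0.
Proof.
split=> // t; rewrite mul0r /comb_eval big1 ?normr0// => a _.
by rewrite mulr0.
Qed.

Lemma comb_norm_le t M : comb_bound (comb t) M -> comb_norm t <= M%:C%C.
Proof.
move=> [M0 /(_ t)]; rewrite ger0_norm ?comb_form_ge0// -comb_normK expr2.
have := comb_norm_ge0 t; rewrite le_eqVlt => /orP[/eqP <- _|n0].
  by rewrite lecR.
by rewrite ler_pM2r.
Qed.

(** The closure of the combinations in the dual norm. Null combinations are the zero function, so a
    degenerate kernel is quotiented implicitly. *)
Definition limit_comb : {pred X -> cplx R} :=
  fun f => `[< forall e : R, 0 < e -> exists t, comb_bound (f - comb t) e >].

Lemma limit_combP f : reflect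
  (forall e : R, 0 < e -> exists t, comb_bound (f - comb t) e)
  (f \in limit_comb).
Proof. exact: asboolP. Qed.

Lemma limit_comb_comb t : comb t \in limit_comb.
Proof.
apply/limit_combP => e e0; exists t; rewrite subrr.
by apply: (comb_bound_le (ltW e0)); exact: comb_bound0.
Qed.

Lemma limit_comb_submod : submod_closed limit_comb.
Proof.
split=> [|c f g /limit_combP fP /limit_combP gP].
  have -> : 0 = comb [::] by apply/funext => x; rewrite /comb big_nil.
  exact: limit_comb_comb.
apply/limit_combP => e e0; pose c' := complex.Re `|c|.
have c'0 : 0 <= c' := Re_norm_ge0 c.
have e1 : 0 < e / (c' + 1) by rewrite divr_gt0// ltr_wpDl.
have [s fs] := fP _ e1; have [t gt] := gP _ e1.
exists (comb_scale c s ++ t).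
rewrite comb_cat combZ opprD addrACA -scalerBr.
have -> : e = c' * (e / (c' + 1)) + e / (c' + 1).
  by rewrite -[X in _ * _ + X]mul1r -mulrDl mulrCA divff ?mulr1// gt_eqF// ltr_wpDl.
by apply: comb_boundD => //; exact: comb_boundZ.
Qed.

HB.instance Definition _ :=
  GRing.isSubmodClosed.Build _ _ limit_comb limit_comb_submod.

End FormalCombinations.

(* The completion of the formal combinations of points of [X] for [k], realized *)
(* as functions on [X]: [f] stands for the vector whose inner product with   *)
(* the point [x] is [f x].                                                     *)
Record rkhs (R : realType) (X : Type) (k : pdkernel R X) := RKHS {
  rkhs_fun :> X -> cplx R;
  rkhs_limit : rkhs_fun \in limit_comb k
}.

Section RKHSModule.
Variables (R : realType) (X : Type) (k : pdkernel R X).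
HB.instance Definition _ := [isSub for @rkhs_fun R X k].
HB.instance Definition _ := [Choice of rkhs k by <:].
HB.instance Definition _ := [SubChoice_isSubLmodule of rkhs k by <:].
End RKHSModule.

(** * Norm and completeness of the kernel space *)

Section RKHSNorm.
Variables (R : realType) (X : Type) (k : pdkernel R X).
Implicit Types (f g : rkhs k) (c : R[i]) (s t : seq (R[i] * X)).

Lemma rkhs_funD f g : rkhs_fun (f + g) = rkhs_fun f + rkhs_fun g.
Proof. by []. Qed.

Lemma rkhs_funZ c f : rkhs_fun (c *: f) = c *: rkhs_fun f.
Proof. by []. Qed.

Lemma rkhs_funB f g : rkhs_fun (f - g) = rkhs_fun f - rkhs_fun g.
Proof. by []. Qed.

Lemma rkhs_eq f g : rkhs_fun f = rkhs_fun g -> f = g.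
Proof. exact: val_inj. Qed.

Definition rkhs_comb t : rkhs k := RKHS (limit_comb_comb k t).

Lemma rkhs_approx f (e : R) : 0 < e -> exists t, comb_bound k (rkhs_fun f - comb k t) e.
Proof. by have /limit_combP fP := rkhs_limit f; exact: fP. Qed.

Definition rkhs_norm f : R := inf (comb_bound k (rkhs_fun f)).

Lemma rkhs_norm_le f M : comb_bound k (rkhs_fun f) M -> rkhs_norm f <= M.
Proof. exact: ge_inf_dominates. Qed.

Lemma rkhs_norm_bound f : comb_bound k (rkhs_fun f) (rkhs_norm f).
Proof.
have [t ft] := rkhs_approx f ltr01.
have ne : comb_bound k (rkhs_fun f) (1 + complex.Re (comb_norm k t)).
  rewrite -[X in comb_bound _ X](subrK (comb k t)).
  by apply: comb_boundD => //; exact: comb_bound_comb.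
by apply: inf_dominates ne => // s; exact: comb_norm_ge0.
Qed.

Lemma rkhs_norm_ge0 f : 0 <= rkhs_norm f.
Proof. by case: (rkhs_norm_bound f). Qed.

Let normD f g : (rkhs_norm (f + g))%:C%C <= (rkhs_norm f)%:C%C + (rkhs_norm g)%:C%C :> R[i].
Proof.
rewrite -rmorphD lecR; apply: rkhs_norm_le.
by rewrite rkhs_funD; apply: comb_boundD; exact: rkhs_norm_bound.
Qed.

Let normZ_le c f : rkhs_norm (c *: f) <= complex.Re `|c| * rkhs_norm f.
Proof.
by apply: rkhs_norm_le; rewrite rkhs_funZ; exact/comb_boundZ/rkhs_norm_bound.
Qed.

Let normZ c f : (rkhs_norm (c *: f))%:C%C = `|c| * (rkhs_norm f)%:C%C :> R[i].
Proof.
have [->|c0] := eqVneq c 0.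
  rewrite scale0r normr0 mul0r; apply/eqP; rewrite eq_le !lecR rkhs_norm_ge0 andbT.
  by apply: rkhs_norm_le; exact: comb_bound0.
apply/eqP; rewrite eq_le; apply/andP; split.
  by rewrite normc_ReC -rmorphM lecR normZ_le.
have := normZ_le c^-1 (c *: f); rewrite scalerA mulVf// scale1r.
rewrite -lecR rmorphM /= -normc_ReC normfV ler_pdivlMl ?normr_gt0//.
Qed.

Let norm_eq0 f : (rkhs_norm f)%:C%C = 0 :> R[i] -> f = 0.
Proof.
move=> f0; apply/rkhs_eq/funext => x.
have [_ /(_ [:: (1, x)])] := rkhs_norm_bound f.
by rewrite f0 mul0r normr_le0 comb_eval1 => /eqP.
Qed.

HB.instance Definition _ :=
  Lmodule_isNormed.Build R[i] (rkhs k) normD normZ norm_eq0.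

Lemma rkhs_normE f : `|f| = (rkhs_norm f)%:C%C. Proof. by []. Qed.

Lemma comb_eval_le f t : `|comb_eval (rkhs_fun f) t| <= `|f| * comb_norm k t.
Proof. by have [_] := rkhs_norm_bound f; exact. Qed.

Lemma rkhs_norm_leP f (M : R) : comb_bound k (rkhs_fun f) M <-> `|f| <= M%:C%C.
Proof.
rewrite rkhs_normE lecR; split; first exact: rkhs_norm_le.
by move=> fM; apply: comb_bound_le fM _; exact: rkhs_norm_bound.
Qed.

Lemma rkhs_comb_norm t : `|rkhs_comb t| = comb_norm k t.
Proof.
have nE : (complex.Re (comb_norm k t))%:C%C = comb_norm k t.
  by rewrite RRe_real// ger0_real// comb_norm_ge0.
apply/eqP; rewrite eq_le; apply/andP; split.
  by rewrite -nE; apply/rkhs_norm_leP; exact: comb_bound_comb.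
by apply: comb_norm_le; exact: rkhs_norm_bound.
Qed.

Lemma rkhs_combP f (e : R[i]) : 0 < e -> exists t, `|f - rkhs_comb t| <= e.
Proof.
move=> e0; have [e' -> e'0] : exists2 e', e = e'%:C%C & 0 < e'.
  have /complex_realP[e' ee'] : e \is Num.real by rewrite gtr0_real.
  by exists e' => //; rewrite -ltcR -ee'.
by have [t ft] := rkhs_approx f e'0; exists t; apply/rkhs_norm_leP.
Qed.

(** Evaluation at a point is bounded, so a Cauchy filter has a pointwise limit, and it remains to
    see that convergence holds in norm. *)
Lemma rkhs_complete (F : set_system (rkhs k)) :
  ProperFilter F -> cauchy F -> cvg F.
Proof.
move=> FF /cauchy_ballP Fc.
have ptw x : cvg ((fun f : rkhs k => rkhs_fun f x) @ F).
  apply/cauchy_cvgP/cauchy_ballP => e e0.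
  have n0 : 0 < comb_norm k [:: (1, x)] + 1.
    by rewrite ltr_wpDl// comb_norm_ge0.
  have e1 : 0 < e / (comb_norm k [:: (1, x)] + 1) by rewrite divr_gt0.
  have [[A B] /= [FA FB] AB] := Fc _ e1.
  exists ((fun f : rkhs k => rkhs_fun f x) @` A, (fun f : rkhs k => rkhs_fun f x) @` B) => /=.
    split; first by apply: filterS FA => f Af; exists f.
    by apply: filterS FB => f Bf; exists f.
  move=> [_ _] /= [[f Af <-] [g Bg <-]].
  have /= := AB (f, g) (conj Af Bg); rewrite -!ball_normE /= => fg.
  have := comb_eval_le (f - g) [:: (1, x)].
  rewrite comb_eval1 => h.
  apply: (le_lt_trans h).
  apply: (@le_lt_trans _ _ (`|f - g| * (comb_norm k [:: (1, x)] + 1))).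
    by rewrite ler_wpM2l// lerDl.
  by rewrite -ltr_pdivlMr.
have /choice[l Fl] : forall x, exists y : cplx R, (fun f : rkhs k => rkhs_fun f x) @ F --> y.
  by move=> x; apply/cvg_ex; exact: ptw.
have evl t (e : R[i]) : 0 < e -> \forall g \near F, `|comb_eval (l - rkhs_fun g) t| < e.
  elim: t e => [|a t IH] e e0.
    by apply: nearW => g; rewrite /comb_eval big_nil normr0.
  have a1 : 0 < `|a.1| + 1 by rewrite ltr_wpDl.
  have e2 : 0 < e / 2 by rewrite divr_gt0.
  have e3 : 0 < e / 2 / (`|a.1| + 1) by rewrite divr_gt0.
  have /cvgrPdist_lt /(_ _ e3) Fa := Fl a.2.
  apply: filterS2 (IH _ e2) Fa => g gt ga.
  rewrite /comb_eval big_cons [ltRHS]splitr addrC.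
  apply: (le_lt_trans (ler_normD _ _)); apply: ltr_leD => //.
  rewrite normrM norm_conjC.
  apply: (@le_trans _ _ ((`|a.1| + 1) * (e / 2 / (`|a.1| + 1)))).
    by rewrite ler_pM// ?lerDl// ltW.
  by rewrite mulrC divfK// gt_eqF.
(* The comparison element [g] depends on the combination [t], but the bound on its distance to [f]
   does not, so the estimate is uniform in [t]. *)
have lF (e : R) : 0 < e -> \forall f \near F, comb_bound k (l - rkhs_fun f) e.
  move=> e0; have e0' : 0 < e%:C%C :> R[i] by rewrite ltcR.
  have [[A B] /= [FA FB] AB] := Fc _ e0'.
  apply: filterS FA => f Af; split; first exact: ltW.
  move=> t; apply/ler_addgt0Pr => d d0.
  have [g [/= gt Bg]] := filter_ex (filterI (evl t d d0) FB).
  have -> : l - rkhs_fun f = (l - rkhs_fun g) + rkhs_fun (g - f).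
    by rewrite rkhs_funB addrA subrK.
  rewrite comb_evalD [leRHS]addrC (le_trans (ler_normD _ _))// lerD//.
    exact: ltW.
  apply: (le_trans (comb_eval_le _ _)); rewrite ler_wpM2r ?comb_norm_ge0//.
  by have := AB (f, g) (conj Af Bg); rewrite -ball_normE /= distrC => /ltW.
have lk : l \in limit_comb k.
  apply/limit_combP => e e0; have e2 : 0 < e / 2 by rewrite divr_gt0.
  have [f lf] := filter_ex (lF _ e2).
  have [t ft] := rkhs_approx f e2; exists t.
  rewrite [e]splitr -[l - _](subrKA (rkhs_fun f)).
  exact: comb_boundD.
apply/cvg_ex; exists (RKHS lk); apply/cvgrPdist_le => e e0.
have [e' -> e'0] : exists2 e', e = e'%:C%C & 0 < e'.
  have /complex_realP[e' ee'] : e \is Num.real by rewrite gtr0_real.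
  by exists e' => //; rewrite -ltcR -ee'.
by apply: filterS (lF _ e'0) => f lf; apply/rkhs_norm_leP.
Qed.

HB.instance Definition _ := Uniform_isComplete.Build (rkhs k) rkhs_complete.

End RKHSNorm.

Lemma split_scaled (K : numFieldType) (e m : K) : 0 <= m ->
  e = (m + 1) * (e / (2 * (m + 1)) + e / (2 * (m + 1))).
Proof. by move=> m0; field; rewrite gt_eqF// ltr_wpDl. Qed.

(** * Inner product of the kernel space *)

Section RKHSDot.
Variables (R : realType) (X : Type) (k : pdkernel R X).
Implicit Types (f g h : rkhs k) (c : R[i]) (s t : seq (R[i] * X)).
Local Notation cb := (rkhs_comb k).
Local Notation ev := comb_eval.

Lemma rkhs_comb_cat s t : cb (s ++ t) = cb s + cb t.
Proof. by apply: rkhs_eq; exact: comb_cat. Qed.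

Lemma rkhs_comb_scale c t : cb (comb_scale c t) = c *: cb t.
Proof. by apply: rkhs_eq; exact: combZ. Qed.

Lemma comb_eval_dist f s t : `|ev f s - ev f t| <= `|f| * `|cb s - cb t|.
Proof.
have -> : ev f s - ev f t = ev f (s ++ comb_scale (-1) t).
  by rewrite comb_eval_cat comb_eval_scale rmorphN1 mulN1r.
have -> : cb s - cb t = cb (s ++ comb_scale (-1) t).
  by rewrite rkhs_comb_cat rkhs_comb_scale scaleN1r.
by rewrite rkhs_comb_norm comb_eval_le.
Qed.

Lemma comb_eval_comb_eq0 f t : comb k t = 0 -> ev f t = 0.
Proof.
move=> t0; apply/eqP; rewrite -normr_le0; apply: (le_trans (comb_eval_le f t)).
rewrite -rkhs_comb_norm; have -> : cb t = 0 by exact: rkhs_eq.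
by rewrite normr0 mulr0.
Qed.

(** Extension by continuity of the pairing of [f] with combinations, which approximate [g]. *)
Let rdot_exists f g :
  exists c : cplx R, forall s, `|c - ev f s| <= `|f| * `|g - cb s|.
Proof.
pose P (e : R[i]) : set (cplx R) :=
  [set (comb_eval (rkhs_fun f) s : cplx R) | s in [set s | `|g - cb s| <= e]].
have C0 : 0 <= 2 * `|f| by rewrite mulr_ge0.
have [|||c cP] := @approx_limit R (cplx R) P _ C0.
- by move=> e e' ee _ [s /= gs <-]; exists s => //=; exact: le_trans ee.
- by move=> e /(rkhs_combP g)[s gs]; exists (ev f s); exists s.
- move=> e _ _ e0 [s /= gs <-] [s' /= gs' <-].
  rewrite (le_trans (comb_eval_dist f s s'))//.
  rewrite [2 * _]mulrC -mulrA ler_wpM2l// mulr_natl mulr2n.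
  by rewrite -(subrKA g) (le_trans (ler_normD _ _))// lerD// distrC.
exists c => s; have f1 : 0 <= 3 * `|f| by rewrite mulr_ge0.
suff key (e : R[i]) : 0 < e -> `|c - ev f s| <= `|f| * `|g - cb s| + (3 * `|f|) * e.
  apply/ler_addgt0Pr => e e0; have f2 : 0 < 3 * `|f| + 1 by rewrite ltr_wpDl.
  apply: (le_trans (key (e / (3 * `|f| + 1)) _)); first by rewrite divr_gt0.
  by rewrite lerD2l mulrA ler_pdivrMr// mulrC ler_wpM2l ?(ltW e0)// lerDl.
move=> e0; have [s' gs'] := rkhs_combP g e0.
have cs' : `|c - ev f s'| <= 2 * `|f| * e by apply: cP => //; exists s'.
rewrite -(subrKA (ev f s')) (le_trans (ler_normD _ _))//.
have -> : `|f| * `|g - cb s| + 3 * `|f| * e =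
    2 * `|f| * e + `|f| * (e + `|g - cb s|) by ring.
rewrite lerD// (le_trans (comb_eval_dist f s' s))// ler_wpM2l//.
by rewrite -(subrKA g) (le_trans (ler_normD _ _))// lerD2r distrC.
Qed.

Definition rkhs_dot f g : R[i] := projT1 (cid (rdot_exists f g)).

Lemma rkhs_dotP f g s : `|rkhs_dot f g - ev f s| <= `|f| * `|g - cb s|.
Proof. by rewrite /rkhs_dot; case: cid. Qed.

(** A candidate that depends on [g] as continuously as the pairing does must be the inner product;
    linearity and adjoint relations are checked this way. *)
Lemma rkhs_dot_eq f g c (C : R[i]) : 0 <= C ->
  (forall s, `|c - ev f s| <= C * `|g - cb s|) -> rkhs_dot f g = c.
Proof.
move=> C0 cP; apply/eqP; rewrite -subr_eq0; apply/eqP.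
apply: (@norm_eq0_approx _ (cplx R) _ (`|f| + C)); first by rewrite addr_ge0.
move=> e e0; have [s gs] := rkhs_combP g e0.
rewrite -(subrKA (ev f s)) (le_trans (ler_normD _ _))//.
rewrite mulrDl lerD//; first by rewrite (le_trans (rkhs_dotP _ _ _))// ler_wpM2l.
by rewrite distrC (le_trans (cP _))// ler_wpM2l.
Qed.

Lemma rkhs_dot_comb f s : rkhs_dot f (cb s) = ev f s.
Proof.
apply/eqP; rewrite -subr_eq0 -normr_le0; apply: (le_trans (rkhs_dotP _ _ s)).
by rewrite subrr normr0 mulr0.
Qed.

Lemma rkhs_dot_linear c f f' g :
  rkhs_dot (c *: f + f') g = c * rkhs_dot f g + rkhs_dot f' g.
Proof.
apply: (@rkhs_dot_eq _ _ _ (`|c| * `|f| + `|f'|)) => [|s].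
  by rewrite addr_ge0// mulr_ge0.
rewrite comb_evalD comb_evalZ opprD addrACA -mulrBr.
rewrite (le_trans (ler_normD _ _))// mulrDl lerD ?rkhs_dotP//.
by rewrite normrM -mulrA ler_wpM2l// rkhs_dotP.
Qed.

Lemma rkhs_dotBl f f' g : rkhs_dot (f - f') g = rkhs_dot f g - rkhs_dot f' g.
Proof. by rewrite addrC -scaleN1r rkhs_dot_linear mulN1r addrC. Qed.

Lemma rkhs_comb_dot t g : rkhs_dot (cb t) g = (ev g t)^*.
Proof.
apply: (@rkhs_dot_eq _ _ _ (comb_norm k t)) => [|s]; first exact: comb_norm_ge0.
rewrite comb_form_herm -rmorphB norm_conjC -comb_evalB mulrC.
exact: (comb_eval_le (g - cb s)).
Qed.

Lemma rkhs_dot_cauchy_schwarz f g : `|rkhs_dot f g| <= `|f| * `|g|.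
Proof.
apply/ler_addgt0Pr => e e0.
have f1 : 0 < 2 * (`|f| + 1) by rewrite mulr_gt0// ltr_wpDl.
have d0 : 0 < e / (2 * (`|f| + 1)) by rewrite divr_gt0.
have [s gs] := rkhs_combP g d0; set d := e / _ in d0 gs.
have ed : e = (`|f| + 1) * (d + d).
  exact: split_scaled.
rewrite -[rkhs_dot f g](subrK (ev f s)) (le_trans (ler_normD _ _))//.
apply: (@le_trans _ _ (`|f| * d + `|f| * (`|g| + d))).
  rewrite lerD//; first by rewrite (le_trans (rkhs_dotP _ _ _))// ler_wpM2l.
  rewrite (le_trans (comb_eval_le _ _))// ler_wpM2l// -rkhs_comb_norm.
  rewrite -[cb s](subrK g) addrC (le_trans (ler_normD _ _))// lerD//.
  by rewrite distrC.
rewrite -mulrDr [d + _]addrC -addrA mulrDr lerD2l ed ler_wpM2r ?lerDl//.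
by rewrite ltW// addr_gt0.
Qed.

Lemma rkhs_dot_herm f g : rkhs_dot f g = (rkhs_dot g f)^*.
Proof.
apply/eqP; rewrite -subr_eq0; apply/eqP.
apply: (@norm_eq0_approx _ (cplx R) _ (2 * `|g|)); first by rewrite mulr_ge0.
move=> e e0; have [t ft] := rkhs_combP f e0.
have -> : rkhs_dot f g - (rkhs_dot g f)^* =
    rkhs_dot (f - cb t) g - (rkhs_dot g f - ev g t)^*.
  by rewrite rkhs_dotBl rkhs_comb_dot rmorphB opprB addrA subrK.
rewrite (le_trans (ler_normB _ _))// norm_conjC.
have -> : 2 * `|g| * e = e * `|g| + `|g| * e by ring.
rewrite lerD//.
  by rewrite (le_trans (rkhs_dot_cauchy_schwarz _ _))// ler_wpM2r.
by rewrite (le_trans (rkhs_dotP _ _ _))// ler_wpM2l.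
Qed.

Lemma rkhs_dot_norm f : `|f| ^+ 2 = rkhs_dot f f.
Proof.
apply/eqP; rewrite eq_sym -subr_eq0; apply/eqP.
apply: (@norm_eq0_approx _ (cplx R) _ (2 * (`|f| + `|f| + 1))).
  by rewrite mulr_ge0// !addr_ge0.
move=> e e0; have [d d0 [de d1]] := posmin e0 (@ltr01 R[i]).
have [t ft] := rkhs_combP f d0.
have tn : `|cb t| <= `|f| + 1.
  rewrite -[cb t](subrK f) addrC (le_trans (ler_normD _ _))// lerD//.
  by rewrite distrC (le_trans ft).
have fte := le_trans ft de.
have -> : rkhs_dot f f - `|f| ^+ 2 = rkhs_dot (f - cb t) f +
    ((rkhs_dot (f - cb t) (cb t))^* + (`|cb t| - `|f|) * (`|cb t| + `|f|)).
  rewrite !rkhs_dotBl rmorphB /= rkhs_comb_dot -rkhs_dot_comb.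
  rewrite -subr_sqr rkhs_comb_norm comb_normK rkhs_dot_comb [in RHS]rkhs_dot_comb.
  rewrite /= (conjc_ge0 (comb_form_ge0 k t)).
  by ring.
rewrite (le_trans (ler_normD _ _))//.
have -> : 2 * (`|f| + `|f| + 1) * e =
    e * `|f| + (e * (`|f| + 1) + e * (`|f| + 1 + `|f|)).
  by ring.
apply: lerD.
  by rewrite (le_trans (rkhs_dot_cauchy_schwarz _ _))// ler_wpM2r.
rewrite (le_trans (ler_normD _ _))// lerD//.
  rewrite norm_conjC (le_trans (rkhs_dot_cauchy_schwarz _ _))//.
  by rewrite ler_pM.
rewrite normrM ler_pM//.
  by rewrite (le_trans (ler_dist_dist _ _))// distrC.
by rewrite ger0_norm ?addr_ge0// lerD2r.
Qed.

Lemma rkhs_dot_bilinear :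
  bilinear_for (GRing.Scale.Law.clone _ _ ( *%R ) _)
    (GRing.Scale.Law.clone _ _ (@Num.conj R[i] \; *%R) _) rkhs_dot.
Proof.
split=> [g c f f'|f c g g'] /=; first exact: rkhs_dot_linear.
by rewrite rkhs_dot_herm rkhs_dot_linear rmorphD rmorphM /= -!rkhs_dot_herm.
Qed.

HB.instance Definition _ := bilinear_isBilinear.Build R[i] (rkhs k) (rkhs k) R[i]
  _ _ rkhs_dot rkhs_dot_bilinear.

Lemma rkhs_dot_hermitian f g :
  rkhs_dot f g = (-1) ^+ false * (rkhs_dot g f)^*.
Proof. by rewrite expr0 mul1r -rkhs_dot_herm. Qed.

Lemma rkhs_dot_gt0 f : f != 0 -> 0 < rkhs_dot f f.
Proof. by move=> f0; rewrite -rkhs_dot_norm exprn_gt0// normr_gt0. Qed.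

HB.instance Definition _ := isHermitianSesquilinear.Build R[i] (rkhs k) false
  (@Num.conj R[i]) rkhs_dot rkhs_dot_hermitian.
HB.instance Definition _ := isDotProduct.Build R[i] (rkhs k) rkhs_dot rkhs_dot_gt0.

HB.instance Definition _ := isHilbert.Build R (rkhs k)
  (dot := (rkhs_dot : {dot (rkhs k) for @Num.conj R[i]})) rkhs_dot_norm.

End RKHSDot.

(** * Kernel representations and the GNS construction *)

Section Pullback.
Variables (R : realType) (X : Type) (k : pdkernel R X).
Implicit Types (f g : rkhs k) (T : X -> X) (s t : seq (R[i] * X)).
Local Notation cb := (rkhs_comb k).

Definition comb_map T t : seq (R[i] * X) := [seq (a.1, T a.2) | a <- t].

(** Both maps are bounded by the same [M], which makes the notion symmetric in [T] and [T']. *)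
Record kernel_adjoint T T' (M : R) : Prop := KernelAdjoint {
  kadj : forall x y, k (T x) y = k x (T' y);
  kadj_ge0 : 0 <= M;
  kadj_bound : forall t, comb_norm k (comb_map T t) <= M%:C%C * comb_norm k t;
  kadj_bound' : forall t, comb_norm k (comb_map T' t) <= M%:C%C * comb_norm k t
}.

Lemma kernel_adjointC T T' M : kernel_adjoint T T' M -> kernel_adjoint T' T M.
Proof.
move=> [kT M0 bT bT']; split=> // x y.
by rewrite pdk_herm -kT -pdk_herm.
Qed.

Lemma comb_eval_map (f : X -> cplx R) T t :
  comb_eval f (comb_map T t) = comb_eval (f \o T) t.
Proof. by rewrite /comb_eval big_map. Qed.

Variables (T T' : X -> X) (M : R).
Hypothesis TT' : kernel_adjoint T T' M.

Lemma comb_map_comb t : comb k (comb_map T t) = comb k t \o T'.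
Proof.
apply/funext => y; rewrite /comb big_map; apply: eq_bigr => a _ /=.
by rewrite (kadj TT').
Qed.

Lemma comb_bound_pullback (f : X -> cplx R) (e : R) :
  comb_bound k f e -> comb_bound k (f \o T') (M * e).
Proof.
move=> [e0 fe]; split; first by rewrite mulr_ge0// (kadj_ge0 TT').
move=> t; rewrite -comb_eval_map (le_trans (fe _))//.
by rewrite mulrC rmorphM /= mulrAC ler_wpM2r ?lecR// (kadj_bound' TT').
Qed.

Lemma pullback_limit f : rkhs_fun f \o T' \in limit_comb k.
Proof.
apply/limit_combP => e e0.
have M1 : 0 < M + 1 by rewrite ltr_wpDl// (kadj_ge0 TT').
have e1 : 0 < e / (M + 1) by rewrite divr_gt0.
have [t ft] := rkhs_approx f e1; exists (comb_map T t).
rewrite comb_map_comb; apply: (@comb_bound_le _ _ _ _ (M * (e / (M + 1)))).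
  by rewrite mulrCA ler_piMr ?(ltW e0)// ler_pdivrMr// mul1r lerDl.
exact: comb_bound_pullback ft.
Qed.

(** The linear extension of [T]: the value at [x] of the image of [f] is its inner product with [x],
    that is of [f] with [T' x]. *)
Definition pullback f : rkhs k := RKHS (pullback_limit f).

Lemma pullback_linear c f g : pullback (c *: f + g) = c *: pullback f + pullback g.
Proof. by apply: rkhs_eq. Qed.

Lemma pullback_norm f : `|pullback f| <= M%:C%C * `|f|.
Proof.
rewrite [`|f|]rkhs_normE -rmorphM; apply/rkhs_norm_leP.
exact/comb_bound_pullback/rkhs_norm_bound.
Qed.

Lemma pullback_comb t : pullback (cb t) = cb (comb_map T t).
Proof. by apply: rkhs_eq; rewrite /= comb_map_comb. Qed.

End Pullback.

Lemma pullback_adj (R : realType) (X : Type) (k : pdkernel R X) (T T' : X -> X)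
    (M : R) (TT' : kernel_adjoint k T T' M) (T'T : kernel_adjoint k T' T M)
    (f g : rkhs k) : dot (pullback TT' f) g = dot f (pullback T'T g).
Proof.
apply: (@rkhs_dot_eq _ _ _ _ _ _ (`|f| * M%:C%C)) => [|s].
  by rewrite mulr_ge0// lecR (kadj_ge0 TT').
have -> : comb_eval (pullback TT' f) s = comb_eval f (comb_map T' s).
  by rewrite comb_eval_map.
rewrite (le_trans (rkhs_dotP _ _ _))// -mulrA ler_wpM2l//.
rewrite -(pullback_comb T'T).
have -> : pullback T'T g - pullback T'T (rkhs_comb k s) =
    pullback T'T (g - rkhs_comb k s) by exact: rkhs_eq.
exact: pullback_norm.
Qed.

Section KernelRep.
Variables (R : realType) (A : cstarType R) (X : Type) (k : pdkernel R X).
Variable act : A -> X -> X.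
Hypothesis act_adj : forall a x y, k (act a x) y = k x (act (star a) y).
Hypothesis act_linear : forall (c : R[i]) a b x y,
  k (act (c *: a + b) x) y = c * k (act a x) y + k (act b x) y.
Hypothesis act_mul : forall a b x y, k (act (a ** b) x) y = k (act a (act b x)) y.
Hypothesis act_one : forall x y, k (act cone x) y = k x y.
Implicit Types (t : seq (R[i] * X)).

Let frm a t := comb_eval (comb k (comb_map (act a) t)) t.

Let frm_linear c a b t : frm (c *: a + b) t = c * frm a t + frm b t.
Proof.
rewrite /frm mulr_sumr -big_split; apply: eq_bigr => x _ /=.
rewrite mulrCA -mulrDr; congr (_ * _).
rewrite /comb !big_map mulr_sumr -big_split; apply: eq_bigr => y _ /=.
by rewrite act_linear mulrDr mulrCA.
Qed.

Let frm_one t : frm cone t = comb_eval (comb k t) t.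
Proof.
apply: eq_bigr => x _; congr (_ * _).
by rewrite /comb big_map; apply: eq_bigr => y _; rewrite act_one.
Qed.

Let frm_star a t : frm (star a ** a) t =
  comb_eval (comb k (comb_map (act a) t)) (comb_map (act a) t).
Proof.
rewrite comb_eval_map; apply: eq_bigr => x _; congr (_ * _).
rewrite /= /comb !big_map; apply: eq_bigr => y _ /=.
by rewrite act_mul act_adj starK.
Qed.

(** For fixed [t], [frm] is linear in the algebra element and nonnegative on every [y^* y]; it is
    evaluated at [|a|^2 - a^* a = y^* y]. *)
Let act_bound a t :
  comb_norm k (comb_map (act a) t) <= `|a| * comb_norm k t.
Proof.
rewrite -(@ler_pXn2r _ 2) ?nnegrE ?mulr_ge0 ?comb_norm_ge0//.
rewrite exprMn !comb_normK -frm_star.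
have [y sy yy] := pos_normB_root (lexx `|a|).
have -> : star a ** a = (-1) *: (star y ** y) + `|a| ^+ 2 *: cone.
  by rewrite scaleN1r sy yy opprB subrK.
have frm0 : frm 0 t = 0.
  by have := frm_linear (-1) 0 0 t; rewrite scaleN1r oppr0 addr0 mulN1r addNr.
have frmZ c : frm (c *: cone) t = c * frm cone t.
  by rewrite -[c *: cone]addr0 frm_linear frm0 addr0.
rewrite frm_linear frmZ frm_one frm_star mulN1r gerDr oppr_le0.
exact: comb_form_ge0.
Qed.

Let act_kadj a : kernel_adjoint k (act a) (act (star a)) (complex.Re `|a|).
Proof.
have nE : (complex.Re `|a|)%:C%C = `|a| by rewrite -norm_ReC.
split=> // [|t|t]; first by rewrite -lecR nE; exact: normr_ge0.
  by rewrite nE.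
by rewrite nE -[`|a|]norm_star.
Qed.

(** The action on points obeys the algebra relations only when tested against the kernel. Each
    relation is a combination with zero function, on which every vector vanishes by
    [comb_eval_comb_eq0]. *)
Lemma kernel_rep_exists : exists pi : starrep A (rkhs k),
  (forall a t, pi a (rkhs_comb k t) = rkhs_comb k (comb_map (act a) t)) /\
  (forall a (f : rkhs k) x, rkhs_fun (pi a f) x = f (act (star a) x)).
Proof.
have frel (f : rkhs k) t : comb k t = 0 -> comb_eval f t = 0.
  exact: comb_eval_comb_eq0.
unshelve eexists.
  apply: (@StarRep R A (rkhs k) (fun a => pullback (act_kadj a))).
  - by move=> a c f g; exact: pullback_linear.
  - move=> a; exists `|a| => f; rewrite [X in X * _]norm_ReC; exact: pullback_norm.
  - move=> c a b f; apply/rkhs_eq/funext => x /=.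
    have /(frel f) : comb k [:: (1, act (star (c *: a + b)) x);
        (- c^*, act (star a) x); (-1, act (star b) x)] = 0.
      apply/funext => y; rewrite /comb !big_cons big_nil /=.
      by rewrite starD starZ act_linear; rewrite [0 y]/(0 : R[i]); ring.
    rewrite /comb_eval !big_cons big_nil /= conjC1 !rmorphN /= conjCK conjC1.
    rewrite mul1r !mulNr mul1r addr0 => /eqP.
    by rewrite -opprD subr_eq0 => /eqP ->.
  - move=> a b f; apply/rkhs_eq/funext => x /=.
    have /(frel f) : comb k [:: (1, act (star (a ** b)) x);
        (- 1, act (star b) (act (star a) x))] = 0.
      apply/funext => y; rewrite /comb !big_cons big_nil /=.
      by rewrite starM act_mul; rewrite [0 y]/(0 : R[i]); ring.
    rewrite /comb_eval !big_cons big_nil /= conjC1 !rmorphN /= conjC1.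
    by rewrite mul1r mulNr mul1r addr0 => /eqP; rewrite subr_eq0 => /eqP ->.
  - move=> f; apply/rkhs_eq/funext => x /=.
    have /(frel f) : comb k [:: (1, act (star cone) x); (- 1, x)] = 0.
      apply/funext => y; rewrite /comb !big_cons big_nil /=.
      by rewrite star_one act_one; rewrite [0 y]/(0 : R[i]); ring.
    rewrite /comb_eval !big_cons big_nil /= conjC1 !rmorphN /= conjC1.
    by rewrite mul1r mulNr mul1r addr0 => /eqP; rewrite subr_eq0 => /eqP ->.
  - move=> a f g.
    have T'T := kernel_adjointC (act_kadj a).
    rewrite (pullback_adj _ T'T); congr (dot f _).
    by apply: rkhs_eq; rewrite /= starK.
by split=> // a t; exact: pullback_comb.
Qed.

End KernelRep.

(** * The GNS construction *)

Section GNS.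
Variables (R : realType) (A : cstarType R).

(** Polarization: [phi] is real at [(1 + a)^* (1 + a)] and at [(1 + i a)^* (1 + i a)], so
    [phi a + phi a^*] and [i (phi a - phi a^* )] are real. *)
Lemma positive_functional_herm (phi : A -> R[i]) a :
  positive_functional phi -> phi (star a) = (phi a)^*.
Proof.
move=> [phiL phi0].
have phiZ c x : phi (c *: x) = c * phi x.
  have p0 : phi 0 = 0.
    by have := phiL (-1) 0 0; rewrite scaleN1r oppr0 addr0 mulN1r addNr.
  by rewrite -[c *: x]addr0 phiL p0 addr0.
have phiD x y : phi (x + y) = phi x + phi y.
  by rewrite -[x]scale1r phiL mul1r scale1r.
have real x : (phi (star x ** x))^* = phi (star x ** x) by exact: conjc_ge0.
have one : (phi cone)^* = phi cone by have := real cone; rewrite star_one cmul1x.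
have e1 : (phi a + phi (star a))^* = phi a + phi (star a).
  have := real (cone + a); rewrite starD star_one cmulDl !cmulDr !cmul1x cmulx1.
  rewrite !phiD ![in X in X = _]rmorphD /= real one => h.
  have : phi cone + ((phi a)^* + (phi (star a))^*) + phi (star a ** a) =
     phi cone + (phi a + phi (star a)) + phi (star a ** a).
    by rewrite !addrA in h *.
  by move=> /addIr /addrI; rewrite rmorphD.
have e2 : ('i * (phi a - phi (star a)))^* = 'i * (phi a - phi (star a)).
  have := real (cone + 'i *: a); rewrite starD starZ conjCi star_one.
  rewrite cmulDl !cmulDr !cmulZl !cmulZr !cmul1x cmulx1.
  rewrite scalerA mulNr -expr2 sqrCi opprK scale1r.
  rewrite !phiD !phiZ mulNr ![in X in X = _]rmorphD /= real one => h.
  have : phi cone + (('i * phi a)^* + (- ('i * phi (star a)))^*) + phi (star a ** a) =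
     phi cone + ('i * phi a + (- ('i * phi (star a)))) + phi (star a ** a).
    by rewrite !addrA in h *.
  by move=> /addIr /addrI; rewrite -rmorphD mulrBr.
move: e2; rewrite rmorphM /= conjCi mulNr -mulrN => /(mulfI (neq0Ci _)).
rewrite rmorphB /= opprB => e2.
have : 2 * phi (star a) = 2 * (phi a)^*.
  move: e1; rewrite rmorphD /= => e1.
  have -> : 2 * phi (star a) = (phi a + phi (star a)) - (phi a - phi (star a)).
    by ring.
  by rewrite -e1 -e2; ring.
by apply: mulfI; rewrite pnatr_eq0.
Qed.

(** GNS for a state with [phi (a^* a) = |a|^2]: left multiplication on the kernel [phi (y^* x)],
    with the point [cone] as unit vector. *)
Theorem exists_norm_attaining_rep (a : A) :
  exists (H : hilbertType R) (pi : starrep A H) (x : H),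
    `|x| = 1 /\ `|pi a x| = `|a|.
Proof.
wlog a0 : a / a != 0 => [wl|].
  have [->|] := eqVneq a 0; last exact: wl.
  have [H [pi [x [x1 _]]]] := wl cone cone_neq0.
  by exists H, pi, x; rewrite rep0l !normr0.
have [phi [pphi phi1 phia]] := exists_positive_functional a0.
have [phiL phi0] := pphi.
have phi00 : phi 0 = 0.
  by have := phiL (-1) 0 0; rewrite scaleN1r oppr0 addr0 mulN1r addNr.
have phiZ c x : phi (c *: x) = c * phi x.
  by rewrite -[c *: x]addr0 phiL phi00 addr0.
have phiD x y : phi (x + y) = phi x + phi y.
  by rewrite -[x]scale1r phiL mul1r scale1r.
have phi_sum I (s : seq I) (F : I -> A) :
    phi (\sum_(i <- s) F i) = \sum_(i <- s) phi (F i).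
  elim: s => [|i s IH]; first by rewrite !big_nil.
  by rewrite !big_cons phiD IH.
pose k0 (x y : A) := phi (star y ** x).
have kherm x y : k0 x y = (k0 y x)^*.
  by rewrite /k0 -positive_functional_herm// starM starK.
have kpos (t : seq (R[i] * A)) :
    0 <= \sum_(x <- t) \sum_(y <- t) y.1^* * (x.1 * k0 x.2 y.2).
  have := phi0 (\sum_(x <- t) x.1 *: x.2); congr (0 <= _).
  rewrite cmul_sumr phi_sum; apply: eq_bigr => x _.
  rewrite star_sum cmul_suml phi_sum; apply: eq_bigr => y _.
  by rewrite starZ cmulZl cmulZr !phiZ.
pose k := PDKernel kherm kpos.
have [|||| pi [piE _]] := @kernel_rep_exists R A A k (fun a x => a ** x).
- by move=> b x y; rewrite /= /k0 starM starK cmulA.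
- by move=> c b b' x y; rewrite /= /k0 cmulDl cmulZl cmulDr cmulZr phiL.
- by move=> b b' x y; rewrite /= /k0 !cmulA.
- by move=> x y; rewrite /= cmul1x.
have nE b : `|rkhs_comb k [:: (1, b)]| ^+ 2 = phi (star b ** b).
  rewrite rkhs_comb_norm comb_normK comb_eval1 /comb big_seq1 mul1r //.
exists (rkhs k), pi, (rkhs_comb k [:: (1, cone)]); split.
  apply/eqP; rewrite -(@eqrXn2 _ 2)// nE star_one cmul1x phi1 expr1n//.
apply/eqP; rewrite -(@eqrXn2 _ 2)// piE nE /=.
by rewrite cmulx1 phia.
Qed.

End GNS.

(** * Adjointable operators on a Hilbert space *)

Section HilbertTheory.
Variables (R : realType) (H : hilbertType R).
Implicit Types x y z : H.

Lemma dot_cauchy_schwarz x y : `|dot x y| <= `|x| * `|y|.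
Proof.
rewrite -(@ler_pXn2r _ 2) ?nnegrE ?mulr_ge0// exprMn !dot_norm.
apply: discriminant_le; rewrite ?dot_ge0// => l.
have := dot_ge0 (x + l *: y).
rewrite dotDl !dotDr !dotZl !dotZr [dot y x]dotC; congr (0 <= _).
by ring.
Qed.

Lemma dot_ext x x' : (forall y, dot x y = dot x' y) -> x = x'.
Proof.
move=> xx'; apply/eqP; rewrite -subr_eq0 -normr_eq0 -sqrf_eq0 dot_norm.
by rewrite dotBl xx' subrr.
Qed.

(** Operators are bare functions: an adjoint forces linearity ([adjoint_linear]). *)
Definition is_adjoint (T S : H -> H) : Prop :=
  forall x y, dot (T x) y = dot x (S y).

Lemma is_adjointC T S : is_adjoint T S -> is_adjoint S T.
Proof. by move=> TS x y; rewrite dotC -TS -dotC. Qed.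

Lemma adjoint_uniq T S S' : is_adjoint T S -> is_adjoint T S' -> S = S'.
Proof.
move=> /is_adjointC TS /is_adjointC TS'; apply/funext => y; apply: dot_ext => x.
by rewrite TS TS'.
Qed.

Lemma adjoint_linear T S (c : R[i]) x y : is_adjoint T S ->
  T (c *: x + y) = c *: T x + T y.
Proof.
by move=> TS; apply: dot_ext => z; rewrite TS !dotDl !dotZl !TS.
Qed.

Definition op_bound (T : H -> H) : R -> Prop :=
  dominates (fun x => `|T x|) (fun x => `|x|).

(** [|S y|^2 = <T (S y), y> <= M |S y| |y|], divided by [|S y|]. *)
Lemma op_bound_adjoint T S M : is_adjoint T S -> op_bound T M -> op_bound S M.
Proof.
move=> TS [M0 TM]; split=> // y.
have [->|Sy0] := eqVneq (S y) 0; first by rewrite normr0 mulr_ge0// lecR.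
have Syp : 0 < `|S y| by rewrite normr_gt0.
rewrite -(ler_pM2r Syp) -expr2 dot_norm -TS.
apply: (@le_trans _ _ `|dot (T (S y)) y|).
  by rewrite ger0_norm// TS dot_ge0.
rewrite (le_trans (dot_cauchy_schwarz _ _))//.
by rewrite mulrAC ler_wpM2r// TM.
Qed.

Definition adjointable : {pred H -> H} :=
  fun T => `[< exists S M, is_adjoint T S /\ op_bound T M >].

Lemma adjointableP T : reflect (exists S M, is_adjoint T S /\ op_bound T M)
  (T \in adjointable).
Proof. exact: asboolP. Qed.

Lemma op_boundD T T' M M' : op_bound T M -> op_bound T' M' ->
  op_bound (T + T') (M + M').
Proof.
move=> [M0 TM] [M'0 TM']; split; first exact: addr_ge0.
by move=> x; rewrite rmorphD mulrDl (le_trans (ler_normD _ _))// lerD//.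
Qed.

Lemma op_boundZ (c : R[i]) T M : op_bound T M ->
  op_bound (c *: T) (complex.Re `|c| * M).
Proof.
move=> [M0 TM]; split; first by rewrite mulr_ge0// Re_norm_ge0.
move=> x; rewrite [(c *: T) x]/(c *: T x) normrZ rmorphM /= -normc_ReC -mulrA.
by rewrite ler_wpM2l// TM.
Qed.

Lemma op_bound0 : op_bound 0 0.
Proof. by split=> // x; rewrite mul0r normr0. Qed.

Lemma is_adjoint_linear (c : R[i]) T S T' S' : is_adjoint T S ->
  is_adjoint T' S' -> is_adjoint (c *: T + T') (c^* *: S + S').
Proof.
move=> TS TS' x y; rewrite [LHS]dotDl [RHS]dotDr TS'; congr (_ + _).
by rewrite [LHS]dotZl [RHS]dotZr conjCK TS.
Qed.

Lemma adjointable_submod : submod_closed adjointable.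
Proof.
split=> [|c T T' /adjointableP[S [M [TS TM]]] /adjointableP[S' [M' [TS' TM']]]].
  apply/adjointableP; exists 0, 0; split; last exact: op_bound0.
  by move=> x y; rewrite dot0l dot0r.
apply/adjointableP; exists (c^* *: S + S'), (complex.Re `|c| * M + M'); split.
  exact: is_adjoint_linear.
by apply: op_boundD => //; exact: op_boundZ.
Qed.

HB.instance Definition _ :=
  GRing.isSubmodClosed.Build _ _ adjointable adjointable_submod.
End HilbertTheory.

(* The C*-algebra of operators on the zero space is excluded by [cone_neq0]. *)
Record nonzero_hilbert (R : realType) := NonzeroHilbert {
  nz_hilbert :> hilbertType R;
  nz_hilbertP : exists x : nz_hilbert, x != 0
}.

Record bop (R : realType) (H : nonzero_hilbert R) := BOp {
  bop_fun :> H -> H;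
  bopP : bop_fun \in @adjointable R H
}.

(** * The C*-algebra of bounded operators *)

Section BoundedOperators.
Variables (R : realType) (H : nonzero_hilbert R).
Implicit Types (T S : bop H) (c : R[i]) (x y : H).

HB.instance Definition _ := [isSub for @bop_fun R H].
HB.instance Definition _ := [Choice of bop H by <:].
HB.instance Definition _ := [SubChoice_isSubLmodule of bop H by <:].

Lemma bop_ext T S : (forall x, T x = S x) -> T = S.
Proof. by move=> TS; apply: val_inj; apply/funext. Qed.

Definition bop_norm T : R := inf (op_bound (bop_fun T)).

Lemma bop_norm_bound T : op_bound T (bop_norm T).
Proof.
have /adjointableP[_ [M [_ TM]]] := bopP T.
exact: (inf_dominates (fun _ => normr_ge0 _) (fun _ => normr_ge0 _) TM).
Qed.

Lemma bop_norm_le T M : op_bound T M -> bop_norm T <= M.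
Proof. exact: ge_inf_dominates. Qed.

Let normD T S : (bop_norm (T + S))%:C%C <= (bop_norm T)%:C%C + (bop_norm S)%:C%C :> R[i].
Proof.
rewrite -rmorphD lecR; apply: bop_norm_le.
by apply: (op_boundD (bop_norm_bound T) (bop_norm_bound S)).
Qed.

Let normZ_le c T : bop_norm (c *: T) <= complex.Re `|c| * bop_norm T.
Proof. by apply: bop_norm_le; exact: (op_boundZ c (bop_norm_bound T)). Qed.

Let bop_norm_ge0 T : 0 <= bop_norm T.
Proof. by case: (bop_norm_bound T). Qed.

Let normZ c T : (bop_norm (c *: T))%:C%C = `|c| * (bop_norm T)%:C%C :> R[i].
Proof.
have [->|c0] := eqVneq c 0.
  rewrite scale0r normr0 mul0r; apply/eqP; rewrite eq_le !lecR bop_norm_ge0 andbT.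
  by apply: bop_norm_le; exact: op_bound0.
apply/eqP; rewrite eq_le; apply/andP; split.
  by rewrite normc_ReC -rmorphM lecR normZ_le.
have := normZ_le c^-1 (c *: T); rewrite scalerA mulVf// scale1r.
by rewrite -lecR rmorphM /= -normc_ReC normfV ler_pdivlMl ?normr_gt0.
Qed.

Let norm_eq0 T : (bop_norm T)%:C%C = 0 :> R[i] -> T = 0.
Proof.
move=> T0; apply: bop_ext => x.
have [_ /(_ x)] := bop_norm_bound T.
by rewrite T0 mul0r normr_le0 => /eqP.
Qed.

HB.instance Definition _ :=
  Lmodule_isNormed.Build R[i] (bop H) normD normZ norm_eq0.

Lemma bop_normE T : `|T| = (bop_norm T)%:C%C. Proof. by []. Qed.

Lemma bop_apply_le T x : `|T x| <= `|T| * `|x|.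
Proof. by have [_] := bop_norm_bound T; exact. Qed.

Lemma bop_norm_leP T (M : R) : op_bound T M <-> `|T| <= M%:C%C.
Proof.
rewrite bop_normE lecR; split; first exact: bop_norm_le.
move=> TM; have [T0 Tx] := bop_norm_bound T; split; first exact: le_trans TM.
by move=> x; rewrite (le_trans (Tx x))// ler_wpM2r// lecR.
Qed.

Let bop_adj_exists T : exists S : bop H, is_adjoint T S.
Proof.
have /adjointableP[S [M [TS TM]]] := bopP T.
have SP : S \in @adjointable R H.
  apply/adjointableP; exists T, M; split; first exact: is_adjointC.
  exact: op_bound_adjoint TM.
by exists (BOp SP).
Qed.

Definition bop_adj T : bop H := projT1 (cid (bop_adj_exists T)).

Lemma bop_adjP T : is_adjoint T (bop_adj T).
Proof. by rewrite /bop_adj; case: cid. Qed.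

Lemma bop_adj_eq T S : is_adjoint T S -> bop_adj T = S.
Proof. by move=> TS; apply: val_inj; apply: adjoint_uniq (bop_adjP T) TS. Qed.

Lemma bop_adj_norm T : `|bop_adj T| = `|T|.
Proof.
rewrite !bop_normE; congr (_%:C%C); rewrite /bop_norm; congr inf.
apply/seteqP; split => M; apply: op_bound_adjoint.
  exact/is_adjointC/bop_adjP.
exact: bop_adjP.
Qed.

Lemma bop_linear T c x y : T (c *: x + y) = c *: T x + T y.
Proof. exact: adjoint_linear (bop_adjP T). Qed.

Lemma bop_adjK : involutive bop_adj.
Proof. by move=> T; apply: bop_adj_eq; apply/is_adjointC/bop_adjP. Qed.

Lemma bop_adj_linear c T S : bop_adj (c *: T + S) = c^* *: bop_adj T + bop_adj S.
Proof.
by apply: bop_adj_eq; exact: (is_adjoint_linear c (bop_adjP T) (bop_adjP S)).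
Qed.

Lemma bop_adjD : {morph bop_adj : T S / T + S}.
Proof.
by move=> T S; rewrite -[T]scale1r bop_adj_linear conjC1 !scale1r.
Qed.

Lemma bop_adj0 : bop_adj 0 = 0.
Proof. by apply: bop_adj_eq => x y; rewrite dot0l dot0r. Qed.

Lemma bop_adjZ c T : bop_adj (c *: T) = c^* *: bop_adj T.
Proof. by rewrite -[c *: T]addr0 bop_adj_linear bop_adj0 addr0. Qed.

Lemma bop_adjB T S : bop_adj (T - S) = bop_adj T - bop_adj S.
Proof. by rewrite bop_adjD -scaleN1r bop_adjZ rmorphN1 scaleN1r. Qed.

(** Operators and their adjoints both converge pointwise, and the two limits are adjoint to each
    other. *)
Lemma bop_complete (F : set_system (bop H)) : ProperFilter F -> cauchy F -> cvg F.
Proof.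
move=> FF /cauchy_ballP Fc.
have ptw (G : bop H -> bop H) x : (forall T S, `|G T - G S| <= `|T - S|) ->
    cvg ((fun T : bop H => G T x) @ F).
  move=> Gle; apply/cauchy_cvgP/cauchy_ballP => e e0.
  have x1 : 0 < `|x| + 1 by rewrite ltr_wpDl.
  have e1 : 0 < e / (`|x| + 1) by rewrite divr_gt0.
  have [[A B] /= [FA FB] AB] := Fc _ e1.
  exists ((fun T : bop H => G T x) @` A, (fun T : bop H => G T x) @` B) => /=.
    split; first by apply: filterS FA => T AT; exists T.
    by apply: filterS FB => T BT; exists T.
  move=> [_ _] /= [[T AT <-] [S BS <-]].
  have /= := AB (T, S) (conj AT BS); rewrite -!ball_normE /= => TS.
  apply: (le_lt_trans (bop_apply_le (G T - G S) x)).
  apply: (@le_lt_trans _ _ (`|T - S| * (`|x| + 1))).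
    by rewrite ler_pM// lerDl.
  by rewrite -ltr_pdivlMr.
have /choice[L FL] : forall x, exists y : H, (fun T : bop H => T x) @ F --> y.
  by move=> x; apply/cvg_ex; exact: (ptw id).
have /choice[L' FL'] : forall x, exists y : H, (fun T : bop H => bop_adj T x) @ F --> y.
  by move=> x; apply/cvg_ex; apply: ptw => T S; rewrite -bop_adjB bop_adj_norm.
have LL' : is_adjoint L L'.
  move=> x y; apply/eqP; rewrite -subr_eq0; apply/eqP.
  apply: (@norm_eq0_approx _ (cplx R) _ (`|y| + `|x|)); first by rewrite addr_ge0.
  move=> e e0.
  have /cvgrPdist_lt /(_ _ e0) Fx := FL x.
  have /cvgrPdist_lt /(_ _ e0) Fy := FL' y.
  have [T [/= /ltW Tx /ltW Ty]] := filter_ex (filterI Fx Fy).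
  have -> : dot (L x) y - dot x (L' y) =
      dot (L x - T x) y - dot x (L' y - bop_adj T y).
    by rewrite dotBl dotBr -bop_adjP opprB addrA subrK.
  rewrite (le_trans (ler_normB _ _))// mulrDl lerD//.
    by rewrite (le_trans (dot_cauchy_schwarz _ _))// mulrC ler_wpM2l.
  by rewrite (le_trans (dot_cauchy_schwarz _ _))// ler_wpM2l.
have LF (e : R) : 0 < e -> \forall T \near F, op_bound (L - bop_fun T) e.
  move=> e0; have e0' : 0 < e%:C%C :> R[i] by rewrite ltcR.
  have [[A B] /= [FA FB] AB] := Fc _ e0'.
  apply: filterS FA => T AT; split; first exact: ltW.
  move=> x; apply/ler_addgt0Pr => d d0.
  have /cvgrPdist_lt /(_ _ d0) Fx := FL x.
  have [S [/= Sx BS]] := filter_ex (filterI Fx FB).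
  rewrite -[(L - _) x]/(L x - T x) -(subrKA (S x)).
  rewrite [leRHS]addrC (le_trans (ler_normD _ _))// lerD//; first exact: ltW.
  apply: (le_trans (bop_apply_le (S - T) x)); rewrite ler_wpM2r//.
  by have := AB (T, S) (conj AT BS); rewrite -ball_normE /= distrC => /ltW.
have LP : L \in @adjointable R H.
  apply/adjointableP; have [T LT] := filter_ex (LF _ ltr01).
  exists L', (1 + bop_norm T); split=> //.
  rewrite -[L](subrK (bop_fun T)); apply: op_boundD => //.
  exact: bop_norm_bound.
apply/cvg_ex; exists (BOp LP); apply/cvgrPdist_le => e e0.
have [e' -> e'0] : exists2 e', e = e'%:C%C & 0 < e'.
  have /complex_realP[e' ee'] : e \is Num.real by rewrite gtr0_real.
  by exists e' => //; rewrite -ltcR -ee'.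
by apply: filterS (LF _ e'0) => T LT; apply/bop_norm_leP.
Qed.

HB.instance Definition _ := Uniform_isComplete.Build (bop H) bop_complete.

Lemma bop_id_adjointable : id \in @adjointable R H.
Proof.
apply/adjointableP; exists id, 1; split => //.
by split=> // x; rewrite mul1r.
Qed.

Definition bop_id : bop H := BOp bop_id_adjointable.

Lemma bop_comp_adjointable T S : (T \o S) \in @adjointable R H.
Proof.
apply/adjointableP.
exists (bop_adj S \o bop_adj T), (bop_norm T * bop_norm S); split.
  by move=> x y /=; rewrite bop_adjP bop_adjP.
split; first by rewrite mulr_ge0.
move=> x /=; rewrite (le_trans (bop_apply_le _ _))// rmorphM /= -mulrA.
by rewrite ler_wpM2l// ?lecR// bop_apply_le.
Qed.

Definition bop_comp T S : bop H := BOp (bop_comp_adjointable T S).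

Lemma bop_compA : associative bop_comp.
Proof. by move=> T S U; exact: bop_ext. Qed.

Lemma bop_comp1x : left_id bop_id bop_comp.
Proof. by move=> T; exact: bop_ext. Qed.

Lemma bop_compx1 : right_id bop_id bop_comp.
Proof. by move=> T; exact: bop_ext. Qed.

Lemma bop_compDl : left_distributive bop_comp +%R.
Proof. by move=> T S U; exact: bop_ext. Qed.

Lemma bop_compDr : right_distributive bop_comp +%R.
Proof.
move=> T S U; apply: bop_ext => x /=.
by have := bop_linear T 1 (S x) (U x); rewrite !scale1r.
Qed.

Lemma bop_compZl c T S : bop_comp (c *: T) S = c *: bop_comp T S.
Proof. exact: bop_ext. Qed.

Lemma bop_compZr c T S : bop_comp T (c *: S) = c *: bop_comp T S.
Proof.
apply: bop_ext => x /=.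
have T0 : T 0 = 0.
  by have := bop_linear T (-1) 0 0; rewrite scaler0 addr0 scaleN1r addNr.
by have := bop_linear T c (S x) 0; rewrite T0 !addr0.
Qed.

Lemma bop_id_neq0 : bop_id != 0.
Proof.
have [x x0] := nz_hilbertP H; apply: contraNneq x0 => id0.
by apply/eqP; rewrite -[x]/(bop_id x) id0.
Qed.

Lemma bop_adjM T S : bop_adj (bop_comp T S) = bop_comp (bop_adj S) (bop_adj T).
Proof. by apply: bop_adj_eq => x y /=; rewrite !bop_adjP. Qed.

Lemma bop_normM T S : `|bop_comp T S| <= `|T| * `|S|.
Proof.
rewrite [`|T|]bop_normE [`|S|]bop_normE -rmorphM; apply/bop_norm_leP; split.
  by rewrite mulr_ge0.
move=> x /=; rewrite (le_trans (bop_apply_le _ _))// rmorphM /= -mulrA.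
by rewrite ler_wpM2l// ?lecR// bop_apply_le.
Qed.

Lemma bop_cstar_norm T : `|bop_comp (bop_adj T) T| = `|T| ^+ 2.
Proof.
apply/eqP; rewrite eq_le; apply/andP; split.
  by rewrite (le_trans (bop_normM _ _))// bop_adj_norm expr2.
set N := `|bop_comp _ _|; have N0 : 0 <= N by exact: normr_ge0.
have sN : 0 <= sqrtC N by rewrite sqrtC_ge0.
rewrite -(sqrtCK N) ler_pXn2r ?nnegrE//.
have sE : (complex.Re (sqrtC N))%:C%C = sqrtC N by rewrite RRe_real// ger0_real.
rewrite -sE; apply/bop_norm_leP; split; first by rewrite -lecR sE.
move=> x; rewrite sE -(@ler_pXn2r _ 2) ?nnegrE ?mulr_ge0//.
rewrite exprMn sqrtCK dot_norm bop_adjP.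
apply: (@le_trans _ _ `|dot x (bop_comp (bop_adj T) T x)|).
  by rewrite ger0_norm// -bop_adjP dot_ge0.
rewrite (le_trans (dot_cauchy_schwarz _ _))// expr2 mulrA mulrC.
by rewrite ler_wpM2r// bop_apply_le.
Qed.

HB.instance Definition _ := isCStar.Build R (bop H) (cone := bop_id)
  (cmul := bop_comp) (star := bop_adj) bop_compA bop_comp1x bop_compx1
  bop_compDl bop_compDr bop_compZl bop_compZr bop_id_neq0 bop_adjK bop_adjD
  bop_adjZ bop_adjM bop_normM bop_cstar_norm.

(** Kept transparent so that it reduces to application of the operator. *)
Definition bop_rep : starrep (bop H) H.
Proof.
apply: (@StarRep R (bop H) H (@bop_fun R H)) => //.
- exact: bop_linear.
- by move=> T; exists `|T| => x; exact: bop_apply_le.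
- exact: bop_adjP.
Defined.

End BoundedOperators.

(** * The regular representation of a crossed product *)

Section DotSums.
Variables (R : realType) (H : hilbertType R).

Lemma dot_suml I (s : seq I) (F : I -> H) y :
  dot (\sum_(i <- s) F i) y = \sum_(i <- s) dot (F i) y.
Proof.
elim: s => [|i s IH]; first by rewrite !big_nil dot0l.
by rewrite !big_cons dotDl IH.
Qed.

Lemma dot_sumr I (s : seq I) (F : I -> H) y :
  dot y (\sum_(i <- s) F i) = \sum_(i <- s) dot y (F i).
Proof.
elim: s => [|i s IH]; first by rewrite !big_nil dot0r.
by rewrite !big_cons dotDr IH.
Qed.
End DotSums.

Section DirectSumKernel.
Variables (R : realType) (Gam : choiceType) (H : hilbertType R).
Implicit Types (x y : Gam * H) (t : seq (R[i] * (Gam * H))).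

(** The kernel whose completion is l^2(Gam, H): points with different labels are orthogonal. *)
Definition ksum_fun x y : R[i] := if x.1 == y.1 then dot x.2 y.2 else 0.

Lemma ksum_herm x y : ksum_fun x y = (ksum_fun y x)^*.
Proof.
by rewrite /ksum_fun eq_sym; case: ifP => _; rewrite ?conjC0// -dotC.
Qed.

(** Collecting the terms with label [g] into one vector [v g] turns the form into the sum of the
    [|v g|^2]. *)
Lemma ksum_ge0 t :
  0 <= \sum_(a <- t) \sum_(b <- t) b.1^* * (a.1 * ksum_fun a.2 b.2).
Proof.
pose r := undup [seq a.2.1 | a <- t].
pose v g := \sum_(a <- t) (if a.2.1 == g then a.1 *: a.2.2 else 0).
have -> : \sum_(a <- t) \sum_(b <- t) b.1^* * (a.1 * ksum_fun a.2 b.2) =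
    \sum_(g <- r) dot (v g) (v g).
  under [RHS]eq_bigr do rewrite dot_suml.
  rewrite [RHS]exchange_big /=.
  apply: (@eq_big_seq _ _ _ (R[i] * (Gam * H))%type t) => a ta.
  under [RHS]eq_bigr do rewrite dot_sumr.
  rewrite [RHS]exchange_big /=; apply: eq_bigr => b _.
  have ra : a.2.1 \in r by rewrite mem_undup; apply: map_f.
  rewrite (bigD1_seq _ ra (undup_uniq _)) /= big1 ?addr0.
    rewrite eqxx /ksum_fun eq_sym; case: ifP => _; last by rewrite dot0r !mulr0.
    by rewrite dotZl dotZr mulrCA.
  by move=> g ga; rewrite eq_sym (negbTE ga) dot0l.
elim: r => [|g r IH]; first by rewrite big_nil.
by rewrite big_cons addr_ge0// dot_ge0.
Qed.

Definition ksum : pdkernel R (Gam * H) := PDKernel ksum_herm ksum_ge0.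

Definition ksum_inj (g : Gam) (x : H) : rkhs ksum := rkhs_comb ksum [:: (1, (g, x))].

Lemma ksum_inj_dot (g h : Gam) (x y : H) :
  dot (ksum_inj g x) (ksum_inj h y) = if g == h then dot x y else 0.
Proof.
rewrite [LHS](rkhs_dot_comb (ksum_inj g x)) comb_eval1 /=.
by rewrite /comb big_seq1 mul1r.
Qed.

End DirectSumKernel.

Lemma rep_starhom_exists (R : realType) (A : cstarType R) (K : nonzero_hilbert R)
    (rho : starrep A K) :
  exists f : starhom A (bop K), forall a x, f a x = rho a x.
Proof.
have adj a : is_adjoint (rho a) (rho (star a)) by move=> x y; exact: rep_star.
have P a : rho a \in @adjointable R K.
  apply/adjointableP; exists (rho (star a)), (complex.Re `|a|); split=> //.
  split; first by rewrite -lecR -norm_ReC; exact: normr_ge0.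
  by move=> x; rewrite -norm_ReC rep_norm_le.
have hom : starhom_on setT (fun a => BOp (P a) : bop K).
  split.
  - by move=> c a b _ _; apply: bop_ext => x; exact: rep_linear_alg.
  - by move=> a b _ _; apply: bop_ext => x; exact: rep_mul.
  - by apply: bop_ext => x; exact: rep_one.
  - by move=> a _; apply/esym; apply: (@bop_adj_eq _ K); exact: adj.
by exists (StarHom hom).
Qed.

Section InducedRep.
Variables (R : realType) (Gam : groupType) (G : cqg R) (alpha : qaction Gam G).
Variables (GG : cqg R) (X : crossed_product alpha GG).
Variables (H : hilbertType R) (pi : starrep G H).
Hypothesis H_nonzero : exists x : H, x != 0.

Local Notation K := (ksum Gam H).
Local Notation J := (@ksum_inj R Gam H).

Let act (a : G) (x : Gam * H) : Gam * H := (x.1, pi (alpha (x.1)^-1%g a) x.2).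

Let shift (g : Gam) (x : Gam * H) : Gam * H := ((g * x.1)%g, x.2).

Let shift_kernel g x y : K (shift g x) (shift g y) = K x y.
Proof. by rewrite /= /ksum_fun /= (inj_eq (mulgI g)). Qed.

Let shift_kadj g : kernel_adjoint K (shift g) (shift g^-1%g) 1.
Proof.
have nE h t : comb_norm K (comb_map (shift h) t) = comb_norm K t.
  rewrite /comb_norm comb_eval_map; congr sqrtC.
  apply: eq_bigr => a _ /=; rewrite /comb big_map; congr (_ * _).
  by apply: eq_bigr => b _; rewrite shift_kernel.
split=> // [x y|t|t]; rewrite ?nE ?mul1r//.
rewrite -(shift_kernel g^-1%g) /=; congr ksum_fun.
by case: x => h x; rewrite /shift /= mulKg.
Qed.

(** Twisting [pi] by [alpha g^-1] on the summand [g] makes left translation implement [alpha], so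
    the universal property applies. The nonzero vector makes the operators a C*-algebra with
    [cone != 0]. *)
Lemma induced_rep : exists theta : starrep GG (rkhs K),
  (forall a g x, theta (cp_inj X a) (J g x) = J g (pi (alpha g^-1%g a) x)) /\
  (forall g h x, theta (cp_u X g) (J h x) = J (g * h)%g x).
Proof.
have [|||| rho [rhoJ rhoE]] := @kernel_rep_exists R G (Gam * H)%type K act.
- move=> a [g x] [h y]; rewrite /= /ksum_fun /=; case: eqP => // ->.
  by rewrite rep_star hom_star.
- move=> c a b [g x] [h y]; rewrite /= /ksum_fun /=; case: eqP => // _.
    by rewrite hom_linear rep_linear_alg dotDl dotZl.
  by rewrite mulr0 addr0.
- move=> a b [g x] [h y]; rewrite /= /ksum_fun /=; case: eqP => // _.
  by rewrite hom_mul rep_mul.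
- move=> [g x] [h y]; rewrite /= /ksum_fun /=; case: eqP => // _.
  by rewrite hom_one rep_one.
have Knz : exists z : rkhs K, z != 0.
  have [x x0] := H_nonzero; exists (J 1%g x).
  rewrite -normr_eq0 -sqrf_eq0 dot_norm ksum_inj_dot eqxx -dot_norm.
  by rewrite sqrf_eq0 normr_eq0.
pose K' := NonzeroHilbert Knz.
have [p pE] := @rep_starhom_exists R G K' rho.
have vP g : pullback (shift_kadj g) \in @adjointable R (rkhs K).
  apply/adjointableP; exists (pullback (shift_kadj g^-1%g)), 1; split.
    have E := kernel_adjointC (shift_kadj g).
    move=> x y; rewrite (pullback_adj _ E); congr (dot _ _).
    by apply: rkhs_eq; rewrite /= invgK.
  by split=> // x; exact: pullback_norm.
pose v g := @BOp R K' _ (vP g).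
have vM g h : v (g * h)%g = v g ** v h.
  apply: bop_ext => f; apply/rkhs_eq/funext => -[k x].
  by rewrite /= /shift /= invgM mulgA.
have v1 : v 1%g = cone.
  apply: bop_ext => f; apply/rkhs_eq/funext => -[k x].
  by rewrite /= /shift /= invg1 mul1g.
have vS g : star (v g) = v g^-1%g.
  apply: (@bop_adj_eq _ K') => x y /=.
  have E := kernel_adjointC (shift_kadj g).
  rewrite (pullback_adj _ E); congr (dot _ _).
  by apply: rkhs_eq; rewrite /= invgK.
have [||f [fi fu]] := @cp_universal _ _ _ _ _ X (bop K') p v.
- by split=> // g; split; rewrite vS -vM ?mulgV ?mulVg v1.
- move=> g a; rewrite vS; apply: bop_ext => f; apply/rkhs_eq/funext => -[k x] /=.
  rewrite !pE rhoE /= rhoE /= /act /shift /= invgK mulVKg.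
  by rewrite -!hom_star invgM invgK qactM.
have [theta thE] := comp_rep_subproof f (bop_rep K').
exists theta; split=> [a g x|g h x]; rewrite thE /= ?fi ?fu.
  by rewrite pE /J rhoJ.
by apply: (pullback_comb (shift_kadj g)).
Qed.

End InducedRep.

(** * Slices of the minimal tensor product *)

Section HilbertTensor.
Variables (R : realType) (H K : hilbertType R).
Implicit Types (t : seq (H * K)) (x e : H) (y : K).

Let slice e t : K := \sum_(p <- t) dot p.1 e *: p.2.

Let perp e x : H := x - (dot x e / dot e e) *: e.

Let perps e t : seq (H * K) := [seq (perp e p.1, p.2) | p <- t].

Let dot_perp e x x' : e != 0 ->
  dot x x' = dot x e * (dot x' e)^* / dot e e + dot (perp e x) (perp e x').
Proof.
move=> e0; have en : dot e e != 0 by rewrite -dot_norm sqrf_eq0 normr_eq0.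
have er : (dot e e)^* = dot e e by rewrite -dotC.
rewrite /perp dotBl !dotBr !dotZl !dotZr rmorphM fmorphV /= er.
rewrite [dot e x']dotC; field.
by [].
Qed.

(** Each first leg is split along [e] and its orthogonal complement; the part along [e] contributes
    exactly the slice. *)
Let htens_decomp e t : e != 0 ->
  htens_sqnorm t = `|slice e t| ^+ 2 / dot e e + htens_sqnorm (perps e t).
Proof.
move=> e0; rewrite dot_norm /slice dot_suml mulr_suml /htens_sqnorm big_map.
rewrite -big_split; apply: eq_bigr => p _ /=.
rewrite dot_sumr mulr_suml big_map -big_split; apply: eq_bigr => q _ /=.
by rewrite (dot_perp _ _ e0) mulrDl dotZl dotZr; congr (_ + _); ring.
Qed.

(** Induction on the length: splitting along the first leg of the head leaves a remainder whose head
    has first leg zero. *)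
Lemma htens_sqnorm_ge0 t : 0 <= htens_sqnorm t.
Proof.
have [n] := ubnP (size t); elim: n t => // n IH [|[x y] t] /= tn.
  by rewrite /htens_sqnorm big_nil.
have cons0 z s : htens_sqnorm ((0, z) :: s) = htens_sqnorm s.
  rewrite /htens_sqnorm big_cons big1 ?add0r => [|q _]; last by rewrite /= dot0l mul0r.
  by apply: eq_bigr => q _; rewrite big_cons /= dot0r mul0r add0r.
have [->|x0] := eqVneq x 0; first by rewrite cons0 IH.
rewrite (htens_decomp _ x0) addr_ge0//.
  by rewrite divr_ge0 ?dot_ge0// exprn_ge0.
have xn : dot x x != 0 by rewrite -dot_norm sqrf_eq0 normr_eq0.
rewrite /= {1}/perp divff// scale1r subrr cons0 IH//.
by rewrite size_map.
Qed.

Lemma norm_slice_le e t :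
  `|\sum_(p <- t) dot p.1 e *: p.2| ^+ 2 <= `|e| ^+ 2 * htens_sqnorm t.
Proof.
have [->|e0] := eqVneq e 0.
  rewrite big1 ?normr0 ?expr0n ?mul0r// => p _.
  by rewrite dot0r scale0r.
have ep : 0 < `|e| ^+ 2 by rewrite exprn_gt0// normr_gt0.
rewrite (htens_decomp t e0) -dot_norm mulrDr mulrC divfK ?gt_eqF//.
by rewrite lerDl mulr_ge0 ?htens_sqnorm_ge0// ltW.
Qed.

End HilbertTensor.

Section SliceBound.
Variables (R : realType) (A B : cstarType R) (T : mintensor A B).
Variables (H : hilbertType R) (theta : starrep A H).

(* The slice map [phi (x) id], for a vector functional [phi], is bounded. *)
Lemma norm_slice_tens_le (x e : H) (s : seq (A * B)) :
  `|\sum_(p <- s) dot (theta p.1 x) e *: p.2| <=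
  `|x| * `|e| * `|tens_sum (tinl T) (tinr T) s|.
Proof.
set b := \sum_(p <- s) _.
(* A norm-attaining representation of [B] turns the slice of tensors into a slice of vectors, to
   which the spatial bound for [theta] and [rho] applies. *)
have [K [rho [y [y1 yb]]]] := exists_norm_attaining_rep b.
rewrite -yb -(@ler_pXn2r _ 2) ?nnegrE ?mulr_ge0//.
have -> : rho b y =
    \sum_(p <- tens_act theta rho s [:: (x, y)]) dot p.1 e *: p.2.
  rewrite /b rep_suml /tens_act; elim: s {b yb} => [|p s IH].
    by rewrite !big_nil.
  by rewrite /= !big_cons IH repZl.
rewrite (le_trans (norm_slice_le _ _))//.
rewrite -mulrA mulrCA exprMn ler_wpM2l ?exprn_ge0//.
rewrite (le_trans (tens_bound T s theta rho [:: (x, y)]))//.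
rewrite /htens_sqnorm !big_seq1 /= -!dot_norm y1 expr1n mulr1.
by rewrite exprMn mulrC.
Qed.

End SliceBound.

Section TensHom.
Variables (R : realType) (A B D : cstarType R) (T : mintensor A B).

Lemma hom_tens_sum (f : starhom T D) (s : seq (A * B)) :
  f (tens_sum (tinl T) (tinr T) s) =
  \sum_(a <- s) f (tinl T a.1) ** f (tinr T a.2).
Proof.
rewrite /tens_sum; elim: s => [|a s IH]; first by rewrite !big_nil hom0.
by rewrite !big_cons -[X in X + _]scale1r hom_linear scale1r IH hom_mul.
Qed.

Lemma tens_sum_dense (z : T) (e : R[i]) : 0 < e ->
  exists s, `|z - tens_sum (tinl T) (tinr T) s| < e.
Proof.
move=> e0.
have [||y [/interior_subset + [s _ sy]]] := @tens_dense _ _ _ T (ball z e)^°.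
- by exists z; exact: nbhsx_ballx.
- exact: open_interior.
- by rewrite -ball_normE /= -sy => zs; exists s.
Qed.

End TensHom.

Lemma dense_approx (R : realType) (V : normedModType R[i]) (S : set V) (z : V)
  (e : R[i]) : dense S -> 0 < e -> exists2 x, S x & `|z - x| < e.
Proof.
move=> dS e0; have [||y [/interior_subset + Sy]] := dS (ball z e)^°.
- by exists z; exact: nbhsx_ballx.
- exact: open_interior.
- by rewrite -ball_normE /= => zy; exists y.
Qed.

(** Approximate preimages of [y] are close to each other because [f] preserves distances. *)
Lemma isometric_hom_range_closed (R : realType) (A B : cstarType R)
    (f : starhom A B) (y : B) : (forall a, `|f a| = `|a|) ->
  (forall e : R[i], 0 < e -> exists a, `|y - f a| <= e) -> exists a, f a = y.
Proof.
move=> fiso yf; pose P e : set A := [set a | `|y - f a| <= e].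
have [|||c cP] := @approx_limit R A P 2 (ler0n _ 2).
- by move=> e e' ee a /= ya; exact: le_trans ee.
- by move=> e /yf[a ya]; exists a.
- move=> e a b e0 /= ya yb; rewrite -fiso hom_sub -(subrKA y).
  by rewrite (le_trans (ler_normD _ _))// mulr_natl mulr2n lerD// distrC.
exists c; apply/eqP; rewrite -subr_eq0; apply/eqP.
apply: (@norm_eq0_approx _ _ _ 3) => // e e0; have [a ya] := yf _ e0.
rewrite -(subrKA (f a)) (le_trans (ler_normD _ _))//.
have -> : 3 * e = 2 * e + e by ring.
by rewrite -hom_sub fiso lerD ?cP// distrC.
Qed.

(** * Isometric embedding of the algebra and of its tensor square *)

Section Crossed.
Variables (R : realType) (Gam : groupType) (G : cqg R) (alpha : qaction Gam G).
Variables (GG : cqg R) (X : crossed_product alpha GG).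
Implicit Types (a b : G) (g h : Gam).

Lemma norm_ksum_inj (H : hilbertType R) g (x : H) : `|ksum_inj g x| = `|x|.
Proof. by apply/eqP; rewrite -(@eqrXn2 _ 2)// !dot_norm ksum_inj_dot eqxx. Qed.

Lemma norm1_neq0 (H : hilbertType R) (x : H) : `|x| = 1 -> x != 0.
Proof. by move=> x1; rewrite -normr_eq0 x1 oner_eq0. Qed.

(** On the summand of 1 the induced representation restricts to [pi], which attains the norm of
    [a]. *)
Lemma cp_inj_norm a : `|cp_inj X a| = `|a|.
Proof.
apply/eqP; rewrite eq_le hom_le_norm/=.
have [H [pi [x [x1 <-]]]] := exists_norm_attaining_rep a.
have [|theta [thJ _]] := @induced_rep _ _ _ _ _ X H pi.
  by exists x; exact: norm1_neq0.
rewrite -(norm_ksum_inj 1%g) -[X in pi X](qact1 alpha) -[X in alpha X]invg1 -thJ.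
by rewrite (le_trans (rep_norm_le _ _ _))// norm_ksum_inj x1 mulr1.
Qed.

Lemma cp_inj_injective : injective (cp_inj X).
Proof.
move=> a b ab; apply/eqP; rewrite -subr_eq0 -normr_eq0 -cp_inj_norm hom_sub.
by rewrite ab subrr normr0.
Qed.

Let inj2 : starhom (cqg_sq G) (cqg_sq GG) :=
  tens_map (cqg_sq G) (cqg_sq GG) (cp_inj X) (cp_inj X).

Let ts (s : seq (G * G)) : cqg_sq G := tens_sum (tinl (cqg_sq G)) (tinr (cqg_sq G)) s.
Let tts (s : seq (GG * GG)) : cqg_sq GG :=
  tens_sum (tinl (cqg_sq GG)) (tinr (cqg_sq GG)) s.

Let injs (s : seq (G * G)) : seq (GG * GG) :=
  [seq (cp_inj X p.1, cp_inj X p.2) | p <- s].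

Let inj2_ts s : inj2 (ts s) = tts (injs s).
Proof.
rewrite hom_tens_sum /tts /tens_sum big_map; apply: eq_bigr => p _ /=.
by rewrite tens_map_inl tens_map_inr.
Qed.

Let htens_sqnorm_zero (H K : hilbertType R) (t : seq (H * K)) :
  (forall x y : H * K, dot x.1 y.1 * dot x.2 y.2 = 0) -> htens_sqnorm t = 0.
Proof. by move=> t0; rewrite /htens_sqnorm big1// => x _; rewrite big1. Qed.

(** Every pair [pi], [rho] is the restriction, to the summands of 1, of a pair of representations of
    [GG], so the spatial norm cannot decrease. *)
Let ts_norm_le s : `|ts s| <= `|tts (injs s)|.
Proof.
apply: tens_least => // H K pi rho t.
(* [induced_rep] needs a nonzero vector; over a zero space all squared norms vanish. *)
have [H0|] := pselect (exists x : H, x != 0); last first.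
  move=> H0; have z (x : H) : x = 0.
    by apply/eqP; apply/negP => x0; apply: H0; exists x; exact/negP.
  rewrite !htens_sqnorm_zero ?mulr0//.
    by move=> x y; rewrite (z x.1) dot0l mul0r.
  by move=> x y; rewrite (z x.1) dot0l mul0r.
have [K0|] := pselect (exists x : K, x != 0); last first.
  move=> K0; have z (x : K) : x = 0.
    by apply/eqP; apply/negP => x0; apply: K0; exists x; exact/negP.
  rewrite !htens_sqnorm_zero ?mulr0//.
    by move=> x y; rewrite (z x.2) dot0l mulr0.
  by move=> x y; rewrite (z x.2) dot0l mulr0.
have [theta [thJ _]] := @induced_rep _ _ _ _ _ X H pi H0.
have [sigma [siJ _]] := @induced_rep _ _ _ _ _ X K rho K0.
pose J (t : seq (H * K)) :=
  [seq (ksum_inj (1%g : Gam) x.1, ksum_inj (1%g : Gam) x.2) | x <- t].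
have sqJ u : htens_sqnorm (J u) = htens_sqnorm u.
  rewrite /htens_sqnorm big_map; apply: eq_bigr => x _.
  by rewrite big_map; apply: eq_bigr => y _; rewrite !ksum_inj_dot eqxx.
have actJ : tens_act theta sigma (injs s) (J t) = J (tens_act pi rho s t).
  rewrite /tens_act /J /injs allpairs_mapl allpairs_mapr map_allpairs.
  by apply: eq_allpairs => a x /=; rewrite thJ siJ invg1 !qact1.
have := tens_bound (cqg_sq GG) (injs s) theta sigma (J t).
by rewrite actJ !sqJ.
Qed.

Lemma cp_inj2_norm_ge (z : cqg_sq G) : `|z| <= `|inj2 z|.
Proof.
apply/ler_addgt0Pr => e e0; have e2 : 0 < e / 2 by rewrite divr_gt0.
have [s /ltW zs] := tens_sum_dense z e2.
have h1 : `|z| <= `|ts s| + `|z - ts s|.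
  by rewrite -{1}[z](subrK (ts s)) addrC ler_normD.
have h2 : `|inj2 (ts s)| <= `|inj2 z| + `|z - ts s|.
  rewrite -{1}[inj2 (ts s)](subrK (inj2 z)) addrC (le_trans (ler_normD _ _))//.
  by rewrite lerD2l -hom_sub distrC hom_le_norm.
rewrite (le_trans h1)// [e]splitr addrA lerD// (le_trans (ts_norm_le s))//.
by rewrite -inj2_ts (le_trans h2)// lerD2l.
Qed.

Lemma cp_inj2_injective : injective inj2.
Proof.
move=> a b ab; apply/eqP; rewrite -subr_eq0 -normr_le0.
by rewrite (le_trans (cp_inj2_norm_ge _))// hom_sub ab subrr normr0.
Qed.

End Crossed.

(** * Group-like unitaries of a crossed product *)

Lemma lin_span_ind (R : realType) (A : cstarType R) (S : set A) (P : A -> Prop) :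
  P 0 -> (forall (c : R[i]) x y, S x -> P y -> P (c *: x + y)) ->
  forall x, lin_span S x -> P x.
Proof.
move=> P0 PD _ [s Ss ->]; elim: s Ss => [|a s IH] Ss; first by rewrite big_nil.
rewrite big_cons; apply: PD; first exact: (Ss 0%N).
by apply: IH => i si; exact: (Ss i.+1).
Qed.

Section CrossedInt.
Variables (R : realType) (Gam : groupType) (G : cqg R) (alpha : qaction Gam G).
Variables (GG : cqg R) (X : crossed_product alpha GG).
Implicit Types (a b : G) (g h : Gam) (u v : intg G) (w : intg GG).

Definition cp_uint g : intg GG := IntG ((cp_u_rep X).1 g) (cp_comul_u X g).

Lemma cp_uintM g h : cp_uint (g * h)%g = (cp_uint g * cp_uint h)%g.
Proof. by apply: int_val_inj; exact: (cp_u_rep X).2. Qed.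

Lemma cp_uint1 : cp_uint 1%g = 1%g.
Proof. by apply: (@mulgI _ (cp_uint 1%g)); rewrite -cp_uintM !mulg1. Qed.

Lemma cp_uintV g : cp_uint g^-1%g = (cp_uint g)^-1%g.
Proof.
by apply: (@mulgI _ (cp_uint g)); rewrite -cp_uintM !mulgV cp_uint1.
Qed.

Lemma tens_map_pure (a b : G) :
  tens_map (cqg_sq G) (cqg_sq GG) (cp_inj X) (cp_inj X) (pure_tens a b) =
  pure_tens (cp_inj X a) (cp_inj X b).
Proof. by rewrite hom_mul tens_map_inl tens_map_inr. Qed.

Lemma cp_inj_unitary u : unitary (cp_inj X u).
Proof.
have [u1 u2] := int_unitary u.
by split; rewrite -hom_star -hom_mul ?u1 ?u2 hom_one.
Qed.

Lemma cp_inj_comul u : comul GG (cp_inj X u) = pure_tens (cp_inj X u) (cp_inj X u).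
Proof. by rewrite cp_comul_inj int_comul tens_map_pure. Qed.

Definition cp_jint u : intg GG := IntG (cp_inj_unitary u) (cp_inj_comul u).

Lemma cp_jintM u v : cp_jint (u * v)%g = (cp_jint u * cp_jint v)%g.
Proof. by apply: int_val_inj; exact: hom_mul. Qed.

Lemma cp_jint_act g u :
  cp_jint (int_act alpha g u) = (cp_uint g * cp_jint u * (cp_uint g)^-1)%g.
Proof. by apply: int_val_inj; rewrite /= -(cp_covariant X). Qed.

(** Unitarity and group-likeness descend along the injections of [G] and of its tensor square. *)
Lemma cp_jint_surj w a : int_val w = cp_inj X a -> exists u, w = cp_jint u.
Proof.
move=> wa; have inj := @cp_inj_injective _ _ _ _ _ X.
have ua : unitary a.
  have [w1 w2] := int_unitary w.
  by split; apply: inj; rewrite hom_mul hom_star hom_one -wa.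
have ca : comul G a = pure_tens a a.
  apply: (@cp_inj2_injective _ _ _ _ _ X).
  by rewrite tens_map_pure -(cp_comul_inj X) -wa int_comul.
by exists (IntG ua ca); apply: int_val_inj.
Qed.

Lemma rep_unitary_norm (H : hilbertType R) (theta : starrep GG H) w x :
  `|theta w x| = `|x|.
Proof.
apply/eqP; rewrite -(@eqrXn2 _ 2)// !dot_norm rep_star -rep_mul.
by have [_ ->] := int_unitary w; rewrite rep_one.
Qed.

Section Slice.
Variables (H : hilbertType R) (pi : starrep G H) (theta : starrep GG (rkhs (ksum Gam H))).
Hypothesis thetaJ : forall a g x,
  theta (cp_inj X a) (ksum_inj g x) = ksum_inj g (pi (alpha g^-1%g a) x).
Hypothesis thetaU : forall g h x,
  theta (cp_u X g) (ksum_inj h x) = ksum_inj (g * h)%g x.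
Variables (g : Gam) (x e : H).

Local Notation tts := (tens_sum (tinl (cqg_sq GG)) (tinr (cqg_sq GG))).

Let phi (y : GG) : R[i] := dot (theta y (ksum_inj g x)) (ksum_inj g e).

Let phiZ c y : phi (c *: y) = c * phi y.
Proof. by rewrite /phi repZl dotZl. Qed.

(** The element moves the summand [g] to the orthogonal summand [h g]. *)
Let phi_gen a h : h != 1%g -> phi (cp_inj X a ** cp_u X h) = 0.
Proof.
move=> h1; rewrite /phi rep_mul thetaU thetaJ ksum_inj_dot.
by rewrite -[X in _ == X]mul1g (inj_eq (mulIg g)) (negbTE h1).
Qed.

Let slice (s : seq (GG * GG)) : GG := \sum_(p <- s) phi p.1 *: p.2.

(** Stands for the slice of [z] lying in the closed range of [cp_inj], phrased with finite sums
    instead of a slice map on the completion. *)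
Let sliced (z : cqg_sq GG) : Prop := forall d : R[i], 0 < d ->
  exists s, `|z - tts s| <= d /\ exists a, slice s = cp_inj X a.

Let slice_cat s t : slice (s ++ t) = slice s + slice t.
Proof. exact: big_cat. Qed.

Let slice_scale c s : slice (tscale c s) = c *: slice s.
Proof.
rewrite /slice big_map scaler_sumr; apply: eq_bigr => p _.
by rewrite phiZ scalerA.
Qed.

Let norm_pure_u h : `|pure_tens (cp_u X h) (cp_u X h) : cqg_sq GG| <= 1.
Proof.
have u1 : `|cp_u X h| <= 1.
  rewrite -(@ler_pXn2r _ 2) ?nnegrE// -cstar_norm expr1n.
  by have [_ ->] := (cp_u_rep X).1 h; rewrite norm_cone.
rewrite (le_trans (normM_le _ _))// -[1]mulr1.
by rewrite ler_pM// (le_trans (hom_le_norm _ _)).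
Qed.

(** The comultiplication is the image of [comul a] times [u_h (x) u_h], so the approximants have
    legs [inj(b) u_h]: [phi] kills them for [h <> 1], and for [h = 1] the second legs lie in the
    range. *)
Let sliced_gen a h : sliced (comul GG (cp_inj X a ** cp_u X h)).
Proof.
move=> d d0; have [s0 /ltW as0] := tens_sum_dense (comul G a) d0.
pose s := [seq (cp_inj X p.1 ** cp_u X h, cp_inj X p.2 ** cp_u X h) | p <- s0].
exists s; split.
  rewrite hom_mul cp_comul_u cp_comul_inj.
  have -> : tts s = tens_map (cqg_sq G) (cqg_sq GG) (cp_inj X) (cp_inj X)
      (tens_sum (tinl (cqg_sq G)) (tinr (cqg_sq G)) s0) **
      pure_tens (cp_u X h) (cp_u X h).
    rewrite hom_tens_sum cmul_suml /tens_sum big_map; apply: eq_bigr => p _ /=.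
    by rewrite tens_map_inl tens_map_inr pure_tensM.
  rewrite -cmulBl -hom_sub (le_trans (normM_le _ _))// -[d]mulr1.
  by rewrite ler_pM// (le_trans (hom_le_norm _ _)).
have [h1|h1] := eqVneq h 1%g; last first.
  exists 0; rewrite hom0 /slice big_map big1// => p _ /=.
  by rewrite phi_gen// scale0r.
exists (\sum_(p <- s0) phi (cp_inj X p.1 ** cp_u X h) *: p.2).
have u1 : cp_u X h = cone by rewrite h1; exact: (congr1 (@int_val R GG) cp_uint1).
rewrite /slice big_map; elim: s0 {as0 s} => [|p s0 IH].
  by rewrite !big_nil hom0.
by rewrite !big_cons hom_linear IH u1 !cmulx1.
Qed.

Let sliced_lin c z z' : sliced z -> sliced z' -> sliced (c *: z + z').
Proof.
move=> sz sz' d d0.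
have c1 : 0 < `|c| + 1 by rewrite ltr_wpDl.
have d1 : 0 < d / (`|c| + 1) by rewrite divr_gt0.
have [s [zs [a sa]]] := sz _ d1; have [s' [zs' [a' sa']]] := sz' _ d1.
exists (tscale c s ++ s'); split.
  rewrite tens_sum_cat tens_sum_scale opprD addrACA -scalerBr.
  rewrite (le_trans (ler_normD _ _))// normrZ.
  have -> : d = `|c| * (d / (`|c| + 1)) + d / (`|c| + 1).
    by rewrite -[X in _ * _ + X]mul1r -mulrDl mulrCA divff ?mulr1// gt_eqF.
  by rewrite lerD// ler_wpM2l.
by exists (c *: a + a'); rewrite slice_cat slice_scale sa sa' hom_linear.
Qed.

Let sliced_span y :
  lin_span [set x | exists a g, x = cp_inj X a ** cp_u X g] y ->
  sliced (comul GG y).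
Proof.
move: y; apply: lin_span_ind => [|c _ y [a [h ->]] IH].
  rewrite hom0 => d d0; exists [::]; rewrite /tens_sum /slice !big_nil.
  by rewrite subr0 normr0 ltW//; split=> //; exists 0; rewrite hom0.
by rewrite hom_linear; apply: sliced_lin => //; exact: sliced_gen.
Qed.

(* Slicing [comul w = w (x) w] by [phi] leaves a multiple of [w]. *)
Lemma grouplike_slice w : phi w != 0 -> exists a, int_val w = cp_inj X a.
Proof.
move=> phiw; suff [a aw] : exists a, cp_inj X a = phi w *: (w : GG).
  by exists ((phi w)^-1 *: a); rewrite homZ aw scalerA mulVf// scale1r.
apply: isometric_hom_range_closed; first exact: cp_inj_norm.
move=> d d0; set C := `|ksum_inj g x| * `|ksum_inj g e|.
have C0 : 0 <= C by rewrite mulr_ge0.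
have C1 : 0 < C + 1 by rewrite ltr_wpDl.
(* Two errors of size [r] enter, from [w] to [y] and from [comul y] to a finite sum, and slicing
   multiplies them by at most [C]. *)
have r0 : 0 < d / (2 * (C + 1)) by rewrite divr_gt0// mulr_gt0.
set r := d / _ in r0.
have [y Sy wy] := dense_approx (w : GG) (cp_generated X) r0.
have [s [ys [a sa]]] := sliced_span Sy r0.
exists a; have := norm_slice_tens_le (cqg_sq GG) theta (ksum_inj g x) (ksum_inj g e)
  ((w : GG, w : GG) :: tscale (-1) s).
rewrite -[\sum_(p <- _) _]/(slice _) -cat1s slice_cat slice_scale sa scaleN1r.
rewrite /slice big_seq1 => h; apply: (le_trans h).
rewrite -/C tens_sum_cat tens_sum_scale scaleN1r /tens_sum big_seq1 -/(tens_sum _ _ s).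
rewrite -[_ ** _]/(pure_tens _ _) -int_comul -(subrKA (comul GG y)).
rewrite (split_scaled d C0) -/r ler_pM ?lerDl// (le_trans (ler_normD _ _))//.
by rewrite lerD// -hom_sub (le_trans (hom_le_norm _ _))// ltW.
Qed.

End Slice.

(** The label [g] is that of a summand where the image of a unit vector of the summand of 1 has a
    nonzero component; dividing by [cp_u g] makes a diagonal coefficient nonzero. *)
Lemma grouplike_crossed w : exists g u, w = (cp_jint u * cp_uint g)%g.
Proof.
have [H [pi [x [x1 _]]]] := exists_norm_attaining_rep (cone : G).
have [|theta [thJ thU]] := @induced_rep _ _ _ _ _ X H pi.
  by exists x; exact: norm1_neq0.
pose k := theta w (ksum_inj 1%g x).
have k1 : `|k| = 1 by rewrite rep_unitary_norm norm_ksum_inj.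
(* Otherwise [k] is orthogonal to what any [y] of the generating span makes of the starting vector;
   a [y] within 1 of [w] then forces [|k|^2 < 1]. *)
have [[g [e ke]]|k0] := pselect (exists g e, dot k (ksum_inj g e) != 0); last first.
  exfalso; have k0' g e : dot k (ksum_inj g e) = 0.
    by apply/eqP/negP => kge; apply: k0; exists g, e; exact/negP.
  have [y Sy wy] := dense_approx (w : GG) (cp_generated X) (@ltr01 R[i]).
  have ky : dot k (theta y (ksum_inj 1%g x)) = 0.
    move: y Sy {wy}; apply: lin_span_ind => [|c _ y [a [h ->]] IH].
      by rewrite rep0l dot0r.
    by rewrite repDl repZl dotDr IH dotZr rep_mul thU thJ k0' mulr0 addr0.
  have : `|k| ^+ 2 < 1.
    rewrite dot_norm -[dot k k]subr0 -ky -dotBr -repBl.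
    have d0 : 0 <= dot k (theta ((w : GG) - y) (ksum_inj 1%g x)).
      by rewrite repBl dotBr ky subr0 dot_ge0.
    rewrite -(ger0_norm d0) (le_lt_trans (dot_cauchy_schwarz _ _))// k1 mul1r.
    by rewrite (le_lt_trans (rep_norm_le _ _ _))// norm_ksum_inj x1 mulr1.
  by rewrite k1 expr1n ltxx.
pose w' := (w * (cp_uint g)^-1)%g.
have [|a w'a] := grouplike_slice thJ thU (g := g) (x := x) (e := e) (w := w').
  rewrite /w' -cp_uintV [int_val _]/(w ** cp_u X g^-1%g) rep_mul thU mulVg.
  exact: ke.
have [u w'u] := cp_jint_surj w'a.
by exists g, u; rewrite -w'u mulgVK.
Qed.

(** With [u] on the left, moving [cp_u g] past the next factor produces the action of [g], as in the
    semidirect product. *)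
Definition cp_int (z : semidirect alpha) : intg GG := (cp_jint z.2 * cp_uint z.1)%g.

Lemma cp_int_morph : {morph cp_int : y z / (y * z)%g}.
Proof.
move=> [g u] [h v]; rewrite /cp_int /= cp_jintM cp_jint_act cp_uintM.
by rewrite !mulgA mulgVK.
Qed.

(** The image of [(g, u)] carries the summand of 1 to the summand [g], and different summands are
    orthogonal; then [cp_u g] cancels. *)
Lemma cp_int_inj : injective cp_int.
Proof.
move=> [g u] [h v]; rewrite /cp_int /= => E.
have [H [pi [x [x1 _]]]] := exists_norm_attaining_rep (cone : G).
have [|theta [thJ thU]] := @induced_rep _ _ _ _ _ X H pi.
  by exists x; exact: norm1_neq0.
have act k t : theta (cp_jint t * cp_uint k)%g (ksum_inj 1%g x) =
    ksum_inj k (pi (alpha k^-1%g t) x).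
  by rewrite rep_mul thU thJ mulg1.
have gh : g = h.
  apply/eqP; apply/negP => /negP gh.
  have := norm1_neq0 (H := rkhs (ksum Gam H))
    (x := theta (cp_jint u * cp_uint g)%g (ksum_inj 1%g x)).
  rewrite rep_unitary_norm norm_ksum_inj => /(_ x1).
  rewrite -normr_eq0 -sqrf_eq0 dot_norm {2}E !act ksum_inj_dot.
  by rewrite (negbTE gh) eqxx.
move: E; rewrite gh => /mulIg /(congr1 (@int_val R GG)) /= uv.
by congr (_, _); apply: int_val_inj; exact: cp_inj_injective uv.
Qed.

Lemma cp_int_bijective : bijective cp_int.
Proof.
have /choice[f fP] : forall w, exists z, cp_int z = w.
  by move=> w; have [g [u ->]] := grouplike_crossed w; exists (g, u).
by exists f => // z; apply: cp_int_inj; rewrite fP.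
Qed.

End CrossedInt.

(** * Characters of a crossed product *)

Lemma continuous_ptws (S : topologicalType) (U : Type) (V : topologicalType)
    (h : S -> {ptws U -> V}) :
  (forall u, continuous (fun x => h x u)) -> continuous h.
Proof.
move=> hc x; apply/cvg_sup => u.
exact: (@continuous_comp_initial (U -> V) S V (fun f : U -> V => f u) h (hc u)).
Qed.

(** * Topologies on the groups of characters *)

Section CharTopology.
Variables (R : realType) (G : cqg R).

Lemma char_eval_continuous (a : G) : continuous (fun x : character G => x a : cplx R).
Proof.
move=> x; apply: (@continuous_comp (character G) {ptws G -> cplx R} (cplx R)
  (fun x : character G => (x : G -> cplx R)) (fun f => f a)).
  exact: (@initial_continuous (character G) {ptws G -> cplx R}).
exact: (@proj_continuous _ (fun _ : G => cplx R) a).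
Qed.

Lemma continuous_char (S : topologicalType) (h : S -> character G) :
  (forall a, continuous (fun s => h s a : cplx R)) -> continuous h.
Proof.
move=> hc; apply: (@continuous_comp_initial (character G) S {ptws G -> cplx R}).
exact: continuous_ptws.
Qed.

End CharTopology.

Section SpTopology.
Variables (R : realType) (Gam : groupType).

Lemma Sp_eval_continuous (g : Gam) : continuous (fun x : Sp R Gam => x g : cplx R).
Proof.
move=> x; apply: (@continuous_comp (Sp R Gam) {ptws Gam -> cplx R} (cplx R)
  (fun x : Sp R Gam => (x : Gam -> cplx R)) (fun f => f g)).
  exact: (@initial_continuous (Sp R Gam) {ptws Gam -> cplx R}).
exact: (@proj_continuous _ (fun _ : Gam => cplx R) g).
Qed.

Lemma continuous_Sp (S : topologicalType) (h : S -> Sp R Gam) :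
  (forall g, continuous (fun s => h s g : cplx R)) -> continuous h.
Proof.
move=> hc; apply: (@continuous_comp_initial (Sp R Gam) S {ptws Gam -> cplx R}).
exact: continuous_ptws.
Qed.

Lemma Sp_ext (x y : Sp R Gam) : (forall g, x g = y g) -> x = y.
Proof.
case: x y => [x xn xm] [y yn ym] /= /funext xy; move: yn ym; rewrite -xy => yn ym.
by congr MkSp; exact: Prop_irrelevance.
Qed.

End SpTopology.

Section FixCharTopology.
Variables (R : realType) (Gam : groupType) (G : cqg R) (alpha : qaction Gam G).

Lemma fixchar_eval_continuous (a : G) :
  continuous (fun x : fixchar alpha => x a : cplx R).
Proof.
move=> x; apply: (@continuous_comp (fixchar alpha) (character G) (cplx R)
  (@fixchar_val R Gam G alpha) (fun c : character G => c a)).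
  exact: (@initial_continuous (fixchar alpha) (character G)).
exact: char_eval_continuous.
Qed.

Lemma continuous_fixchar (S : topologicalType) (h : S -> fixchar alpha) :
  (forall a, continuous (fun s => h s a : cplx R)) -> continuous h.
Proof.
move=> hc; apply: (@continuous_comp_initial (fixchar alpha) S (character G)).
exact: continuous_char.
Qed.

Lemma fixchar_ext (x y : fixchar alpha) : (forall a, x a = y a) -> x = y.
Proof.
case: x y => [x xf] [y yf] /= xy; have e : x = y by exact: starhom_eq.
by move: yf; rewrite -e => yf; congr FixChar; exact: Prop_irrelevance.
Qed.

End FixCharTopology.

Lemma starhom_eq_dense (R : realType) (A B : cstarType R) (S : set A)
    (f g : starhom A B) : dense S -> (forall x, S x -> f x = g x) -> f = g.
Proof.
move=> dS fg; apply: starhom_eq => y; apply/eqP; rewrite -subr_eq0; apply/eqP.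
apply: (@norm_eq0_approx _ _ _ 2) => // e e0.
have [x Sx yx] := dense_approx y dS e0.
rewrite -(subrKA (f x)) (le_trans (ler_normD _ _))// mulr_natl mulr2n.
have -> : f x - g y = g (x - y) by rewrite hom_sub (fg x Sx).
rewrite -hom_sub lerD// (le_trans (hom_le_norm _ _))//.
  exact: ltW.
by rewrite distrC ltW.
Qed.

Section CrossedCharacters.
Variables (R : realType) (Gam : groupType) (G : cqg R) (alpha : qaction Gam G).
Variables (GG : cqg R) (X : crossed_product alpha GG).
Implicit Types (a : G) (g h : Gam) (chi : character GG).

Local Notation gens := (lin_span [set x : GG | exists a g, x = cp_inj X a ** cp_u X g]).

Lemma hom_eq_gens (B : cstarType R) (f f' : starhom GG B) :
  (forall a, f (cp_inj X a) = f' (cp_inj X a)) ->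
  (forall g, f (cp_u X g) = f' (cp_u X g)) -> f = f'.
Proof.
move=> fi fu; apply: (starhom_eq_dense (cp_generated X)) => x.
move: x; apply: lin_span_ind => [|c _ y [a [g ->]] IH]; first by rewrite !hom0.
by rewrite !hom_linear IH !hom_mul fi fu.
Qed.

Lemma comp_hom (A B D : cstarType R) (f : starhom B D) (p : starhom A B) :
  starhom_on setT (fun x => f (p x)).
Proof.
split.
- by move=> c x y _ _; rewrite !hom_linear.
- by move=> x y _ _; rewrite !hom_mul.
- by rewrite !hom_one.
- by move=> x _; rewrite !hom_star.
Qed.

Definition char_res chi : character G := StarHom (comp_hom chi (cp_inj X)).

Lemma char_u_norm chi g : `|chi (cp_u X g)| = 1.
Proof.
apply/eqP; rewrite -(@eqrXn2 _ 2)// expr1n normCK.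
have [u1 _] := (cp_u_rep X).1 g.
by have := hom_one chi; rewrite -u1 hom_mul hom_star => /eqP.
Qed.

(** Scalars commute, so the value at [cp_u g] meets its conjugate and their product is 1. *)
Lemma char_res_fixed chi g a : char_res chi (alpha g a) = char_res chi a.
Proof.
rewrite /= -(cp_covariant X) !hom_mul hom_star.
rewrite [LHS]mulrAC -[_ * (_)^*]normCK char_u_norm expr1n mul1r //.
Qed.

Definition cp_Phi chi : fixchar alpha * Sp R Gam :=
  (FixChar (char_res_fixed chi),
   MkSp (char_u_norm chi)
     (fun g h => etrans (congr1 chi ((cp_u_rep X).2 g h)) (hom_mul chi _ _))).

(** Covariance of the scalar pair is precisely invariance of [z.1] under [alpha]. *)
Lemma cp_Psi_exists (z : fixchar alpha * Sp R Gam) : exists chi : character GG,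
  (forall a, chi (cp_inj X a) = z.1 a) /\ (forall g, chi (cp_u X g) = z.2 g).
Proof.
have n1 g : (z.2 g : R[i]) * (z.2 g)^* = 1 by rewrite -normCK Sp_norm expr1n.
apply: (@cp_universal _ _ _ _ _ X (cplx R) (fixchar_val z.1) (Sp_fun z.2)).
  split; last exact: Sp_morph.
  by move=> g; split; [|rewrite [LHS]mulrC]; exact: n1.
move=> g a; apply: etrans (esym (fixchar_fixed z.1 g a)).
rewrite [LHS]mulrAC.
exact: etrans (congr1 (fun c : R[i] => c * _) (n1 g)) (mul1r _).
Qed.

Definition cp_Psi z : character GG := projT1 (cid (cp_Psi_exists z)).

Lemma cp_Psi_inj z a : cp_Psi z (cp_inj X a) = z.1 a.
Proof. by rewrite /cp_Psi; case: cid => chi []. Qed.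

Lemma cp_Psi_u z g : cp_Psi z (cp_u X g) = z.2 g.
Proof. by rewrite /cp_Psi; case: cid => chi []. Qed.

Lemma cp_PhiK : cancel cp_Phi cp_Psi.
Proof.
by move=> chi; apply: hom_eq_gens => [a|g]; [exact: cp_Psi_inj|exact: cp_Psi_u].
Qed.

Lemma cp_PsiK : cancel cp_Psi cp_Phi.
Proof.
move=> [x y]; rewrite /cp_Phi; congr (_, _).
  by apply: fixchar_ext => a; exact: cp_Psi_inj.
by apply: Sp_ext => g; exact: cp_Psi_u.
Qed.

(** Two contractive homomorphisms on the tensor square that agree on both legs. *)
Lemma char_tens_inj2 chi chi' (z : cqg_sq G) :
  char_tens chi chi' (tens_map (cqg_sq G) (cqg_sq GG) (cp_inj X) (cp_inj X) z) =
  char_tens (char_res chi) (char_res chi') z.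
Proof.
apply: (tens_hom_eq (f := StarHom (comp_hom (char_tens chi chi')
  (tens_map (cqg_sq G) (cqg_sq GG) (cp_inj X) (cp_inj X))))) => [x|x|a|a] /=.
- exact: (hom_le_norm (StarHom (comp_hom _ _))).
- exact: hom_le_norm.
- rewrite tens_map_inl; have := char_tensE chi chi' (cp_inj X a) cone.
  have := char_tensE (char_res chi) (char_res chi') a cone.
  by rewrite /pure_tens !hom_one !cmulx1 => -> ->.
- rewrite tens_map_inr; have := char_tensE chi chi' cone (cp_inj X a).
  have := char_tensE (char_res chi) (char_res chi') cone a.
  by rewrite /pure_tens !hom_one !cmul1x => -> ->.
Qed.

Lemma cp_Phi_morph : {morph cp_Phi : x y / (x * y)%g}.
Proof.
move=> chi chi'; congr (_, _).
  apply: fixchar_ext => a.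
  by rewrite [LHS](congr1 (char_tens chi chi') (cp_comul_inj X a)) char_tens_inj2.
apply: Sp_ext => g.
by rewrite [LHS](congr1 (char_tens chi chi') (cp_comul_u X g)) char_tensE.
Qed.

Lemma cp_Phi_continuous : continuous cp_Phi.
Proof.
have c1 : continuous (fun chi => (cp_Phi chi).1).
  by apply: continuous_fixchar => a; exact: (@char_eval_continuous R GG (cp_inj X a)).
have c2 : continuous (fun chi => (cp_Phi chi).2).
  by apply: continuous_Sp => g; exact: (@char_eval_continuous R GG (cp_u X g)).
move=> chi; exact: (cvg_pair (c1 chi) (c2 chi)).
Qed.

(** On the span of the generators the values are finite combinations of products [z.1 a * z.2 g];
    contractivity, uniform in [z], reaches all other elements. *)
Lemma cp_Psi_continuous : continuous cp_Psi.
Proof.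
apply: continuous_char => y z.
have gen x : gens x -> (fun z => cp_Psi z x : cplx R) @ z --> (cp_Psi z x : cplx R).
  move: x; apply: lin_span_ind => [|c _ x [a [g ->]] IH].
    have E z' : cp_Psi z' 0 = 0 :> cplx R by exact: (@hom0 R GG (cplx R)).
    by under eq_fun do rewrite E; rewrite E; exact: cvg_cst.
  have E z' : cp_Psi z' (c *: (cp_inj X a ** cp_u X g) + x) =
      c *: (z'.1 a * z'.2 g : cplx R) + cp_Psi z' x :> cplx R.
    rewrite [LHS](@hom_linear R GG (cplx R)) [in LHS](@hom_mul R GG (cplx R)).
    congr (c *: _ + _).
    exact: (congr2 (fun p q : R[i] => p * q) (cp_Psi_inj z' a) (cp_Psi_u z' g)).
  under eq_fun do rewrite E; rewrite E.
  apply: (@cvgD R[i] (cplx R)); last exact: IH.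
  apply: (@cvgZr R[i] (cplx R)).
  apply: (@cvgM R[i]).
  - apply: (@cvg_comp _ _ _ (@fst (fixchar alpha) (Sp R Gam))
      (fun x : fixchar alpha => x a : cplx R) _ (nbhs z.1)); first exact: cvg_fst.
    exact: (@fixchar_eval_continuous R Gam G alpha a z.1).
  - apply: (@cvg_comp _ _ _ (@snd (fixchar alpha) (Sp R Gam))
      (fun x : Sp R Gam => x g : cplx R) _ (nbhs z.2)); first exact: cvg_snd.
    exact: (@Sp_eval_continuous R Gam g z.2).
(* Replacing [y] by [x] costs at most [e / 4] at [z] and at [z'] alike, which leaves [e / 2] for the
   convergence at [x]. *)
apply/cvgrPdist_le => e e0; have e4 : 0 < e / 4 by rewrite divr_gt0.
have [x Sx yx] := dense_approx y (cp_generated X) e4.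
have e2 : 0 < e / 2 by rewrite divr_gt0.
have /cvgrPdist_le /(_ _ e2) := gen _ Sx.
apply: filterS => z' zz'.
have subE t : cp_Psi t (y - x) = cp_Psi t y - cp_Psi t x :> cplx R.
  exact: (@hom_sub R GG (cplx R)).
have le t : `|cp_Psi t (y - x) : cplx R| <= e / 4.
  by apply: le_trans (ltW yx); exact: (@hom_le_norm R GG (cplx R)).
have -> : (cp_Psi z y : cplx R) - cp_Psi z' y =
  cp_Psi z (y - x) + ((cp_Psi z x - cp_Psi z' x) - cp_Psi z' (y - x)).
  by rewrite !subE; ring.
have -> : e = e / 4 + (e / 2 + e / 4) by field.
rewrite (le_trans (ler_normD _ _))// lerD ?le//.
by rewrite (le_trans (ler_normB _ _))// lerD ?le.
Qed.

End CrossedCharacters.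

Theorem proposition6p5 (R : realType) (Gam : groupType)
    (countable_Gam : countable [set: Gam]) (G : cqg R)
    (alpha : qaction Gam G) (GG : cqg R) (X : crossed_product alpha GG) :
  (exists F : semidirect alpha -> intg GG,
     [/\ bijective F,
         {morph F : x y / (x * y)%g} &
         forall (g : Gam) (u : intg G),
           int_val (F (g, u)) = cp_inj X u ** cp_u X g]) /\
  (exists (Phi : character GG -> fixchar alpha * Sp R Gam)
          (Psi : fixchar alpha * Sp R Gam -> character GG),
     [/\ cancel Phi Psi /\ cancel Psi Phi,
         {morph Phi : x y / (x * y)%g},
         continuous Phi,
         continuous Psi &
         forall chi : character GG,
           (forall a : G, (Phi chi).1 a = chi (cp_inj X a)) /\
           (forall g : Gam, (Phi chi).2 g = chi (cp_u X g))]).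
Proof.
split.
  exists (@cp_int R Gam G alpha GG X); split=> //.
    exact: cp_int_bijective.
  exact: cp_int_morph.
exists (cp_Phi X), (cp_Psi X); split=> //.
- by split; [exact: cp_PhiK|exact: cp_PsiK].
- exact: cp_Phi_morph.
- exact: cp_Phi_continuous.
- exact: cp_Psi_continuous.
Qed.
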